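(* Fix a constant $n\in\mathbb{N}$. There is an algorithm that, given a smooth multivalued d-DNNF circuit $C$ on domain $D$ with $n$ variables $X$ and a subset-monotone $(D,X)$-ranking function $w$, enumerates all assignments in $\mathrm{rel}(C)$, without duplicates and in nonincreasing order of $w$-score (ties broken arbitrarily), with preprocessing time $O(|C|)$ and delay $O(\log(K+1))$, where $K$ is the number of assignments produced so far.
   Context: An assignment on domain $D$ and variables $X$ is a map $X\to D$; a singleton assignment $[x\mapsto d]$. For $R\subseteq D^Y$, $S\subseteq D^Z$: $R\wedge S=\{\tau\bowtie\sigma\mid\tau\in R,\sigma\in S,\tau,\sigma$ agree on $Y\cap Z\}$ and $R\vee S=\{\tau\in D^{Y\cup Z}\mid \tau|_Y\in R$ or $\tau|_Z\in S\}$. A multivalued circuit on $D$ and $X$ is a DAG with a distinguished output gate; each input gate (no incoming edges) is labeled $\langle x:d\rangle$ with $x\in X,d\in D$, and each other gate is labeled $\vee$ or $\wedge$. $|C|$ is the number of edges. $\mathrm{var}(v)$ is the set of variables of input gates with a path to $v$; it is assumed $X=\mathrm{var}(r)$ for the output gate $r$. $\mathrm{rel}(v)\subseteq D^{\mathrm{var}(v)}$ is $\{[x\mapsto d]\}$ for an input $\langle x:d\rangle$, and $\mathrm{rel}(v_1)\ \mathrm{op}\cdots\mathrm{op}\ \mathrm{rel}(v_k)$ for an internal gate labeled $\mathrm{op}$ with inputs $v_1,\dots,v_k$; $\mathrm{rel}(C)$ is $\mathrm{rel}$ of the output gate. A $\wedge$-gate is decomposable if its inputs have pairwise disjoint variable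 sets; a $\vee$-gate is smooth if all inputs have the same variable set; a $\vee$-gate $v$ is deterministic if for all distinct inputs $v_1\ne v_2$ and every $\tau\in\mathrm{rel}(v)$, not both $\tau|_{\mathrm{var}(v_1)}\in\mathrm{rel}(v_1)$ and $\tau|_{\mathrm{var}(v_2)}\in\mathrm{rel}(v_2)$. A smooth multivalued d-DNNF is a multivalued circuit where every $\wedge$-gate is decomposable and every $\vee$-gate is smooth and deterministic. Partial assignments are maps $X\to D\cup\{\bot\}$; a $(D,X)$-ranking function $w$ maps partial assignments to reals (assumed computable in time depending only on $X$, not $D$); it is subset-monotone if for every $Y\subseteq X$, all partial assignments $\tau_1,\tau_2$ on $Y$ with $w(\tau_1)\le w(\tau_2)$ and all partial assignments $\sigma$ on $X\setminus Y$, $w(\sigma\times\tau_1)\le w(\sigma\times\tau_2)$ (a partial assignment on $Y\subseteq X$ is evaluated by $w$ after extending it with $\bot$ outside $Y$, and $\times$ combines partial assignments on disjoint variable sets). The computational model is the RAM model with words of logarithmic size. *)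

(* Defs.v *)
From HB Require Import structures.
From mathcomp Require Import all_boot all_order all_algebra.
From mathcomp Require Import reals.
Set Implicit Arguments. Unset Strict Implicit. Unset Printing Implicit Defensive.
Import Order.TTheory GRing.Theory Num.Theory.
Local Open Scope ring_scope.

(* Multivalued circuits on the domain D = 'I_m and variables X = 'I_n.        *)
(* Gates are numbered 0 .. size (gates C) - 1; a gate lists the numbers of    *)
(* its input gates (its incoming edges).                                      *)
Section Circuits.
Variables (n m : nat).

Inductive gate :=
| GInp of 'I_n & 'I_m
| GOr  of seq nat
| GAnd of seq nat.

Record circuit := Circuit { gates : seq gate; outg : nat }.

Definition gins (g : gate) : seq nat :=
  match g with GInp _ _ => [::] | GOr s => s | GAnd s => s end.

Definition gate_at (C : circuit) (v : nat) : gate := nth (GOr [::]) (gates C) v.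
Definition edges (C : circuit) (v : nat) : seq nat := gins (gate_at C v).

Definition circuit_size (C : circuit) : nat := (\sum_(g <- gates C) size (gins g))%N.

Definition wf_circuit (C : circuit) : Prop :=
  [/\ (outg C < size (gates C))%N,
      forall v, (v < size (gates C))%N ->
        all (fun u => u < size (gates C))%N (edges C v) && uniq (edges C v),
      forall v, (v < size (gates C))%N ->
        (match gate_at C v with GInp _ _ => True | _ => edges C v <> [::] end)
    & exists rk : nat -> nat, forall v u, (v < size (gates C))%N ->
        u \in edges C v -> (rk u < rk v)%N ].

Inductive reach (C : circuit) : nat -> nat -> Prop :=
| reach_refl v : reach C v v
| reach_step u w v : reach C u w -> w \in edges C v -> reach C u v.

Definition invar (C : circuit) (v : nat) (x : 'I_n) : Prop :=
  exists u d, reach C u v /\ gate_at C u = GInp x d.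

(* Partial assignments X -> D \cup {bot}; None stands for bot.  An assignment
   on a set Y of variables is represented by the partial assignment that is
   bot outside Y. *)
Definition passign := {ffun 'I_n -> option 'I_m}.

Definition on_var (C : circuit) (v : nat) (tau : passign) : Prop :=
  forall x, tau x <> None <-> invar C v x.

Definition agrees_on (C : circuit) (u : nat) (sigma tau : passign) : Prop :=
  forall x, invar C u x -> sigma x = tau x.

(* relg C v tau  <->  tau \in rel(v).  For an internal gate v with inputs
   v_1..v_k, rel(v_1) /\ ... /\ rel(v_k) is the set of tau on var(v) whose
   restrictions to every var(v_i) lie in rel(v_i), and rel(v_1) \/ ... \/
   rel(v_k) is the set of tau on var(v) whose restriction to some var(v_i)
   lies in rel(v_i).  "tau|_var(u) \in rel(u)" is expressed as: some sigma in
   rel(u) agrees with tau on var(u). *)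
Inductive relg (C : circuit) : nat -> passign -> Prop :=
| relg_inp v x d (tau : passign) :
    gate_at C v = GInp x d ->
    (forall y, tau y = if y == x then Some d else None) -> relg C v tau
| relg_and v s (tau : passign) :
    gate_at C v = GAnd s -> on_var C v tau ->
    (forall u, u \in s -> exists2 sigma, relg C u sigma & agrees_on C u sigma tau) ->
    relg C v tau
| relg_or v s (tau : passign) :
    gate_at C v = GOr s -> on_var C v tau ->
    (exists2 u, u \in s & exists2 sigma, relg C u sigma & agrees_on C u sigma tau) ->
    relg C v tau.

Definition restr_in_rel (C : circuit) (u : nat) (tau : passign) : Prop :=
  exists2 sigma, relg C u sigma & agrees_on C u sigma tau.

Definition decomposable (C : circuit) : Prop :=
  forall v s, gate_at C v = GAnd s -> forall u1 u2, u1 \in s -> u2 \in s ->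
    u1 <> u2 -> forall x, ~ (invar C u1 x /\ invar C u2 x).

Definition smooth (C : circuit) : Prop :=
  forall v s, gate_at C v = GOr s -> forall u1 u2, u1 \in s -> u2 \in s ->
    forall x, invar C u1 x <-> invar C u2 x.

Definition deterministic (C : circuit) : Prop :=
  forall v s, gate_at C v = GOr s -> forall u1 u2, u1 \in s -> u2 \in s ->
    u1 <> u2 -> forall tau, relg C v tau ->
    ~ (restr_in_rel C u1 tau /\ restr_in_rel C u2 tau).

Definition smooth_dDNNF (C : circuit) : Prop :=
  [/\ decomposable C, smooth C & deterministic C].

(* standing assumption X = var(r) *)
Definition covers_all_vars (C : circuit) : Prop := forall x, invar C (outg C) x.

Definition lift (a : {ffun 'I_n -> 'I_m}) : passign := [ffun x => Some (a x)].

Definition pcombine (Y : {set 'I_n}) (sigma tau : passign) : passign :=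
  [ffun x => if x \in Y then tau x else sigma x].

Definition subset_monotone (R : realType) (w : passign -> R) : Prop :=
  forall (Y : {set 'I_n}) (t1 t2 sigma : passign),
    (forall x, x \notin Y -> t1 x = None /\ t2 x = None) ->
    (forall x, x \in Y -> sigma x = None) ->
    w t1 <= w t2 -> w (pcombine Y sigma t1) <= w (pcombine Y sigma t2).

Definition enc_gate (g : gate) : seq nat :=
  match g with
  | GInp x d => [:: 0%N; nat_of_ord x; nat_of_ord d]
  | GOr s => 1%N :: size s :: s
  | GAnd s => 2%N :: size s :: s
  end.

Fixpoint offsets (base : nat) (l : seq (seq nat)) : seq nat :=
  match l with [::] => [::] | e :: l' => base :: offsets (base + size e) l' end.

Definition encode (C : circuit) : seq nat :=
  let encs := map enc_gate (gates C) in
  [:: size (gates C); outg C] ++ offsets (2 + size (gates C)) encs ++ flatten encs.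

End Circuits.

(* Word RAM with an oracle for the ranking function.                          *)
(*  - integer registers M : nat -> nat; every value written must be < B,      *)
(*    where B = N^c is the word bound (words of logarithmic size) and N is   *)
(*    the input length plus the largest input word plus 2; exceeding it makes *)
(*    the machine fail;                                                       *)
(*  - real registers (holding scores) that can only be copied, filled by an   *)
(*    oracle call to w (unit cost; w is computable in time depending only on  *)
(*    X, which is constant as n is fixed), and compared.                      *)
Inductive instr :=
| IConst of nat & nat
| IAdd of nat & nat & nat
| ISub of nat & nat & nat
| IMul of nat & nat & nat
| IDiv of nat & nat & nat
| IMod of nat & nat & nat
| ILoad of nat & nat
| IStore of nat & nat
| IRead of nat & nat
| ILen of nat
| IJle of nat & nat & nat
| IOracle of nat & nat           (* S[r] := w(tau), tau x decoded from M[a+x]: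
                                    0 = bot, d+1 = d (fails if d >= m) *)
| IRMov of nat & nat
| IRJle of nat & nat & nat
| IOutput of nat
| IHalt.

Section RAM.
Variables (n m : nat) (R : realType).
Variables (P : seq instr) (B : nat) (input : seq nat) (w : passign n m -> R).

Record state := State { pc : nat; mem : nat -> nat; smem : nat -> R }.

Inductive outcome :=
| OHalt | OStuck | ONext of state & option (passign n m).

Definition upd {T} (f : nat -> T) (i : nat) (v : T) : nat -> T :=
  fun j => if j == i then v else f j.

Definition read_passign (M : nat -> nat) (a : nat) : option (passign n m) :=
  if [forall x : 'I_n, M (a + x)%N <= m]%N
  then Some [ffun x : 'I_n => if M (a + x)%N is d.+1 then insub d else None]
  else None.

Definition read_assign (M : nat -> nat) (a : nat) : option (passign n m) :=
  if [forall x : 'I_n, M (a + x)%N < m]%N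
  then Some [ffun x : 'I_n => insub (M (a + x)%N)]
  else None.

Definition step (st : state) : outcome :=
  let M := mem st in
  let S := smem st in
  let next := (pc st).+1 in
  let setM r v := if (v < B)%N then ONext (State next (upd M r v) S) None
                  else OStuck in
  if (pc st < size P)%N then
  match nth IHalt P (pc st) with
  | IConst r k => setM r k
  | IAdd r a b => setM r (M a + M b)%N
  | ISub r a b => setM r (M a - M b)%N
  | IMul r a b => setM r (M a * M b)%N
  | IDiv r a b => setM r (M a %/ M b)%N
  | IMod r a b => setM r (M a %% M b)%N
  | ILoad r a => setM r (M (M a))
  | IStore a b => setM (M a) (M b)
  | IRead r a => setM r (nth 0%N input (M a))
  | ILen r => setM r (size input)
  | IJle a b l => ONext (State (if (M a <= M b)%N then l else next) M S) None
  | IOracle r a =>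
      match read_passign M a with
      | Some tau => ONext (State next M (upd S r (w tau))) None
      | None => OStuck
      end
  | IRMov r a => ONext (State next M (upd S r (S a))) None
  | IRJle a b l => ONext (State (if S a <= S b then l else next) M S) None
  | IOutput a =>
      match read_assign M a with
      | Some tau => ONext (State next M S) (Some tau)
      | None => OStuck
      end
  | IHalt => OHalt
  end
  else OStuck.

(* exec fuel t st = (trace, status): trace lists (time, output) pairs, where
   time = number of steps executed when the output is produced; status is
   Some T if the machine halts after T steps within the fuel, None if it
   fails or runs out of fuel. *)
Fixpoint exec (fuel t : nat) (st : state) : seq (nat * passign n m) * option nat :=
  match fuel with
  | 0 => ([::], None)
  | f.+1 =>
    match step st with
    | OHalt => ([::], Some t)
    | OStuck => ([::], None)
    | ONext st' o =>
        let r := exec f t.+1 st' in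
        (if o is Some a then (t.+1, a) :: r.1 else r.1, r.2)
    end
  end.

Definition init_state : state := State 0 (fun _ => 0%N) (fun _ => 0).

End RAM.

Definition word_bound (c : nat) (input : seq nat) : nat :=
  ((size input + \max_(e <- input) e + 2) ^ c)%N.

Definition enumerates (n m : nat) (R : realType) (P : seq instr) (c : nat)
    (C : circuit n m) (w : passign n m -> R) : Prop :=
  let input := encode C in
  exists fuel tr T,
    exec P (word_bound c input) input w fuel 0 (init_state R) = (tr, Some T) /\
    let outs := map snd tr in
    let times := rcons (map fst tr) T in
    [/\ uniq outs /\
        all (fun tau : passign n m => [forall x, tau x != None]) outs,
        (forall a : {ffun 'I_n -> 'I_m}, lift a \in outs <-> relg C (outg C) (lift a)),
        sorted (fun t1 t2 : passign n m => w t2 <= w t1) outs,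
        (nth 0%N times 0 <= c * (circuit_size C).+1)%N
      & forall k, (0 < k < size times)%N ->
          (nth 0%N times k - nth 0%N times k.-1 <= c * (trunc_log 2 k.+1).+1)%N].

(* Main.v *)
(* Lawler's procedure on the circuit unfolded into binary gates. By subset-monotonicity
   the best assignment of a disjunction is the better one of its inputs, and that of a
   conjunction combines those of its inputs. A subproblem is the choice of an alternative
   in a segment of a chain of disjunctions, followed by pending conjuncts, all other
   variables being fixed. Without its best assignment it splits into at most 2n + 1
   subproblems: the two parts of the segment, and one for each chain met while descending
   to the leaves along the best assignment; conjunctions having disjoint inputs, fewer
   than 2n chains are met. The best alternative of a segment is found in logarithmic time
   with Myers' skew-binary jump pointers, each storing the best alternative it jumps over,
   and the subproblems are queued in a tournament tree. Correctness is one invariant: for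
   every assignment, its number of occurrences in the output plus the number of queued
   subproblems containing it is 1 if it belongs to rel(C), and 0 otherwise.

   This gives delay O(log (|C| + K)). As the preprocessing can afford to compute the
   first sqrt |C| outputs in advance, |C| <= K^2 once these are exhausted, and the delay is
   O(log (K + 1)). *)

Require Import Defs.
From HB Require Import structures.
From mathcomp Require Import all_boot all_order all_algebra.
From mathcomp Require Import reals zify.
Set Implicit Arguments. Unset Strict Implicit. Unset Printing Implicit Defensive.
Import Order.TTheory GRing.Theory Num.Theory.

Arguments upd {T} f i v j /.

(** * A structured language for the RAM *)

(** The unfolded tree is a ghost, possibly exponentially larger than the circuit: memory holds a
    shared graph of immutable objects whose children have smaller indices, so trees and pending
    lists survive every later allocation. The size of a circuit counts edges only, while its gate
    list may hold arbitrarily many input gates that no edge touches. The translation therefore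
    starts at the output gate and relies on memory being initially zero, no array ever being
    initialised. The word size depends on the encoded circuit and not on the domain, so the total
    allocation must be bounded without the domain size: every value in a solution is the label of an
    input gate, which gives at most [inlen C ^ n] outputs, each allocating at most [4 * n + 2]
    objects. Costs are counted in commands of a structured language and transferred to the machine
    gap by gap between outputs, as a bound on the total time would say nothing about delays. *)

Inductive cond :=
| CLe of nat & nat
| CLt of nat & nat
| CNe of nat & nat
| CNz of nat
| CW of nat & nat.

Inductive cmd :=
| Skip
| Const of nat & nat
| Mov of nat & nat
| AddK of nat & nat & nat
| Add of nat & nat & nat
| Subt of nat & nat & nat
| Mul of nat & nat & nat
| Half of nat & nat
| Ld of nat & nat & nat
| St of nat & nat & nat
| Inp of nat & nat
| Leaf of nat & nat & nat
| Ovl of nat & nat & nat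
| Out of nat
| Seq of cmd & cmd
| If of cond & cmd & cmd
| While of cond & cmd.

Definition wfcond b :=
  match b with
  | CLe x y | CLt x y | CNe x y | CW x y => (x < 64) && (y < 64)
  | CNz x => x < 64
  end.

(** The bounds are those of the memory layout: 64 registers and 32 fields per object. Constants are
    at most 3 because [4 <= V] is what guarantees that they are admissible values. *)
Fixpoint wfc c :=
  match c with
  | Skip => true
  | Const x k => (x < 64) && (k <= 3)
  | AddK x y k => [&& x < 64, y < 64 & k <= 3]
  | Add x y z | Subt x y z | Mul x y z | Leaf x y z | Ovl x y z =>
      [&& x < 64, y < 64 & z < 64]
  | Ld x f y | St f y x => [&& x < 64, f < 32 & y < 64]
  | Mov x y | Half x y | Inp x y => (x < 64) && (y < 64)
  | Out x => x < 64
  | Seq a b => wfc a && wfc b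
  | If b c1 c2 => [&& wfcond b, wfc c1 & wfc c2]
  | While b c => wfcond b && wfc c
  end.

(** * Compilation of structured commands to machine instructions *)

Section Compile.
Variable n : nat.

(* Addresses 0..63 hold the registers of the structured language, 64..71
   scratch words, 72..71+n an argument buffer for the oracle and the outputs;
   after that come the objects, of 32 fields and n assignment cells each. *)
Definition obase := 72 + n.
Definition width := 32 + n.
Definition addr (f i : nat) := obase + f + i * width.

Definition ldaddr (f a : nat) : seq instr :=
  [:: IConst 64 width; IMul 64 a 64; IConst 65 (obase + f); IAdd 64 64 65].

(** The number of variables is a constant, so loops over the cells of an assignment are unrolled. *)
Definition perx (cc : nat -> seq instr) := flatten (map cc (iota 0 n)).

Definition copy_cell a x := ldaddr (32 + x) a ++ [:: ILoad (72 + x) 64].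
Definition copy_pred a x := ldaddr (32 + x) a ++
  [:: ILoad 66 64; IConst 67 1; ISub (72 + x) 66 67].
(** Branch-free: with truncated subtraction, [(x - c) + (c - x)] is the distance of the two indices
    and one minus it the indicator of equality; multiplied by the successor of the value, it is the
    encoded cell, 0 meaning bot. *)
Definition leaf_cell i x d c :=
  [:: IConst 66 c; ISub 67 x 66; ISub 68 66 x; IAdd 67 67 68; IConst 68 1;
      ISub 67 68 67; IAdd 68 d 68; IMul 66 67 68] ++
  ldaddr (32 + c) i ++ [:: IStore 64 66].
(** For cells [k] of [b] and [l] of [a] this computes [(1 - k) * l + k]: truncated subtraction keeps
    [l] exactly when [k] is 0, that is bot. *)
Definition ovl_cell i a b c :=
  ldaddr (32 + c) a ++ [:: ILoad 66 64] ++
  ldaddr (32 + c) b ++ [:: ILoad 67 64; IConst 68 1; ISub 68 68 67;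
                           IMul 66 68 66; IAdd 66 66 67] ++
  ldaddr (32 + c) i ++ [:: IStore 64 66].

(* Code that falls through when the condition holds and jumps to [lf] otherwise. *)
Definition ccond (l : nat) (b : cond) (lf : nat) : seq instr :=
  match b with
  | CLe x y => [:: IJle x y l.+2; IJle 0 0 lf]
  | CLt x y => [:: IJle y x lf]
  | CNe x y => [:: IJle x y l.+2; IJle 0 0 l.+3; IJle y x lf]
  | CNz x => [:: IConst 64 0; IJle x 64 lf]
  | CW x y =>
      let pre := perx (copy_cell x) ++ IOracle 0 72 ::
                 perx (copy_cell y) ++ [:: IOracle 1 72] in
      pre ++ [:: IRJle 0 1 (l + size pre).+2; IJle 0 0 lf]
  end.

Definition straight c : seq instr :=
  match c with
  | Const x k => [:: IConst x k]
  | Mov x a => [:: IConst 64 0; IAdd x a 64]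
  | AddK x a k => [:: IConst 64 k; IAdd x a 64]
  | Add x a b => [:: IAdd x a b]
  | Subt x a b => [:: ISub x a b]
  | Mul x a b => [:: IMul x a b]
  | Half x a => [:: IConst 64 2; IDiv x a 64]
  | Ld x f a => ldaddr f a ++ [:: ILoad x 64]
  | St f a x => ldaddr f a ++ [:: IStore 64 x]
  | Inp x a => [:: IRead x a]
  | Leaf i x d => perx (leaf_cell i x d)
  | Ovl i a b => perx (ovl_cell i a b)
  | _ => [::]
  end.

(** Jump targets are absolute, so the code depends on its start [l]. Its length does not, so targets
    are computed from the lengths of copies compiled at 0. *)
Fixpoint compile (l : nat) (c : cmd) : seq instr :=
  match c with
  | Out a => perx (copy_pred a) ++ [:: IOutput 72]
  | Seq a b => let ca := compile l a in ca ++ compile (l + size ca) b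
  | If b c1 c2 =>
      let kb := size (ccond l b 0) in
      let k1 := size (compile 0 c1) in
      let k2 := size (compile 0 c2) in
      ccond l b (l + kb + k1).+1 ++ compile (l + kb) c1 ++
      IJle 0 0 (l + kb + k1 + k2).+1 :: compile (l + kb + k1).+1 c2
  | While b c1 =>
      let kb := size (ccond l b 0) in
      let k1 := size (compile 0 c1) in
      ccond l b (l + kb + k1).+1 ++ compile (l + kb) c1 ++ [:: IJle 0 0 l]
  | _ => straight c
  end.

Lemma size_ccond l l' b lf lf' : size (ccond l b lf) = size (ccond l' b lf').
Proof. by case: b => //= a b; rewrite !size_cat. Qed.

Lemma size_compile l l' c : size (compile l c) = size (compile l' c).
Proof.
elim: c l l' => //= [a IHa b IHb|b c1 IH1 c2 IH2|b c IH] l l'.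
- rewrite !size_cat (IHa l l'); congr (_ + _); exact: IHb.
- rewrite !size_cat /=; congr (_ + (_ + _.+1)); [exact: size_ccond|exact: IH1|exact: IH2].
rewrite !size_cat /=; congr (_ + (_ + _)); [exact: size_ccond|exact: IH].
Qed.

End Compile.

(** * Simulation of structured commands by the RAM with constant slowdown *)

Section Machine.
Variables (n m : nat) (R : realType).
Variables (P : seq instr) (B V : nat) (input : seq nat) (w : passign n m -> R).
Local Notation state := (state R).
Local Notation trace := (seq (nat * passign n m)).
Local Notation stp := (step P B input w).

Hypothesis V4 : 4 <= V.
(** [V] bounds every register, field and cell. Object indices are such values too, so every address
    fits in a word. *)
Hypothesis HB : obase n + V.+1 * width n <= B.
Hypothesis HI : forall i, nth 0 input i < V.

Fixpoint runs (k t : nat) (s : state) (tr : trace) (s' : state) : Prop :=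
  match k with
  | 0 => tr = [::] /\ s = s'
  | k'.+1 => exists s1 o tr1, [/\ stp s = ONext s1 o, runs k' t.+1 s1 tr1 s'
      & tr = if o is Some a then (t.+1, a) :: tr1 else tr1]
  end.

Lemma runs_cat k1 k2 t s1 s2 s3 tr1 tr2 :
  runs k1 t s1 tr1 s2 -> runs k2 (t + k1) s2 tr2 s3 ->
  runs (k1 + k2) t s1 (tr1 ++ tr2) s3.
Proof.
elim: k1 t s1 tr1 => [|k IH] t s1 tr1 /=.
  by rewrite addn0 add0n => -[-> ->].
case=> s [o [tr [H1 H2 ->]]] H3; exists s, o, (tr ++ tr2); split=> //.
  by apply: IH => //; rewrite addSnnS.
by case: o {H1}.
Qed.

Lemma exec_runs k f t s tr s' : runs k t s tr s' ->
  exec P B input w (k + f) t s =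
    (tr ++ (exec P B input w f (t + k) s').1, (exec P B input w f (t + k) s').2).
Proof.
elim: k t s tr => [|k IH] t s tr /=.
  by rewrite addn0 add0n => -[-> ->]; case: exec.
case=> s1 [o [tr1 [-> /IH -> ->]]]; rewrite addSnnS.
by case: o.
Qed.

Definition code_at (l : nat) (c : seq instr) :=
  exists p q, P = p ++ c ++ q /\ size p = l.

Lemma code_at_cat l c1 c2 :
  code_at l (c1 ++ c2) -> code_at l c1 /\ code_at (l + size c1) c2.
Proof.
case=> p [q [EP <-]]; split; first by exists p, (c2 ++ q); rewrite -catA in EP.
by exists (p ++ c1), q; rewrite size_cat -!catA in EP *.
Qed.

Lemma code_at_cons l i c : code_at l (i :: c) ->
  [/\ l < size P, nth IHalt P l = i & code_at l.+1 c].
Proof.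
case=> p [q [EP <-]]; split.
- by rewrite EP !size_cat /=; lia.
- by rewrite EP nth_cat ltnn subnn.
by exists (rcons p i), q; rewrite cat_rcons size_rcons.
Qed.

Definition write_of (M : nat -> nat) (i : instr) : option (nat * nat) :=
  match i with
  | IConst r k => Some (r, k)
  | IAdd r a b => Some (r, M a + M b)
  | ISub r a b => Some (r, M a - M b)
  | IMul r a b => Some (r, M a * M b)
  | IDiv r a b => Some (r, M a %/ M b)
  | ILoad r a => Some (r, M (M a))
  | IStore a b => Some (M a, M b)
  | IRead r a => Some (r, nth 0 input (M a))
  | _ => None
  end.

Fixpoint slrun (c : seq instr) (M : nat -> nat) : option (nat -> nat) :=
  if c is i :: c' then
    if write_of M i is Some (r, v) then
      if v < B then slrun c' (upd M r v) else None
    else None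
  else Some M.

Lemma slrun_cat c1 c2 M :
  slrun (c1 ++ c2) M = if slrun c1 M is Some M1 then slrun c2 M1 else None.
Proof.
elim: c1 M => //= i c1 IH M.
by case: write_of => // -[r v]; case: ifP.
Qed.

Lemma slrun_runs c l t M S M' : code_at l c -> slrun c M = Some M' ->
  runs (size c) t (State l M S) [::] (State (l + size c) M' S).
Proof.
elim: c l t M => [|i c IH] l t M /=; first by rewrite addn0 => _ [->].
move=> /code_at_cons [lP iP cc].
case E: write_of => [[r v]|] //; case: ifP => // vB Hr.
exists (State l.+1 (upd M r v) S), None, [::]; split=> //; last first.
  by rewrite addnS -addSn; apply: IH.
rewrite /step /= lP iP.
by case: i {iP} E => //= *; match goal with H : Some _ = Some _ |- _ => case: H => *; subst end;
  rewrite vB.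
Qed.

Record hst := Hst {
  rg : nat -> nat;
  fl : nat -> nat -> nat;
  ag : nat -> passign n m;
  tm : nat;
  tr : trace }.

Definition enc (o : option 'I_m) : nat := if o is Some d then d.+1 else 0.

(** Scratch words, the argument buffer and the real registers are left out: commands may overwrite
    them, and scores are asked anew at each comparison. *)
Definition rep (s : hst) (M : nat -> nat) : Prop :=
  [/\ forall x, x < 64 -> M x = rg s x,
      forall f i, f < 32 -> M (addr n f i) = fl s f i
    & forall (x : 'I_n) i, M (addr n (32 + x) i) = enc (ag s i x)].

Definition bnd (s : hst) : Prop :=
  [/\ forall x, x < 64 -> rg s x < V,
      forall f i, f < 32 -> fl s f i < V
    & forall (x : 'I_n) i, enc (ag s i x) < V].

(** Beyond [obase], the field is the residue of the address modulo the width of an object. *)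
Lemma addr_inj f i f' i' : f < width n -> f' < width n ->
  addr n f i = addr n f' i' -> f = f' /\ i = i'.
Proof.
move=> ff ff' E0; have {E0} E : f + i * width n = f' + i' * width n.
  by move: E0; rewrite /addr; lia.
have w0 : 0 < width n by [].
have md g j : g < width n -> (g + j * width n) %% width n = g.
  by move=> gw; rewrite addnC modnMDl modn_small.
have Ef : f = f' by have := congr1 (modn^~ (width n)) E; rewrite /= !md.
by split=> //; move: E; rewrite Ef => /addnI /eqP; rewrite eqn_pmul2r // => /eqP.
Qed.

Lemma ltw x : x < 32 -> x < width n.
Proof. by rewrite /width; lia. Qed.

Lemma ltwx (x : 'I_n) : 32 + x < width n.
Proof. by have := ltn_ord x; rewrite /width; lia. Qed.

Lemma addr_gt f i x : x < 72 + n -> (addr n f i == x) = false.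
Proof. by rewrite /addr /obase; lia. Qed.

Lemma rep_scratch s M t v : 64 <= t -> t < 72 + n -> rep s M -> rep s (upd M t v).
Proof.
move=> t1 t2 [H1 H2 H3]; split=> /=.
- by move=> x x64; rewrite -H1 //; case: eqP => // ?; lia.
- by move=> f i f32; rewrite addr_gt // H2.
by move=> x i; rewrite addr_gt // H3.
Qed.

Definition setr s x v := Hst (upd (rg s) x v) (fl s) (ag s) (tm s).+1 (tr s).
Definition setf s f i v :=
  Hst (rg s) (upd (fl s) f (upd (fl s f) i v)) (ag s) (tm s).+1 (tr s).
Definition seta s i a := Hst (rg s) (fl s) (upd (ag s) i a) (tm s).+1 (tr s).
Definition tick s := Hst (rg s) (fl s) (ag s) (tm s).+1 (tr s).

Lemma rep_setr s M x v : x < 64 -> rep s M -> rep (setr s x v) (upd M x v).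
Proof.
move=> x64 [H1 H2 H3]; split=> /=.
- by move=> y y64; rewrite H1.
- by move=> f i f32; rewrite addr_gt ?H2 //; lia.
by move=> y i; rewrite addr_gt ?H3 //; lia.
Qed.

Lemma rep_setf s M f i v : f < 32 -> rep s M ->
  rep (setf s f i v) (upd M (addr n f i) v).
Proof.
move=> f32 [H1 H2 H3]; split=> /=.
- by move=> y y64; rewrite eq_sym addr_gt ?H1 //; lia.
- move=> f' i' f32'; rewrite H2 //; case: eqP => [E|nE].
    by have [-> ->] := addr_inj (ltw f32') (ltw f32) E; rewrite !eqxx /= eqxx.
  case: (f' =P f) => [Ef|//] /=; case: (i' =P i) => [Ei|_]; last by rewrite Ef.
  by case: nE; rewrite Ef Ei.
move=> y i'; rewrite H3; case: eqP => // E.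
by have [] := addr_inj (ltwx _) (ltw f32) E; lia.
Qed.

Definition cellupd (a : passign n m) (x : 'I_n) (o : option 'I_m) : passign n m :=
  [ffun y => if y == x then o else a y].

Lemma rep_cell s M i x o : rep s M ->
  rep (Hst (rg s) (fl s) (upd (ag s) i (cellupd (ag s i) x o)) (tm s) (tr s))
      (upd M (addr n (32 + x) i) (enc o)).
Proof.
move=> [H1 H2 H3]; split=> /=.
- by move=> y y64; rewrite eq_sym addr_gt ?H1 //; lia.
- move=> f' i' f32'; rewrite H2 //; case: eqP => // E.
  by have [] := addr_inj (ltw f32') (ltwx _) E; lia.
move=> y i'; case: eqP => [E|nE].
  have [] := addr_inj (ltwx _) (ltwx _) E.
  by move=> /addnI /val_inj -> ->; rewrite eqxx ffunE eqxx.
rewrite H3; case: (i' =P i) => // Ei; rewrite ffunE Ei; case: eqP => // Ex.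
by case: nE; rewrite Ei Ex.
Qed.

Lemma addr_lt f i : f < width n -> i < V -> addr n f i < B.
Proof.
move=> fw iV; apply: leq_trans HB; rewrite /addr -addnA ltn_add2l.
apply: (@leq_trans (i.+1 * width n)); first by rewrite mulSn ltn_add2r.
by rewrite leq_mul2r; apply/orP; right; lia.
Qed.

Lemma small_lt i : i <= V + width n -> i < B.
Proof.
move=> iV; apply: leq_trans HB; rewrite /obase.
have : V + width n <= V.+1 * width n by rewrite mulSn addnC leq_add2l leq_pmulr.
by lia.
Qed.

Lemma ldaddr_run s M f a : rep s M -> bnd s -> f < width n -> a < 64 ->
  exists M1, [/\ forall c, slrun (ldaddr n f a ++ c) M = slrun c M1, rep s M1,
    M1 64 = addr n f (rg s a) & forall t, t != 64 -> t != 65 -> M1 t = M t].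
Proof.
move=> rM [bs _ _] fw a64.
have Ea : M a = rg s a by case: rM => ->.
have aV : rg s a < V by exact: bs.
have aB : addr n f (rg s a) < B by exact: addr_lt.
exists (upd (upd (upd (upd M 64 (width n)) 64 (M a * width n)) 65 (obase n + f)) 64
   (M a * width n + (obase n + f))).
split.
- have [h1 h2] : rg s a * width n < B /\ obase n + f < B.
    by split; apply: leq_ltn_trans aB; rewrite /addr; lia.
  have h3 : rg s a * width n + (obase n + f) < B by rewrite addnC.
  have h4 : (a == 64) = false by lia.
  by move=> c /=; rewrite small_lt ?leq_addl // h4 Ea h1 h2 h3.
- by do 4 (apply: rep_scratch; [by []|by lia|]).
- by rewrite /= Ea /addr addnC.
by move=> t /negbTE t1 /negbTE t2 /=; rewrite t1 t2.
Qed.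

Lemma perx_run (cc : nat -> seq instr) (I : nat -> (nat -> nat) -> Prop) M :
  (forall (x : 'I_n) M, I x M -> exists2 M', slrun (cc x) M = Some M' & I x.+1 M') ->
  I 0 M -> exists2 M', slrun (perx n cc) M = Some M' & I n M'.
Proof.
move=> H; rewrite /perx.
suff G k j M1 : j + k = n -> I j M1 ->
    exists2 M', slrun (flatten (map cc (iota j k))) M1 = Some M' & I n M'.
  exact: G.
elim: k j M1 => [|k IH] j M1 /=; first by rewrite addn0 => -> ?; exists M1.
rewrite addnS => E IM; have jn : j < n by lia.
have [M2 E2 I2] := H (Ordinal jn) M1 IM.
have [M3 E3 I3] := IH j.+1 M2 E I2.
by exists M3 => //; rewrite slrun_cat E2.
Qed.

Lemma copy_cell_run s M a : rep s M -> bnd s -> a < 64 ->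
  exists M', [/\ slrun (perx n (copy_cell n a)) M = Some M', rep s M' &
    forall x : 'I_n, M' (72 + x) = enc (ag s (rg s a) x)].
Proof.
move=> rM bs a64.
pose I j M := rep s M /\ forall x : 'I_n, x < j -> M (72 + x) = enc (ag s (rg s a) x).
case: (@perx_run (copy_cell n a) I M) => [x M1 [r1 H1]|//|M' E [r' H']].
  have [M2 [E2 r2 A2 F2]] := ldaddr_run r1 bs (ltwx x) a64.
  have v : M2 (M2 64) = enc (ag s (rg s a) x) by rewrite A2; case: r2.
  have vV : enc (ag s (rg s a) x) < V by case: bs.
  exists (upd M2 (72 + x) (M2 (M2 64))).
    by rewrite /copy_cell E2 /= v small_lt //; lia.
  split; first by apply: rep_scratch => //; rewrite ltn_add2l.
  move=> y; rewrite ltnS leq_eqVlt => /orP[/eqP/val_inj ->|yx] /=; first by rewrite eqxx.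
  rewrite eqn_add2l (ltn_eqF yx) F2; [exact: H1|lia|lia].
by exists M'; split=> // x; apply: H'.
Qed.

Lemma copy_pred_run s M a : rep s M -> bnd s -> a < 64 ->
  exists M', [/\ slrun (perx n (copy_pred n a)) M = Some M', rep s M' &
    forall x : 'I_n, M' (72 + x) = (enc (ag s (rg s a) x)).-1].
Proof.
move=> rM bs a64.
pose I j M := rep s M /\ forall x : 'I_n, x < j -> M (72 + x) = (enc (ag s (rg s a) x)).-1.
case: (@perx_run (copy_pred n a) I M) => [x M1 [r1 H1]|//|M' E [r' H']].
  have [M2 [E2 r2 A2 F2]] := ldaddr_run r1 bs (ltwx x) a64.
  have v : M2 (M2 64) = enc (ag s (rg s a) x) by rewrite A2; case: r2.
  have vV : enc (ag s (rg s a) x) < V by case: bs.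
  exists (upd (upd (upd M2 66 (M2 (M2 64))) 67 1) (72 + x) (M2 (M2 64) - 1)).
    rewrite /copy_pred E2 /= v !small_lt //; lia.
  split.
    by do 3 (apply: rep_scratch; [by []|by have := ltn_ord x; lia|]).
  move=> y; rewrite ltnS leq_eqVlt => /orP[/eqP/val_inj ->|yx] /=.
    by rewrite eqxx v subn1.
  rewrite eqn_add2l (ltn_eqF yx) F2; [|lia|lia].
  by rewrite H1.
by exists M'; split=> // x; apply: H'.
Qed.

Definition semi (s : hst) (i : nat) (a : passign n m) (j : nat) :=
  Hst (rg s) (fl s) (upd (ag s) i [ffun x : 'I_n => if x < j then a x else ag s i x])
    (tm s) (tr s).

(** Column [x] of every object is still the original one when column [x] is processed; hence the
    target may be one of the sources. *)
Lemma cells_run s M (cc : nat -> seq instr) i (a : passign n m) : rep s M -> bnd s ->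
  (forall x, enc (a x) < V) ->
  (forall (x : 'I_n) s1 M1, rep s1 M1 -> bnd s1 -> rg s1 = rg s ->
    (forall j, ag s1 j x = ag s j x) ->
    exists M2, [/\ slrun (cc x) M1 = Some (upd M2 (addr n (32 + x) (rg s i)) (enc (a x)))
      & rep s1 M2]) ->
  exists2 M', slrun (perx n cc) M = Some M' & rep (seta s (rg s i) a) M'.
Proof.
move=> rM bs aV H; set o := rg s i in H *.
pose I j M := rep (semi s o a j) M.
case: (@perx_run cc I M) => [x M1 r1||M' E r'].
- have [|//|j|M2 [E2 r2]] := H x (semi s o a x) M1 r1.
  + case: bs => b1 b2 b3; split=> //= y j; case: eqP => // _; rewrite ffunE.
    by case: ifP.
  + by rewrite /=; case: eqP => // ->; rewrite ffunE ltnn.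
  exists (upd M2 (addr n (32 + x) o) (enc (a x))) => //.
  case: (rep_cell o x (a x) r2) => h1 h2 h3.
  split; [exact: h1|exact: h2|move=> y j; rewrite h3 /= eqxx; case: eqP => // Ej].
  by rewrite !ffunE ltnS -(inj_eq val_inj) /=; case: ltngtP => // /val_inj ->.
- case: rM => h1 h2 h3; split=> //= y j; rewrite h3; case: eqP => // ->.
  by rewrite ffunE.
exists M' => //; case: r' => h1 h2 h3; split=> //= y j; rewrite h3 /=.
by case: eqP => // _; rewrite ffunE ltn_ord.
Qed.

Lemma leaf_run s M i rx rd (x : 'I_n) (d : 'I_m) : rep s M -> bnd s ->
  i < 64 -> rx < 64 -> rd < 64 -> rg s rx = x -> rg s rd = d -> d.+1 < V ->
  exists2 M', slrun (perx n (leaf_cell n i rx rd)) M = Some M' &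
    rep (seta s (rg s i) [ffun y => if y == x then Some d else None]) M'.
Proof.
move=> rM bs i64 x64 d64 Ex Ed dV; apply: cells_run => //.
  by move=> y; rewrite ffunE; case: ifP => //= _; lia.
move=> y s1 M1 r1 b1 Er _.
have [h1 _ _] := r1.
have xB : x < B by apply: small_lt; have := ltn_ord x; rewrite /width; lia.
have yB : y < B by apply: small_lt; have := ltn_ord y; rewrite /width; lia.
have dB : d.+1 < B by apply: small_lt; lia.
have B2 : 1 < B by apply: small_lt; lia.
set v := enc _.
have vE : v = (1 - ((x - y) + (y - x))) * d.+1.
  rewrite /v ffunE -(inj_eq val_inj) /=; case: eqP => [->|ne] /=.
    by rewrite subnn mul1n.
  have ne' : (y : nat) <> x by [].
  have : 0 < x - y + (y - x) by lia.
  by case: (x - y + (y - x)) => // k _; rewrite subSS sub0n.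
have vB : v < B by rewrite /v ffunE; case: ifP => //= _; lia.
pose M2 := upd (upd (upd (upd (upd (upd (upd (upd M1 66 y) 67 (x - y)) 68 (y - x))
  67 (x - y + (y - x))) 68 1) 67 (1 - (x - y + (y - x)))) 68 d.+1) 66 v.
have E2 c : slrun ([:: IConst 66 y; ISub 67 rx 66; ISub 68 66 rx; IAdd 67 67 68;
      IConst 68 1; ISub 67 68 67; IAdd 68 rd 68; IMul 66 67 68] ++ c) M1 = slrun c M2.
  rewrite /= /M2.
  have -> : (rx == 66) = false by lia.
  have -> : (rx == 67) = false by lia.
  have -> : (rd == 67) = false by lia.
  have -> : (rd == 68) = false by lia.
  have -> : (rd == 66) = false by lia.
  rewrite !h1 // Er Ex Ed addn1 -vE yB dB B2 vB.
  by rewrite !ifT //; lia.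
have r2 : rep s1 M2 by do 8 (apply: rep_scratch; [by []|by lia|]).
have [M3 [E3 r3 A3 F3]] := ldaddr_run r2 b1 (ltwx y) i64.
exists M3; split=> //.
by rewrite /leaf_cell E2 E3 /= A3 Er F3 //= vB.
Qed.

Definition ovl (a b : passign n m) : passign n m :=
  [ffun x => if b x is Some d then Some d else a x].

Lemma ovl_run s M i a b : rep s M -> bnd s -> i < 64 -> a < 64 -> b < 64 ->
  exists2 M', slrun (perx n (ovl_cell n i a b)) M = Some M' &
    rep (seta s (rg s i) (ovl (ag s (rg s a)) (ag s (rg s b)))) M'.
Proof.
move=> rM bs i64 a64 b64; apply: cells_run => //.
  by move=> y; rewrite ffunE; case: bs => _ _ b3; case: (ag s (rg s b) y) (b3 y (rg s b)).
move=> y s1 M1 r1 b1 Er Ea.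
have [M2 [E2 r2 A2 F2]] := ldaddr_run r1 b1 (ltwx y) a64.
have v2 : M2 (M2 64) = enc (ag s (rg s a) y) by rewrite A2; case: r2 => _ _ ->; rewrite Er Ea.
have V2 : M2 (M2 64) < V by rewrite v2; case: bs.
pose M3 := upd M2 66 (M2 (M2 64)).
have r3 : rep s1 M3 by apply: rep_scratch => //; lia.
have [M4 [E4 r4 A4 F4]] := ldaddr_run r3 b1 (ltwx y) b64.
have v4 : M4 (M4 64) = enc (ag s (rg s b) y) by rewrite A4; case: r4 => _ _ ->; rewrite Er Ea.
have V4' : M4 (M4 64) < V by rewrite v4; case: bs.
set v := enc (ovl _ _ y).
have vE : v = (1 - M4 (M4 64)) * M2 (M2 64) + M4 (M4 64).
  rewrite /v v4 v2 ffunE; case: (ag s (rg s b) y) => [d|] /=; last by rewrite mul1n addn0.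
  by rewrite subSS sub0n.
have vV : v < V by rewrite vE; case: (M4 (M4 64)) V4' => [|k] ?; rewrite ?subSS ?sub0n; lia.
pose M5 := upd (upd (upd (upd (upd M4 67 (M4 (M4 64))) 68 1) 68 (1 - M4 (M4 64)))
  66 ((1 - M4 (M4 64)) * M2 (M2 64))) 66 v.
have r5 : rep s1 M5 by do 5 (apply: rep_scratch; [by []|by lia|]).
have [M6 [E6 r6 A6 F6]] := ldaddr_run r5 b1 (ltwx y) i64.
exists M6; split=> //.
have sload r a' c M' : M' (M' a') < B ->
    slrun (ILoad r a' :: c) M' = slrun c (upd M' r (M' (M' a'))) by move=> /= ->.
rewrite /ovl_cell E2 cat_cons sload; last by apply: small_lt; lia.
have e66 : M4 66 = M2 (M2 64) by rewrite F4 /M3 //= eqxx.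
have E5 c : slrun ([:: ILoad 67 64; IConst 68 1; ISub 68 68 67; IMul 66 68 66;
    IAdd 66 66 67] ++ c) M4 = slrun c M5.
  have f1 : M4 (M4 64) < B by apply: small_lt; lia.
  have f2 : 1 < B by apply: small_lt; lia.
  have f3 : 1 - M4 (M4 64) < B by lia.
  have f4 : v < B by apply: small_lt; lia.
  have f5 : (1 - M4 (M4 64)) * M2 (M2 64) < B by move: f4; rewrite vE; lia.
  by rewrite /= f1 f2 f3 e66 f5 -vE f4.
by rewrite -/M3 cat0s E4 E5 E6 /= A6 Er F6 // /M5 /= small_lt //; lia.
Qed.

(** Bounds the instructions of one command or one test; the overlay dominates, with 19 per
    variable. *)
Definition KC := 20 * n + 20.

(* [r], from time [t] to [t'], has the outputs of [a], from time [T] to [T'], with delays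
   at most [KC] times longer. *)
Fixpoint simt (t T : nat) (r a : trace) (t' T' : nat) : Prop :=
  match r, a with
  | [::], [::] => T <= T' /\ t' <= t + KC * (T' - T)
  | (t1, x) :: r', (T1, y) :: a' =>
      [/\ x = y, T <= T1, t1 <= t + KC * (T1 - T) & simt t1 T1 r' a' t' T']
  | _, _ => False
  end.

Lemma simt_cat t T r a t1 T1 r' a' t2 T2 : simt t T r a t1 T1 ->
  simt t1 T1 r' a' t2 T2 -> simt t T (r ++ r') (a ++ a') t2 T2.
Proof.
elim: r a t T => [|[u x] r IH] [|[U y] a] t T //=; last first.
  by case=> -> h1 h2 /IH h /h.
case=> h1 h2; case: r' a' => [|[u x] r'] [|[U y] a'] //=.
  case=> h3 h4; split; first by lia.
  have -> : T2 - T = (T2 - T1) + (T1 - T) by lia.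
  by rewrite mulnDr; lia.
case=> -> h3 h4 h5; split=> //; first by lia.
have -> : U - T = (U - T1) + (T1 - T) by lia.
by rewrite mulnDr; lia.
Qed.

(** Total correctness: a finite run is exhibited for every placement of the code and every memory
    representing [s]. Outputs and times are tied by [simt], so that timing claims too are read off
    the abstract state. *)
Definition wp (c : cmd) (Q : hst -> Prop) (s : hst) : Prop :=
  forall l t M S, code_at l (compile n l c) -> wfc c -> rep s M -> bnd s ->
  exists s' k rt ta M' S',
    [/\ runs k t (State l M S) rt (State (l + size (compile n l c)) M' S'),
        rep s' M' /\ bnd s', tr s' = tr s ++ ta,
        simt t (tm s) rt ta (t + k) (tm s') & Q s'].

Lemma wp_seq c1 c2 Q s : wp c1 (wp c2 Q) s -> wp (Seq c1 c2) Q s.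
Proof.
move=> H l t M S /= /code_at_cat [h1 h1'] /andP[h2 h2'] h3 h4.
have [s1 [k1 [r1 [a1 [M1 [S1 [e1 [R1 b1] T1 z1 H2]]]]]]] := H l t M S h1 h2 h3 h4.
have [s2 [k2 [r2 [a2 [M2 [S2 [e2 R2 T2 z2 q2]]]]]]] := H2 _ (t + k1) M1 S1 h1' h2' R1 b1.
exists s2, (k1 + k2), (r1 ++ r2), (a1 ++ a2), M2, S2; split=> //.
- by rewrite size_cat addnA; apply: runs_cat e1 e2.
- by rewrite T2 T1 catA.
by rewrite addnA; apply: simt_cat z1 z2.
Qed.

Lemma wp_skip (Q : hst -> Prop) s : Q s -> wp Skip Q s.
Proof.
move=> q l t M S _ _ rM bs; exists s, 0, [::], [::], M, S.
by rewrite /= !addn0 cats0 subnn muln0 addn0; split.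
Qed.

Lemma wp_straight c (Q : hst -> Prop) s s' :
  (forall l, compile n l c = straight n c) -> size (straight n c) <= KC ->
  tr s' = tr s -> tm s' = (tm s).+1 ->
  (forall M, wfc c -> rep s M -> bnd s ->
     (exists2 M', slrun (straight n c) M = Some M' & rep s' M') /\ bnd s') ->
  Q s' -> wp c Q s.
Proof.
move=> E sz Et Em H q l t M S; rewrite E => h1 h2 h3 h4.
have [[M' e r'] b'] := H M h2 h3 h4.
exists s', (size (straight n c)), [::], [::], M', S; split=> //.
- exact: slrun_runs h1 e.
- by rewrite cats0.
by rewrite /= Em; split; lia.
Qed.

Lemma bnd_setr s x v : v < V -> bnd s -> bnd (setr s x v).
Proof. by move=> vV [h1 h2 h3]; split=> //= y y64; case: eqP => // _; apply: h1. Qed.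

Lemma bnd_setf s f i v : v < V -> bnd s -> bnd (setf s f i v).
Proof.
move=> vV [h1 h2 h3]; split=> //= g j g32; case: eqP => [E|_]; last exact: h2.
by rewrite /upd; case: eqP => // _; rewrite -E; apply: h2.
Qed.

Lemma bnd_seta s i (a : passign n m) : (forall x, enc (a x) < V) -> bnd s -> bnd (seta s i a).
Proof. by move=> vV [h1 h2 h3]; split=> //= x j; case: eqP. Qed.

Lemma bnd_rg s x : bnd s -> x < 64 -> rg s x < V.
Proof. by case=> h _ _; apply: h. Qed.

Lemma VB x : x < V -> x < B.
Proof. by move=> h; apply: small_lt; lia. Qed.

Lemma wp_const x k (Q : hst -> Prop) s : Q (setr s x k) -> wp (Const x k) Q s.
Proof.
move=> q; apply: wp_straight q => //= [|M /andP[x64 k3] rM bs].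
  by rewrite /KC; lia.
have kV : k < V by lia.
split; last exact: bnd_setr.
by rewrite VB //; eexists; [reflexivity|apply: rep_setr].
Qed.

Lemma rep_rg s M x : rep s M -> x < 64 -> M x = rg s x.
Proof. by case=> h _ _; apply: h. Qed.

Lemma wp_addk x a k (Q : hst -> Prop) s : rg s a + k < V ->
  Q (setr s x (rg s a + k)) -> wp (AddK x a k) Q s.
Proof.
move=> kV q; apply: wp_straight q => //= [|M /and3P[x64 a64 k3] rM bs].
  by rewrite /KC; lia.
split; last exact: bnd_setr.
have -> : (a == 64) = false by lia.
rewrite (rep_rg rM a64) !VB //; last by lia.
by eexists; [reflexivity|apply: rep_setr => //; apply: rep_scratch => //; lia].
Qed.

Lemma wp_mov x a (Q : hst -> Prop) s : Q (setr s x (rg s a)) -> wp (Mov x a) Q s.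
Proof.
move=> q; apply: wp_straight q => //= [|M /andP[x64 a64] rM bs].
  by rewrite /KC; lia.
have aV := bnd_rg bs a64.
split; last exact: bnd_setr.
have -> : (a == 64) = false by lia.
rewrite addn0 (rep_rg rM a64) !VB //; last by lia.
by eexists; [reflexivity|apply: rep_setr => //; apply: rep_scratch => //; lia].
Qed.

Lemma wp_add x a b (Q : hst -> Prop) s : rg s a + rg s b < V ->
  Q (setr s x (rg s a + rg s b)) -> wp (Add x a b) Q s.
Proof.
move=> kV q; apply: wp_straight q => //= [|M /and3P[x64 a64 b64] rM bs].
  by rewrite /KC; lia.
split; last exact: bnd_setr.
rewrite (rep_rg rM a64) (rep_rg rM b64) VB //.
by eexists; [reflexivity|apply: rep_setr].
Qed.

Lemma wp_sub x a b (Q : hst -> Prop) s :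
  Q (setr s x (rg s a - rg s b)) -> wp (Subt x a b) Q s.
Proof.
move=> q; apply: wp_straight q => //= [|M /and3P[x64 a64 b64] rM bs].
  by rewrite /KC; lia.
have aV := bnd_rg bs a64; have kV : rg s a - rg s b < V by lia.
split; last exact: bnd_setr.
rewrite (rep_rg rM a64) (rep_rg rM b64) VB //.
by eexists; [reflexivity|apply: rep_setr].
Qed.

Lemma wp_mul x a b (Q : hst -> Prop) s : rg s a * rg s b < V ->
  Q (setr s x (rg s a * rg s b)) -> wp (Mul x a b) Q s.
Proof.
move=> kV q; apply: wp_straight q => //= [|M /and3P[x64 a64 b64] rM bs].
  by rewrite /KC; lia.
split; last exact: bnd_setr.
rewrite (rep_rg rM a64) (rep_rg rM b64) VB //.
by eexists; [reflexivity|apply: rep_setr].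
Qed.

Lemma wp_half x a (Q : hst -> Prop) s :
  Q (setr s x (rg s a)./2) -> wp (Half x a) Q s.
Proof.
move=> q; apply: wp_straight q => //= [|M /andP[x64 a64] rM bs].
  by rewrite /KC; lia.
have aV := bnd_rg bs a64.
have hV : (rg s a)./2 < V by lia.
split; last exact: bnd_setr.
have -> : (a == 64) = false by lia.
rewrite (rep_rg rM a64) divn2 !VB //; last by lia.
by eexists; [reflexivity|apply: rep_setr => //; apply: rep_scratch => //; lia].
Qed.

Lemma wp_inp x a (Q : hst -> Prop) s :
  Q (setr s x (nth 0 input (rg s a))) -> wp (Inp x a) Q s.
Proof.
move=> q; apply: wp_straight q => //= [|M /andP[x64 a64] rM bs].
  by rewrite /KC; lia.
split; last exact: bnd_setr.
rewrite (rep_rg rM a64) VB //.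
by eexists; [reflexivity|apply: rep_setr].
Qed.

Lemma wp_ld x f a (Q : hst -> Prop) s :
  Q (setr s x (fl s f (rg s a))) -> wp (Ld x f a) Q s.
Proof.
move=> q; apply: wp_straight q => // [|M /and3P[x64 f32 a64] rM bs].
  by rewrite /KC /=; lia.
have [b1 b2 b3] := bs.
split; last by apply: bnd_setr; auto.
have [M1 [E1 r1 A1 F1]] := ldaddr_run rM bs (ltw f32) a64.
rewrite /straight E1 /= A1; have [h1 h2 h3] := r1.
rewrite h2 // VB; last exact: b2.
by eexists; [reflexivity|apply: rep_setr].
Qed.

Lemma wp_st f a x (Q : hst -> Prop) s :
  Q (setf s f (rg s a) (rg s x)) -> wp (St f a x) Q s.
Proof.
move=> q; apply: wp_straight q => // [|M /and3P[x64 f32 a64] rM bs].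
  by rewrite /KC /=; lia.
have [b1 b2 b3] := bs.
split; last by apply: bnd_setf; auto.
have [M1 [E1 r1 A1 F1]] := ldaddr_run rM bs (ltw f32) a64.
rewrite /straight E1 /= A1; have [h1 h2 h3] := r1.
rewrite h1 // VB; last exact: b1.
by eexists; [reflexivity|apply: rep_setf].
Qed.

Lemma size_perx (cc : nat -> seq instr) k :
  (forall x, size (cc x) = k) -> size (perx n cc) = n * k.
Proof.
move=> H; rewrite /perx -{2}(size_iota 0 n).
by elim: (iota 0 n) => //= x l IH; rewrite size_cat H IH.
Qed.

Lemma wp_leaf i rx rd (x : 'I_n) (d : 'I_m) (Q : hst -> Prop) s :
  rg s rx = x -> rg s rd = d -> d.+1 < V ->
  Q (seta s (rg s i) [ffun y => if y == x then Some d else None]) ->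
  wp (Leaf i rx rd) Q s.
Proof.
move=> Ex Ed dV q; apply: wp_straight q => // [|M /and3P[i64 x64 d64] rM bs].
  by rewrite /KC [straight _ _]/= (@size_perx _ 13) //; lia.
split; last by apply: bnd_seta => // y; rewrite ffunE; case: ifP => //= _; lia.
exact: leaf_run.
Qed.

Lemma wp_ovl i a b (Q : hst -> Prop) s :
  Q (seta s (rg s i) (ovl (ag s (rg s a)) (ag s (rg s b)))) ->
  wp (Ovl i a b) Q s.
Proof.
move=> q; apply: wp_straight q => // [|M /and3P[i64 x64 d64] rM bs].
  by rewrite /KC [straight _ _]/= (@size_perx _ 19) //; lia.
split; last first.
  apply: bnd_seta => // y; rewrite ffunE; case: bs => _ _ b3.
  by case: (ag s (rg s b) y) (b3 y (rg s b)).
exact: ovl_run.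
Qed.

Definition evc (b : cond) (s : hst) : bool :=
  match b with
  | CLe x y => rg s x <= rg s y
  | CLt x y => rg s x < rg s y
  | CNe x y => rg s x != rg s y
  | CNz x => rg s x != 0
  | CW x y => (w (ag s (rg s x)) <= w (ag s (rg s y)))%R
  end.

Arguments runs : simpl never.

Lemma enc_insub (o : option 'I_m) : (if enc o is d.+1 then insub d else None) = o.
Proof. by case: o => //= d; rewrite valK. Qed.

Lemma oracle_run l r c t M S (a : passign n m) : code_at l (IOracle r 72 :: c) ->
  (forall x : 'I_n, M (72 + x) = enc (a x)) ->
  runs 1 t (State l M S) [::] (State l.+1 M (upd S r (w a))).
Proof.
move=> /code_at_cons[lP iP _] Ma.
exists (State l.+1 M (upd S r (w a))), None, [::]; split=> //.
rewrite /step /= lP iP /read_passign ifT; last first.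
  by apply/forallP => x; rewrite Ma; case: (a x) => //= d.
congr (ONext (State _ _ (upd _ _ (w _))) _).
by apply/ffunP => x; rewrite ffunE Ma enc_insub.
Qed.

Lemma jle_run l x y l' c t M S : code_at l (IJle x y l' :: c) ->
  runs 1 t (State l M S) [::] (State (if M x <= M y then l' else l.+1) M S).
Proof.
move=> /code_at_cons[lP iP _]; eexists _, None, [::]; split=> //.
by rewrite /step /= lP iP.
Qed.

(** Comparing register 0 with itself makes [IJle 0 0] an unconditional jump. *)
Lemma goto_run l l' c t M S : code_at l (IJle 0 0 l' :: c) ->
  runs 1 t (State l M S) [::] (State l' M S).
Proof. by move/jle_run => /(_ t M S); rewrite leqnn. Qed.

Lemma ccond_run l b lf t s M S : code_at l (ccond n l b lf) -> wfcond b ->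
  rep s M -> bnd s ->
  exists k M' S', [/\ runs k t (State l M S) [::]
     (State (if evc b s then l + size (ccond n l b lf) else lf) M' S'),
     rep s M' & k < KC].
Proof.
move=> cc wb rM bs; have rr x := rep_rg (x := x) rM.
have KC19 : 19 < KC by rewrite /KC; lia.
case: b cc wb => [x y|x y|x y|x|x y] /= cc wb.
- have [x64 y64] : x < 64 /\ y < 64 by lia.
  have E1 := @jle_run _ _ _ _ _ t M S cc; move: E1; rewrite !rr //.
  have [_ _ /goto_run E2] := code_at_cons cc.
  case: ifP => _ E1; last first.
    exists 2, M, S; split; [|by []|by lia].
    exact: (runs_cat (k1 := 1) (k2 := 1) E1 (E2 _ _ _)).
  by exists 1, M, S; split; [rewrite addn2|by []|by lia].
- have [x64 y64] : x < 64 /\ y < 64 by lia.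
  have E1 := @jle_run _ _ _ _ _ t M S cc; move: E1; rewrite !rr // leqNgt.
  by case: (_ < _) => /= E1; exists 1, M, S; split; rewrite ?addn1 //; lia.
- have [x64 y64] : x < 64 /\ y < 64 by lia.
  have [_ _ c2] := code_at_cons cc; have [_ _ c3] := code_at_cons c2.
  have E1 := @jle_run _ _ _ _ _ t M S cc; move: E1; rewrite !rr //.
  have E2 := @goto_run _ _ _ (t + 1) M S c2.
  have E3 := @jle_run _ _ _ _ _ (t + 1) M S c3; move: E3; rewrite !rr //.
  rewrite addn3; case: (ltngtP (rg s x) (rg s y)) => _ /= E3 E1.
  + by exists 2, M, S; split; [exact: (runs_cat (k1 := 1) (k2 := 1) E1 E3)|by []|lia].
  + by exists 2, M, S; split; [exact: (runs_cat (k1 := 1) (k2 := 1) E1 E2)|by []|lia].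
  by exists 2, M, S; split; [exact: (runs_cat (k1 := 1) (k2 := 1) E1 E3)|by []|lia].
- have [_ _ c2] := code_at_cons cc.
  have c1 : code_at l ([:: IConst 64 0] ++ [:: IJle x 64 lf]) by [].
  have [c1' _] := code_at_cat c1.
  have B0 : 0 < B by apply: small_lt.
  have E1 : runs 1 t (State l M S) [::] (State (l + 1) (upd M 64 0) S).
    by apply: slrun_runs c1' _; rewrite /= B0.
  have E2 := @jle_run _ _ _ _ _ (t + 1) (upd M 64 0) S c2; move: E2.
  rewrite /= (_ : (x == 64) = false); last by lia.
  rewrite rr // leqn0 => E2.
  exists 2, (upd M 64 0), S; split; [|by apply: rep_scratch => //; lia|by lia].
  rewrite addn1 in E1; have := runs_cat E1 E2; rewrite addn2.
  by case: eqP.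
have [x64 y64] : x < 64 /\ y < 64 by lia.
set pre := perx _ _ ++ _ in cc *.
have [cp cj] := code_at_cat cc.
have [ca] := code_at_cat cp.
rewrite -[_ :: _]cat1s => /code_at_cat[co1] /code_at_cat[cb co2].
have [M1 [e1 r1 v1]] := copy_cell_run rM bs x64.
have R1 := slrun_runs t S ca e1.
set l1 := l + size (perx n (copy_cell n x)) in co1 cb co2 R1.
set t1 := t + size (perx n (copy_cell n x)).
have R2 := oracle_run t1 S co1 v1.
have [M2 [e2 r2 v2]] := copy_cell_run r1 bs y64.
have R3 := slrun_runs (t1 + 1) (upd S 0 (w (ag s (rg s x)))) cb e2.
rewrite /= in R3 cb co2; rewrite -[l1.+1]addn1 in R2.
set l2 := l1 + 1 + _ in co2 R3; set t2 := t1 + 1 + size (perx n (copy_cell n y)).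
have R4 := oracle_run t2 (upd S 0 (w (ag s (rg s x)))) co2 v2.
set S2 := upd (upd _ _ _) _ _ in R4.
have El : l + size pre = l2.+1 by rewrite /pre /l2 /l1 size_cat /= size_cat /=; lia.
rewrite El in cj *.
have [lP iP cg] := code_at_cons cj.
have R5 : runs 1 (t2 + 1) (State l2.+1 M2 S2) [::]
   (State (if (w (ag s (rg s x)) <= w (ag s (rg s y)))%R then l2.+3 else l2.+2) M2 S2).
  by eexists _, None, [::]; split=> //; rewrite /step /= lP iP /S2 /=.
have RR := runs_cat R1 (runs_cat R2 (runs_cat R3 (runs_cat R4 R5))).
have sz z : size (perx n (copy_cell n z)) = n * 5 by apply: size_perx.
case: ifP RR => _ RR; last first.
  have R6 := @goto_run _ _ _ (t + (size (perx n (copy_cell n x)) +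
         (1 + (size (perx n (copy_cell n y)) + (1 + 1))))) M2 S2 cg.
  eexists _, M2, S2; split; [exact: (runs_cat RR R6)|by []|].
  by rewrite !sz /KC; lia.
eexists _, M2, S2; split; [|by []|].
  rewrite size_cat addnA El addn2; exact: RR.
by rewrite !sz /KC; lia.
Qed.

Lemma simt_end t T r a t1 T1 t2 : simt t T r a t1 T1 -> t2 <= t1 + KC ->
  simt t T r a t2 T1.+1.
Proof.
move=> h h2; rewrite -[r]cats0 -[a]cats0; apply: simt_cat h _.
by rewrite /= subSnn muln1; split.
Qed.

Definition csize c := size (compile n 0 c).
Definition ksize b := size (ccond n 0 b 0).
Lemma csizeE l c : size (compile n l c) = csize c.
Proof. exact: size_compile. Qed.
Lemma ksizeE l b lf : size (ccond n l b lf) = ksize b.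
Proof. exact: size_ccond. Qed.

Lemma wp_if b c1 c2 (Q : hst -> Prop) s :
  (if evc b s then wp c1 (fun s' => Q (tick s')) (tick s)
   else wp c2 (fun s' => Q (tick s')) (tick s)) -> wp (If b c1 c2) Q s.
Proof.
move=> H l t M S /=; rewrite !ksizeE !csizeE => cc /and3P[wb w1 w2] rM bs.
have [cb] := code_at_cat cc; rewrite !ksizeE => cr.
have [ca1] := code_at_cat cr; rewrite csizeE => cg.
have [_ _ ca2] := code_at_cons cg.
have [k [M1 [S1 [R1 r1 k1]]]] := ccond_run t S cb wb rM bs.
rewrite ksizeE in R1.
have z1 : simt t (tm s) [::] [::] (t + k) (tm (tick s)) by rewrite /= subSnn; split; lia.
rewrite !size_cat /= !ksizeE !csizeE.
case: ifP H R1 => _ H R1.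
  have [s2 [k2 [r2 [a2 [M2 [S2 [e2 [rr2 b2] T2 z2 q2]]]]]]] := H _ (t + k) M1 S1 ca1 w1 r1 bs.
  rewrite csizeE in e2.
  have e3 := @goto_run _ _ _ (t + k + k2) M2 S2 cg.
  have e := runs_cat R1 (runs_cat e2 e3).
  exists (tick s2), (k + (k2 + 1)), r2, a2, M2, S2; split=> //.
    rewrite cats0 in e.
    rewrite (_ : l + (_ + _) = (l + ksize b + csize c1 + csize c2).+1) //; lia.
  apply: (simt_cat z1); apply: simt_end z2 _; rewrite /KC; lia.
have [s2 [k2 [r2 [a2 [M2 [S2 [e2 [rr2 b2] T2 z2 q2]]]]]]] := H _ (t + k) M1 S1 ca2 w2 r1 bs.
rewrite csizeE in e2.
have e := runs_cat R1 e2.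
exists (tick s2), (k + k2), r2, a2, M2, S2; split=> //.
  rewrite (_ : l + (_ + _) = (l + ksize b + csize c1).+1 + csize c2) //; lia.
apply: (simt_cat z1); apply: simt_end z2 _; rewrite /KC; lia.
Qed.

(** Plain unrolling, with one tick for the test and one for the jump back. There is no variant:
    termination comes from an induction at each use. *)
Lemma wp_while b c (Q : hst -> Prop) s :
  (if evc b s then wp c (fun s' => wp (While b c) Q (tick s')) (tick s)
   else Q (tick s)) -> wp (While b c) Q s.
Proof.
move=> H l t M S cc0 wc0 rM bs; have cc := cc0; have wc := wc0.
rewrite /= !ksizeE !csizeE in cc; move: wc => /= /andP[wb wc].
have [cb] := code_at_cat cc; rewrite !ksizeE => cr.
have [ca1] := code_at_cat cr; rewrite csizeE => cg.
have [k [M1 [S1 [R1 r1 k1]]]] := ccond_run t S cb wb rM bs.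
rewrite ksizeE in R1.
have z1 : simt t (tm s) [::] [::] (t + k) (tm (tick s)) by rewrite /= subSnn; split; lia.
case: ifP H R1 => _ H R1; last first.
  exists (tick s), k, [::], [::], M1, S1; split; rewrite ?cats0 //.
  rewrite /= !size_cat /= !ksizeE !csizeE.
  by rewrite (_ : l + (_ + _) = (l + ksize b + csize c).+1) //; lia.
have [s2 [k2 [r2 [a2 [M2 [S2 [e2 [rr2 b2] T2 z2 q2]]]]]]] := H _ (t + k) M1 S1 ca1 wc r1 bs.
rewrite csizeE in e2.
have e3 := @goto_run _ _ _ (t + k + k2) M2 S2 cg.
have [s3 [k3 [r3 [a3 [M3 [S3 [e4 [rr3 b3] T3 z3 q3]]]]]]] :=
  q2 l (t + k + k2 + 1) M2 S2 cc0 wc0 rr2 b2.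
have e := runs_cat R1 (runs_cat e2 (runs_cat e3 e4)).
exists s3, (k + (k2 + (1 + k3))), (r2 ++ r3), (a2 ++ a3), M3, S3; split=> //.
- by move: e; rewrite /= !csizeE !ksizeE.
- by rewrite T3 [tr (tick _)]T2 catA.
rewrite !addnA; apply: (simt_cat z1); apply: simt_cat z3.
apply: simt_end z2 _; rewrite /KC; lia.
Qed.

Definition outst s a := Hst (rg s) (fl s) (ag s) (tm s).+1 (rcons (tr s) ((tm s).+1, a)).

Lemma wp_out a (Q : hst -> Prop) s : (forall x, ag s (rg s a) x != None) ->
  Q (outst s (ag s (rg s a))) -> wp (Out a) Q s.
Proof.
move=> full q l t M S /= cc a64 rM bs.
have [cp co] := code_at_cat cc.
have [M1 [e1 r1 v1]] := copy_pred_run rM bs a64.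
have R1 := slrun_runs t S cp e1.
have [lP iP _] := code_at_cons co.
set k := size _ in lP iP R1 *.
have R2 : runs 1 (t + k) (State (l + k) M1 S) [:: ((t + k).+1, ag s (rg s a))]
   (State (l + k).+1 M1 S).
  exists (State (l + k).+1 M1 S), (Some (ag s (rg s a))), [::]; split=> //.
  rewrite /step /= lP iP /read_assign ifT; last first.
    by apply/forallP => x; rewrite v1; case: (ag _ _ x) (full x) => //= d.
  congr (ONext _ (Some _)); apply/ffunP => x; rewrite ffunE v1.
  by case: (ag _ _ x) (full x) => //= d; rewrite valK.
exists (outst s (ag s (rg s a))); eexists _, _, [:: ((tm s).+1, ag s (rg s a))], M1, S; split.
- rewrite size_cat addnA addn1; exact: (runs_cat R1 R2).
- by split.
- by rewrite /= cats1.
- have kE : k = n * 7 by apply: size_perx.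
  by rewrite /= subSnn subnn muln0 kE muln1; split=> //; rewrite /KC; try split; lia.
by [].
Qed.

Definition hst0 : hst := Hst (fun=> 0) (fun _ _ => 0) (fun=> [ffun=> None]) 0 [::].

Lemma wp_exec c Q : P = compile n 0 c ++ [:: IHalt] -> wfc c -> wp c Q hst0 ->
  exists s fuel real T, [/\ exec P B input w fuel 0 (init_state R) = (real, Some T),
    Q s & simt 0 0 real (tr s) T (tm s)].
Proof.
move=> EP wc H.
have cc : code_at 0 (compile n 0 c) by exists [::], [:: IHalt].
have r0 : rep hst0 (fun=> 0) by split=> //= x i; rewrite ffunE.
have b0 : bnd hst0 by split=> /= *; rewrite ?ffunE /=; lia.
have [s [k [r [a [M [S [e [_ _] T z q]]]]]]] := H 0 0 (fun=> 0) (fun=> 0%R) cc wc r0 b0.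
exists s, (k + 1), r, k; split=> //; last by rewrite T; rewrite add0n in z.
rewrite (exec_runs 1 e) /= add0n add0n.
rewrite /step /= EP size_cat /= addn1 ltnS leqnn nth_cat ltnn subnn /=.
by rewrite cats0.
Qed.
End Machine.

(** * Trees of binary gates *)

Section Trees.
Variables (n m : nat) (R : realType) (w : passign n m -> R).
Hypothesis mono : subset_monotone w.

Inductive tree := TLeaf of 'I_n & 'I_m | TOr of tree & tree | TAnd of tree & tree.

Implicit Types (tau sigma alpha : passign n m).

(** Smoothness, as required by [wft], makes both inputs of a disjunction agree here. *)
Fixpoint vars t : {set 'I_n} :=
  match t with
  | TLeaf x _ => [set x]
  | TOr a _ => vars a
  | TAnd a b => vars a :|: vars b
  end.

Fixpoint msem t (tau : passign n m) : bool :=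
  match t with
  | TLeaf x d => tau x == Some d
  | TOr a b => msem a tau || msem b tau
  | TAnd a b => msem a tau && msem b tau
  end.

Fixpoint best t : passign n m :=
  match t with
  | TLeaf x d => [ffun y => if y == x then Some d else None]
  | TOr a _ => best a
  | TAnd a b => ovl (best a) (best b)
  end.

(* The first argument of [TOr] is the one with the better maximum. *)
Fixpoint wft t : Prop :=
  match t with
  | TLeaf _ _ => True
  | TOr a b => [/\ wft a, wft b, vars a = vars b,
      forall tau, ~~ (msem a tau && msem b tau) & (w (best b) <= w (best a))%R]
  | TAnd a b => [/\ wft a, wft b & [disjoint vars a & vars b]]
  end.

Lemma msem_ext t tau sigma : wft t -> (forall x, x \in vars t -> tau x = sigma x) ->
  msem t tau = msem t sigma.
Proof.
elim: t => [x d|a IHa b IHb|a IHa b IHb] /=.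
- by move=> _ H; rewrite H ?inE.
- by case=> wa wb E _ _ H; rewrite IHa ?IHb // -E.
by case=> wa wb _ H; rewrite IHa ?IHb // => x xa; apply: H; rewrite inE xa ?orbT.
Qed.

Lemma ovlE (a b : passign n m) x : ovl a b x = if b x is Some d then Some d else a x.
Proof. by rewrite ffunE. Qed.

Lemma best_supp t x : wft t -> (best t x != None) = (x \in vars t).
Proof.
elim: t => [y d|a IHa b IHb|a IHa b IHb] /=.
- by rewrite ffunE inE; case: (x == y).
- by case=> wa _ _ _ _; rewrite IHa.
case=> wa wb _; rewrite inE -IHa // -IHb // ovlE.
by case: (best b x) => [d|] //=; rewrite ?orbT ?orbF.
Qed.

Lemma best_none t x : wft t -> x \notin vars t -> best t x = None.
Proof. by move=> /(best_supp x) <-; rewrite negbK => /eqP. Qed.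

Lemma ovl_in t tau x : wft t -> x \in vars t -> ovl tau (best t) x = best t x.
Proof. by move=> wt; rewrite -best_supp // ovlE; case: (best t x). Qed.

Lemma ovl_out t tau x : wft t -> x \notin vars t -> ovl tau (best t) x = tau x.
Proof. by move=> wt xt; rewrite ovlE best_none. Qed.

Lemma best_msem t : wft t -> msem t (best t).
Proof.
elim: t => [y d|a IHa b IHb|a IHa b IHb] /=.
- by rewrite ffunE eqxx.
- by case=> wa _ _ _ _; rewrite IHa.
case=> wa wb ab; apply/andP; split.
  rewrite (@msem_ext a _ (best a)) ?IHa // => x xa; rewrite ovl_out //.
  by apply/negP => xb; rewrite (disjointFl ab xb) in xa.
rewrite (@msem_ext b _ (best b)) ?IHb // => x xb; exact: ovl_in.
Qed.

Lemma vars_gt0 t : 0 < #|vars t|.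
Proof.
elim: t => [x d|a IHa b IHb|a IHa b IHb] //=; first by rewrite cards1.
by apply: leq_trans IHa _; apply: subset_leq_card; apply: subsetUl.
Qed.

(** Subset-monotonicity with [Y] the common variables: both overlays consist of [tau] erased on [Y],
    combined with one of the two maxima. *)
Lemma w_ovl tau a b : wft a -> wft b -> vars a = vars b ->
  (w (best a) <= w (best b))%R -> (w (ovl tau (best a)) <= w (ovl tau (best b)))%R.
Proof.
move=> wa wb E H.
have eqc t : wft t -> vars t = vars a -> ovl tau (best t) =
    pcombine (vars a) [ffun x => if x \in vars a then None else tau x] (best t).
  move=> wt Et; apply/ffunP => x; rewrite [RHS]ffunE -Et; case: ifP => xt.
    exact: ovl_in.
  by rewrite ovl_out ?xt // ffunE xt.
rewrite (eqc a) // (eqc b) //; apply: mono => // x xa.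
  by rewrite !best_none // -E.
by rewrite ffunE xa.
Qed.

Lemma ovlA (a b c : passign n m) : ovl (ovl a b) c = ovl a (ovl b c).
Proof. by apply/ffunP => x; rewrite !ovlE; case: (c x). Qed.

(** [tau] may be defined beyond [vars t]; so at a conjunction its two parts can be replaced one
    after the other, the first replacement leaving the variables of the second input alone. *)
Lemma best_opt t tau : wft t -> msem t tau -> (w tau <= w (ovl tau (best t)))%R.
Proof.
elim: t tau => [x d|a IHa b IHb|a IHa b IHb] tau /=.
- move=> _ /eqP E; rewrite (_ : ovl _ _ = tau) //; apply/ffunP => y.
  by rewrite ovlE ffunE; case: eqP => [->|].
- case=> wa wb E _ ba /orP[/(IHa _ wa) //|/(IHb _ wb) h].
  by apply: le_trans h _; apply: w_ovl.
case=> wa wb ab /andP[sa sb]; apply: le_trans (IHa _ wa sa) _.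
rewrite -ovlA; apply: IHb => //; rewrite (@msem_ext b _ tau) // => x xb.
by rewrite ovl_out // (disjointFl ab).
Qed.

(** A chain follows the first inputs: [offs] lists the alternatives left aside, [exitt] is the node
    where the chain ends. Together they are the inputs of one disjunction of unbounded arity. *)
Fixpoint offs t : seq tree := if t is TOr a b then b :: offs a else [::].
Fixpoint exitt t := if t is TOr a b then exitt a else t.
Definition depth t := size (offs t).

Fixpoint everyT (P : tree -> Prop) (l : seq tree) : Prop :=
  if l is t :: l' then P t /\ everyT P l' else True.

Lemma everyT_cat P l1 l2 : everyT P (l1 ++ l2) <-> everyT P l1 /\ everyT P l2.
Proof. by elim: l1 => //= [|t l1 ->]; tauto. Qed.

Lemma everyT_nth P l t0 : everyT P l <-> forall i, i < size l -> P (nth t0 l i).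
Proof.
elim: l => [|t l IH] /=; first by split.
split=> [[Pt /IH H] [|i] //|H]; first exact: H.
by split; [exact: (H 0)|apply/IH => i il; exact: (H i.+1)].
Qed.

Definition okoff (Y : {set 'I_n}) o := wft o /\ vars o = Y.

Lemma offs_ok t : wft t -> everyT (okoff (vars t)) (offs t).
Proof.
by elim: t => //= a IHa b _ [wa wb E _ _]; split; [split=> //; rewrite E|exact: IHa].
Qed.

Lemma exit_vars t : vars (exitt t) = vars t. Proof. by elim: t. Qed.
Lemma exit_best t : best (exitt t) = best t. Proof. by elim: t. Qed.
Lemma exit_wft t : wft t -> wft (exitt t).
Proof. by elim: t => //= a IHa b _ [/IHa]. Qed.
Lemma exit_not_or t : if exitt t is TOr _ _ then False else True.
Proof. by elim: t. Qed.

(** Determinism turns the disjunction into a sum of numbers. *)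
Lemma msem_split t tau : wft t ->
  (msem t tau : nat) = msem (exitt t) tau + count (msem^~ tau) (offs t).
Proof.
elim: t => [x d|a IHa b IHb|a IHa b IHb] //=; try by rewrite addn0.
case=> wa wb _ /(_ tau) ex _; rewrite addnCA -IHa //.
by case: (msem a tau) ex; case: (msem b tau).
Qed.

Definition pvars (ps : seq tree) : {set 'I_n} := \bigcup_(p <- ps) vars p.

Definition agree_out (Y : {set 'I_n}) (tau alpha : passign n m) :=
  [forall x, (x \in Y) || (tau x == alpha x)].

Lemma agree_outP (Y : {set 'I_n}) tau alpha :
  reflect (forall x, x \notin Y -> tau x = alpha x) (agree_out Y tau alpha).
Proof.
apply: (iffP forallP) => H x; first by move=> xY; move: (H x); rewrite (negbTE xY) => /eqP.
by case: (boolP (x \in Y)) => //= /H ->.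
Qed.

Definition pend ps tau := all (msem^~ tau) ps.

(* Number of ways in which [tau] extends a choice of one of [os] and is completed
   by elements of the pending trees [ps], the other variables being fixed by [alpha]. *)
Definition Dc (Y : {set 'I_n}) os ps alpha tau : nat :=
  count (msem^~ tau) os * (pend ps tau && agree_out (Y :|: pvars ps) tau alpha).

(** The analogue of [Dc] for a single tree [g] that is still to be expanded. *)
Definition Ec g ps alpha tau : nat :=
  [&& msem g tau, pend ps tau & agree_out (vars g :|: pvars ps) tau alpha].

Lemma Ec_split g ps alpha tau : wft g ->
  Ec g ps alpha tau = Ec (exitt g) ps alpha tau + Dc (vars g) (offs g) ps alpha tau.
Proof.
move=> wg; rewrite /Ec /Dc exit_vars -!mulnb -mulnDl mulnb -msem_split //.
Qed.

Lemma pvars_cons p ps : pvars (p :: ps) = vars p :|: pvars ps.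
Proof. by rewrite /pvars big_cons. Qed.

Lemma Ec_and a b ps alpha tau :
  Ec (TAnd a b) ps alpha tau = Ec a (b :: ps) alpha tau.
Proof. by rewrite /Ec /= pvars_cons setUA -!andbA. Qed.

(** Lawler's cut of a segment at the chosen alternative. *)
Lemma Dc_split Y os1 o os2 ps alpha tau : vars o = Y ->
  Dc Y (os1 ++ o :: os2) ps alpha tau =
  Dc Y os1 ps alpha tau + Dc Y os2 ps alpha tau + Ec o ps alpha tau.
Proof.
move=> Eo; rewrite /Dc /Ec Eo count_cat /=; set b := pend _ _ && _.
by case: (msem o tau); case: b => /=; lia.
Qed.

Lemma Dc_ext Y os ps alpha alpha' tau :
  (forall x, x \notin Y :|: pvars ps -> alpha x = alpha' x) ->
  Dc Y os ps alpha tau = Dc Y os ps alpha' tau.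
Proof.
move=> H; rewrite /Dc; congr (_ * (_ && _)).
by apply/agree_outP/agree_outP => h x xY; rewrite h // H.
Qed.

(** Says that [alpha] is the maximum of the subproblem on its pending trees; disjointness allows the
    maxima to be taken independently. *)
Fixpoint okl (ps : seq tree) (alpha : passign n m) : Prop :=
  if ps is p :: ps' then
    [/\ wft p, [disjoint vars p & pvars ps'],
        forall x, x \in vars p -> alpha x = best p x & okl ps' alpha]
  else True.

Lemma okl_ext ps alpha alpha' : okl ps alpha ->
  (forall x, x \in pvars ps -> alpha x = alpha' x) -> okl ps alpha'.
Proof.
elim: ps => //= p ps IH [h1 h2 h3 h4] H; split=> //.
  by move=> x xp; rewrite -H ?h3 // pvars_cons inE xp.
by apply: IH => // x xp; apply: H; rewrite pvars_cons inE xp orbT.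
Qed.

Lemma pend_ext ps alpha tau sigma : okl ps alpha ->
  (forall x, x \in pvars ps -> tau x = sigma x) -> pend ps tau = pend ps sigma.
Proof.
elim: ps => //= p ps IH [h1 h2 h3 h4] H; rewrite /pend /= -/(pend ps tau) -/(pend ps sigma).
rewrite (@msem_ext p _ sigma) ?IH // => x xp; apply: H;
  by rewrite pvars_cons inE xp ?orbT.
Qed.

(** The pending trees are replaced by their maxima one at a time, the score never decreasing, until
    [alpha] is reached. *)
Lemma pend_opt ps alpha tau : okl ps alpha -> pend ps tau ->
  agree_out (pvars ps) tau alpha -> (w tau <= w alpha)%R.
Proof.
elim: ps tau => [|p ps IH] tau.
  move=> _ _ /agree_outP H; suff -> : tau = alpha by rewrite lexx.
  by apply/ffunP => x; apply: H; rewrite /pvars big_nil inE.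
move=> /= [h1 h2 h3 h4] /andP[sp ss] /agree_outP H.
apply: le_trans (best_opt h1 sp) _; apply: IH => //.
  rewrite -(pend_ext (tau := tau) h4) // => x xp; rewrite ovl_out //.
  by rewrite (disjointFl h2).
apply/agree_outP => x xp; case: (boolP (x \in vars p)) => xv.
  by rewrite ovl_in // h3.
by rewrite ovl_out //; apply: H; rewrite pvars_cons inE negb_or xv.
Qed.

Lemma Ec_opt g ps alpha tau : okl (g :: ps) alpha -> 0 < Ec g ps alpha tau ->
  (w tau <= w alpha)%R.
Proof.
rewrite /Ec lt0b => ok /and3P[h1 h2 h3]; apply: (pend_opt ok).
  by rewrite /pend /= h1.
by rewrite pvars_cons.
Qed.

(** The end of a descent: only [alpha] is left, which is the assignment being output and must not be
    queued. *)
Lemma Ec_leaf_nil x d alpha tau : alpha x = Some d ->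
  Ec (TLeaf x d) [::] alpha tau = (tau == alpha).
Proof.
move=> Ea; rewrite /Ec /=; congr nat_of_bool.
apply/andP/eqP => [[/eqP E /agree_outP H]|->]; last first.
  by rewrite Ea eqxx; split=> //; apply/agree_outP.
apply/ffunP => y; case: (y =P x) => [->|/eqP yx]; first by rewrite E.
by apply: H; rewrite /pvars big_nil !inE orbF.
Qed.

Lemma Ec_leaf_cons x d p ps alpha tau : okl (TLeaf x d :: p :: ps) alpha ->
  Ec (TLeaf x d) (p :: ps) alpha tau = Ec p ps alpha tau.
Proof.
move=> [_ dis ax _]; rewrite /Ec /= andbA; congr nat_of_bool.
have {}ax : alpha x = Some d by rewrite ax /= ?inE // ffunE eqxx.
have xn : x \notin pvars (p :: ps).
  by rewrite (disjointFr dis) //= inE.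
rewrite -pvars_cons; apply/andP/andP => [[/and3P[/eqP E -> h2] /agree_outP H]|].
  rewrite h2; split=> //=; apply/agree_outP => y yp.
  case: (y =P x) => [->|/eqP yx]; first by rewrite E.
  by apply: H; rewrite inE negb_or yp inE yx.
case=> h1 /andP[h2 /agree_outP H]; rewrite h1 /= h2 H // ax eqxx; split=> //.
by apply/agree_outP => y; rewrite inE negb_or => /andP[_]; apply: H.
Qed.

(** First [tau] moves to the maximum of its own alternative [o'], then this one is exchanged for the
    maximum of [o], and the pending trees come last. *)
Lemma Dc_opt Y os ps alpha o tau : everyT (okoff Y) os -> okoff Y o ->
  everyT (fun o' => w (best o') <= w (best o))%R os ->
  okl (o :: ps) alpha -> 0 < Dc Y os ps alpha tau -> (w tau <= w alpha)%R.
Proof.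
move=> H1 [wo Eo] H2 ok; rewrite /Dc muln_gt0 -has_count lt0b => /andP[hs /andP[sp ao]].
have [o' [wo' Eo' so' bo']] : exists o', [/\ wft o', vars o' = Y, msem o' tau
    & (w (best o') <= w (best o))%R].
  elim: os H1 H2 hs => //= o' os IH [[h1 h2] h3] [h4 h5] /orP[h|]; last exact: IH.
  by exists o'.
apply: le_trans (best_opt wo' so') _.
apply: le_trans (w_ovl tau wo' wo _ bo') _; first by rewrite Eo'.
move: ok => [_ dis ax ok]; move/agree_outP: ao => ao.
apply: (pend_opt ok).
  rewrite -(pend_ext (tau := tau) ok) // => x xp; rewrite ovl_out //.
  by rewrite (disjointFl dis).
apply/agree_outP => x xp; case: (boolP (x \in vars o)) => xv.
  by rewrite ovl_in // ax.
by rewrite ovl_out //; apply: ao; rewrite inE negb_or -Eo xv.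
Qed.

(** A binary tree with [k] leaves has [2 * k - 1] nodes; as conjunctions have disjoint inputs, this
    bounds the conjunctions and leaves met by a descent. *)
Definition weight (ps : seq tree) := \sum_(p <- ps) (2 * #|vars p|).-1.

End Trees.

(** * Skew-binary jump pointers (Myers) *)

(** The rule for a node looks at the jump of its parent and at the jump after that, so the recursion
    carries the whole table of earlier targets. *)
Fixpoint jumps d : seq nat :=
  if d is p.+1 then
    let l := jumps p in
    let j := nth 0 l p in
    rcons l (if p - j == j - nth 0 l j then nth 0 l j else p)
  else [:: 0].

Definition J d := nth 0 (jumps d) d.

Lemma size_jumps d : size (jumps d) = d.+1.
Proof. by elim: d => //= d IH; rewrite size_rcons IH. Qed.

Lemma nth_jumps d i : i <= d -> nth 0 (jumps d) i = J i.
Proof.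
elim: d => [|d IH]; first by rewrite leqn0 => /eqP ->.
rewrite leq_eqVlt ltnS => /orP[/eqP -> //|id] /=.
by rewrite nth_rcons size_jumps ltnS id IH.
Qed.

Lemma J_le d : J d <= d.
Proof.
elim/ltn_ind: d => [[|p]] IH //; rewrite /J /= nth_rcons size_jumps ltnn eqxx.
rewrite nth_jumps //; have := IH p (leqnn _) => h; rewrite nth_jumps //.
case: ifP => _ //; apply: leq_trans (IH (J p) _) _; lia.
Qed.

Lemma JS p : J p.+1 = if p - J p == J p - J (J p) then J (J p) else p.
Proof.
have h := J_le p.
by rewrite {1}/J /= nth_rcons size_jumps ltnn eqxx !nth_jumps.
Qed.

Lemma J_lt d : 0 < d -> J d < d.
Proof.
case: d => // p _; rewrite JS; case: ifP => // _.
by have := J_le p; have := J_le (J p); lia.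
Qed.

Definition len d := d - J d.

Lemma JlenS p : J p.+1 = if len p == len (J p) then J (J p) else p.
Proof. exact: JS. Qed.

Lemma pow_lt_double a b : 2 ^ a - 1 < 2 ^ b - 1 -> (2 ^ a - 1).*2.+1 <= 2 ^ b - 1.
Proof.
move=> h; have ab : a < b.
  by rewrite ltnNge; apply/negP => ba; have := leq_pexp2l (isT : 0 < 2) ba; lia.
have := leq_pexp2l (isT : 0 < 2) ab; rewrite expnS.
by have := expn_gt0 2 a; lia.
Qed.

(** The successive jump lengths are the digits of the skew-binary expansion of [d]: numbers
    [2 ^ k - 1] in increasing order, of which only the least may occur twice. *)
Lemma len_inv d : 0 < d ->
  [/\ exists2 k, 0 < k & len d = 2 ^ k - 1,
      0 < J d -> len d <= len (J d)
    & 0 < J d -> 0 < J (J d) -> len (J d) < len (J (J d))].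
Proof.
elim/ltn_ind: d => [[//|[|p]]] IH _; first by split=> //; exists 1.
set q := p.+1 in IH *; have q0 : 0 < q by [].
have [[k k0 Ek] H2 H3] := IH q (leqnn _) q0.
have Jq := J_lt q0.
have lq : 0 < len q by rewrite subn_gt0.
have E := JlenS q; case: eqP E => [El|El] E; rewrite E.
  have Jq0 : 0 < J q by case: (J q) El => //; rewrite /len /=; lia.
  have [[k' _ Ek'] H2' H3'] := IH (J q) (leqW Jq) Jq0.
  have JJ := J_lt Jq0.
  have lE : len q.+1 = (len q).*2.+1 by rewrite {1}/len E -addnn {2}El /len; lia.
  have := expn_gt0 2 k => /= k1.
  split=> [|JJ0|JJ0 JJJ0].
  - by exists k.+1 => //; rewrite lE Ek expnS; lia.
  - rewrite lE Ek.
    have [[k2 _ Ek2] _ _] := IH (J (J q)) (ltn_trans JJ (leqW Jq)) JJ0.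
    rewrite Ek2; apply: pow_lt_double; rewrite -Ek -Ek2 El; exact: H3.
  exact: H3'.
have lE : len q.+1 = 1 by rewrite /len E; lia.
split=> [|_|_ J0]; first by exists 1.
  by rewrite lE.
by rewrite ltn_neqAle H2 // andbT; apply/eqP.
Qed.

(* [hop b d h]: climbing from depth [d] to depth [b], along the jump pointer
   whenever it does not overshoot, takes [h] moves. *)
Inductive hop (b : nat) : nat -> nat -> Prop :=
| hop_stop d : d <= b -> hop b d 0
| hop_jump d h : b < d -> b <= J d -> hop b (J d) h -> hop b d h.+1
| hop_step d h : b < d -> J d < b -> hop b d.-1 h -> hop b d h.+1.

(** A jump of length [2 ^ k - 1] that would overshoot decomposes into a step to the parent and two
    consecutive jumps of length [2 ^ (k - 1) - 1]. At most two moves lead to the half that contains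
    [b]. *)
Lemma hop_down k b d : len d = 2 ^ k - 1 -> J d < b ->
  exists2 h, hop b d h & h <= 2 * k.
Proof.
elim: k b d => [|k IH] b d.
  by rewrite /len => E Jb; exists 0 => //; apply: hop_stop; lia.
move=> Ed Jb; have [db|bd] := leqP d b; first by exists 0 => //; exact: hop_stop.
case: d Ed Jb bd => [|[|p]] Ed Jb bd; try lia.
have E := JlenS p.+1; set q := p.+1 in E Ed Jb bd *.
case: eqP E => [El|_] E; last by rewrite E in Jb; lia.
have lE : len q.+1 = (len q).*2.+1.
  rewrite {1}/len E -addnn {2}El /len; have := J_le (J q); have := J_le q; lia.
have Ek : len q = 2 ^ k - 1.
  by move: Ed; rewrite lE expnS; have := expn_gt0 2 k; lia.
have [bJ|Jb'] := leqP b (J q).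
  have [h H hk] : exists2 h, hop b (J q) h & h <= 2 * k.
    by apply: IH; rewrite -?El // -E.
  exists h.+2; last by lia.
  apply: hop_step => //=; have [qb|bq] := leqP q b; last exact: hop_jump.
  by have := @J_lt q isT; lia.
have [h H hk] := IH b q Ek Jb'.
by exists h.+1; [apply: hop_step|lia].
Qed.

(** As long as jumps do not overshoot, their lengths grow, except that the first may be repeated
    once: the boolean in the measure pays for that. After the first overshoot [hop_down] finishes,
    within [2 * K] moves. *)
Lemma hop_bound K b d : d < 2 ^ K -> exists2 h, hop b d h & h <= 4 * K + 2.
Proof.
move=> dK.
suff G k : 0 < d -> len d = 2 ^ k - 1 ->
   exists2 h, hop b d h & h <= 2 * (K - k) + (len d == len (J d)) + 2 * K + 1.
  have [->|d0] := posnP d; first by exists 0 => //; apply: hop_stop.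
  have [[k _ Ek] _ _] := len_inv d0.
  have [h H hk] := G k d0 Ek; exists h => //; apply: leq_trans hk _.
  by case: (_ == _) => /=; lia.
elim/ltn_ind: d k dK => d IH k dK d0 Ek.
have kK : k <= K.
  rewrite leqNgt; apply/negP => Kk; have := leq_pexp2l (isT : 0 < 2) Kk.
  by rewrite expnS; move: Ek dK; rewrite /len; lia.
have [db|bd] := leqP d b; first by exists 0 => //; exact: hop_stop.
have [bJ|Jb] := leqP b (J d); last first.
  by have [h H hk] := hop_down Ek Jb; exists h => //; lia.
have [J0|J0] := posnP (J d).
  exists 1; last by lia.
  by apply: hop_jump => //; apply: hop_stop; lia.
have [_ H2 H3] := len_inv d0.
have [[k' _ Ek'] _ _] := len_inv J0.
have Jd := J_lt d0.
have [h H hk] := IH _ Jd k' (ltn_trans Jd dK) J0 Ek'.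
exists h.+1; first exact: hop_jump.
have k'K : k' <= K.
  rewrite leqNgt; apply/negP => Kk; have := leq_pexp2l (isT : 0 < 2) Kk.
  by rewrite expnS; move: Ek' dK; rewrite /len; lia.
case: eqP (H2 J0) => [El|El] Hle.
  have kk : k' = k.
    apply/eqP; rewrite -(eqn_exp2l _ _ (isT : 1 < 2)).
    have := expn_gt0 2 k; have := expn_gt0 2 k'; move: El; rewrite Ek Ek'; lia.
  have : (len (J d) == len (J (J d))) = false.
    have [JJ0|JJ0] := posnP (J (J d)); last by have := H3 J0 JJ0; lia.
    by rewrite JJ0; apply/eqP; have := J_lt J0; rewrite {1}/len JJ0 {1}/len /=; lia.
  by move=> E; rewrite E kk in hk; lia.
have kk : k < k'.
  rewrite ltnNge; apply/negP => k'k; have := leq_pexp2l (isT : 0 < 2) k'k; move: El Hle.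
  by rewrite Ek Ek'; lia.
by move: hk; case: (_ == _) => /=; lia.
Qed.

(** * Layout of the data structures *)

(* Fields 0..12 belong to immutable objects (circuit nodes, subproblems, list
   cells), allocated in one common index space. *)
Notation fK := 0 (only parsing).
Notation fL := 1 (only parsing).
Notation fR := 2 (only parsing).
Notation fEX := 3 (only parsing).
Notation fDP := 4 (only parsing).
Notation fJP := 5 (only parsing).
Notation fJM := 6 (only parsing).
Notation fRV := 7 (only parsing).
Notation fRX := 8 (only parsing).
Notation fRY := 9 (only parsing).
Notation fRP := 10 (only parsing).
Notation fCG := 11 (only parsing).
Notation fCN := 12 (only parsing).
Notation fND := 20 (only parsing).
Notation fSG := 21 (only parsing).
Notation fSI := 22 (only parsing).
Notation fSA := 23 (only parsing).
Notation fT := 24 (only parsing).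
Notation fBUF := 25 (only parsing).

Section Nodes.
Variables (n m : nat) (R : realType) (w : passign n m -> R).
Implicit Types (F : nat -> nat -> nat) (G : nat -> passign n m) (t : tree n m).

(** The jump skips [i] itself and the nodes before its target. The best alternative is stored as the
    node offering it, since a query must return a position at which the segment can be cut. *)
Definition jumpok F G d i :=
  F fJP i = iter (len d) (F fL) i /\
  exists2 j, j < len d & F fJM i = iter j (F fL) i /\
    forall j', j' < len d ->
      (w (G (F fR (iter j' (F fL) i))) <= w (G (F fR (F fJM i))))%R.

(** Several subtrees may be represented by one object. Index 0 is the null reference. *)
Fixpoint nrep F G t i : Prop :=
  [/\ 0 < i, G i = best t, F fDP i = depth t &
  match t with
  | TLeaf _ _ => [/\ F fK i = 0, F fEX i = i & F fJP i = i]
  | TAnd a b => [/\ F fK i = 2, F fEX i = i /\ F fJP i = i,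
      F fL i < i /\ F fR i < i, nrep F G a (F fL i) & nrep F G b (F fR i)]
  | TOr a b => [/\ F fK i = 1, F fEX i = F fEX (F fL i) /\ jumpok F G (depth t) i,
      F fL i < i /\ F fR i < i, nrep F G a (F fL i) & nrep F G b (F fR i)]
  end].

Fixpoint sub t j :=
  if j is j'.+1 then if t is TOr a _ then sub a j' else t else t.

Lemma depth_sub t j : j <= depth t -> depth (sub t j) = depth t - j.
Proof.
elim: j t => [|j IH] [x d|a b|a b] //= h; try by rewrite subn0.
by rewrite IH.
Qed.

Lemma offs_sub t j : offs (sub t j) = drop j (offs t).
Proof. by elim: j t => [|j IH] [x d|a b|a b] //=; rewrite ?drop0. Qed.

Lemma vars_sub t j : vars (sub t j) = vars t.
Proof. by elim: j t => [|j IH] [x d|a b|a b] //=. Qed.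

Lemma wft_sub t j : wft w t -> wft w (sub t j).
Proof. by elim: j t => [|j IH] [x d|a b|a b] //= [wa _ _ _ _]; apply: IH. Qed.

(** The inequality bounds chain lengths by object indices: depths fit in words, and scans are
    logarithmic in the number of objects. *)
Lemma nrep_sub F G t i j : nrep F G t i -> j <= depth t ->
  nrep F G (sub t j) (iter j (F fL) i) /\ iter j (F fL) i + j <= i.
Proof.
elim: j t i => [|j IH] [x d|a b|a b] i //; try by rewrite addn0.
move=> /= [_ _ _ [_ _ [Li _] ra _]] h; rewrite -iterS iterSr.
by have [h1 h2] := IH a _ ra h; split=> //; lia.
Qed.

Lemma nrep_offs F G t i j t0 : nrep F G t i -> j < depth t ->
  nrep F G (nth t0 (offs t) j) (F fR (iter j (F fL) i)) /\
  F fR (iter j (F fL) i) < i.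
Proof.
move=> r jd; have [r1 h1] := nrep_sub r (ltnW jd).
have E := offs_sub t j; rewrite (drop_nth t0) // in E.
case: (sub t j) r1 E => [x d|a b|a b] //= [_ _ _ [_ _ [_ Ri] _ rb]] [<- _].
by split=> //; lia.
Qed.

Lemma nrep_exit F G t i : nrep F G t i ->
  [/\ nrep F G (exitt t) (F fEX i), F fEX i <= i &
      F fEX i = iter (depth t) (F fL) i].
Proof.
elim: t i => [x d|a IHa b IHb|a IHa b IHb] i r.
- by case: (r) => _ _ _ [_ E _]; rewrite /= E.
- case: r => _ _ _ [_ [E _] [Li _] ra _]; rewrite E.
  have [h1 h2 h3] := IHa _ ra; split=> //; first by lia.
  by rewrite h3 -iterSr.
by case: (r) => _ _ _ [_ [E _] _ _ _]; rewrite /= E.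
Qed.

Lemma nrep_dp F G t i : nrep F G t i -> F fDP i = depth t.
Proof. by case: t => [x d|a b|a b] []. Qed.
Lemma nrep_gt0 F G t i : nrep F G t i -> 0 < i.
Proof. by case: t => [x d|a b|a b] []. Qed.
Lemma nrep_best F G t i : nrep F G t i -> G i = best t.
Proof. by case: t => [x d|a b|a b] []. Qed.

Lemma nrep_jp F G t i : nrep F G t i -> F fJP i = iter (len (depth t)) (F fL) i.
Proof.
case: t => [x d|a b|a b] [] _ _ _ [].
- by [].
- by move=> _ [_ []].
by move=> _ [].
Qed.

Lemma nrep_jump F G t i : nrep F G t i -> 0 < depth t -> jumpok F G (depth t) i.
Proof. by case: t => [x d|a b|a b] [] // _ _ _ [_ []]. Qed.

Lemma nrep_jp_sub F G t i : nrep F G t i ->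
  nrep F G (sub t (len (depth t))) (F fJP i) /\
  depth (sub t (len (depth t))) = J (depth t).
Proof.
move=> r; have le : len (depth t) <= depth t by rewrite /len leq_subr.
rewrite (nrep_jp r); have [r' _] := nrep_sub r le; split=> //.
by rewrite depth_sub // /len subKn // J_le.
Qed.

Lemma jumpok0 F G a p N : F fL N = p -> F fJP N = p -> F fJM N = N ->
  J (depth a).+1 = depth a -> jumpok F G (@depth n m a).+1 N.
Proof.
move=> EL EJ EM E; have l1 : len (depth a).+1 = 1 by rewrite /len E; lia.
rewrite /jumpok l1 /= EL EM; split=> //; exists 0 => //; split=> //.
by case.
Qed.

(** The combined jump of Myers skips [N], then what [p] skips, then what the target of [p] skips; so
    the best of three stored candidates is the best of all. *)
Lemma jumpok1 F G a p N b : F fL N = p -> nrep F G a p -> 0 < depth a ->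
  len (depth a) = len (J (depth a)) ->
  F fJP N = F fJP (F fJP p) -> F fJM N = b ->
  b \in [:: N; F fJM p; F fJM (F fJP p)] ->
  (forall c, c \in [:: N; F fJM p; F fJM (F fJP p)] ->
     (w (G (F fR c)) <= w (G (F fR b)))%R) ->
  jumpok F G (depth a).+1 N.
Proof.
move=> EL ra d0 El EJ EM bi bmax; set d := depth a in d0 El *.
have [rj dj] := nrep_jp_sub ra; rewrite -/d in dj rj.
have Jd : J d < d by exact: J_lt.
have J0 : 0 < J d by move: El; rewrite /len; case: (J d) Jd => // /=; lia.
have E : J d.+1 = J (J d) by rewrite JlenS El eqxx.
have le1 : len d.+1 = (len d + len (J d)).+1.
  by rewrite /len E; have := J_le (J d); lia.
have [j1 [k1 k1l [k1E k1M]]] := nrep_jump ra d0.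
rewrite -dj in J0; have [j2 [k2 k2l [k2E k2M]]] := nrep_jump rj J0.
rewrite dj in k2l k2M j2; rewrite -/d in j1 k1l k1E k1M.
have it1 j : iter j.+1 (F 1) N = iter j (F 1) p by rewrite iterSr EL.
have it2 j : iter (len d + j).+1 (F 1) N = iter j (F 1) (F fJP p).
  by rewrite it1 addnC iterD j1.
split; first by rewrite le1 it2 EJ j2.
have [j jl jE] : exists2 j, j < len d.+1 & b = iter j (F 1) N.
  move: bi; rewrite !inE => /or3P[] /eqP ->; first by exists 0; rewrite // le1.
    by exists k1.+1; rewrite ?it1 // le1; lia.
  by exists (len d + k2).+1; rewrite ?it2 // le1; lia.
exists j => //; split; first by rewrite EM.
move=> j' jl'; rewrite EM; case: j' jl' => [|j'] jl'.
  by apply: bmax; rewrite !inE eqxx.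
have [lj|lj] := ltnP j' (len d).
  rewrite it1; apply: le_trans (k1M _ lj) _; apply: bmax.
  by rewrite !inE eqxx orbT.
rewrite -(subnKC lj) it2; apply: le_trans (k2M _ _) _; first by lia.
by apply: bmax; rewrite !inE eqxx !orbT.
Qed.

(** Fields from 20 on are mutable arrays and therefore exempt. *)
Definition below N F G F' G' :=
  (forall f i, f < 20 -> i < N -> F' f i = F f i) /\ (forall i, i < N -> G' i = G i).

Lemma iter_below N F G F' G' t i j : below N F G F' G' -> nrep F G t i -> i < N ->
  j <= depth t -> iter j (F' fL) i = iter j (F fL) i.
Proof.
move=> [H1 _]; elim: j t i => // j IH [x d|a b|a b] i // r iN h.
case: r => _ _ _ [_ _ [Li _] ra _]; rewrite !iterSr (H1 1 i isT iN).
by apply: (IH a) => //; apply: ltn_trans Li iN.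
Qed.

(** All that an object refers to, including its jump target and the stored best candidate, has an
    index at most its own. *)
Lemma nrep_below N F G F' G' t i : below N F G F' G' -> nrep F G t i -> i < N ->
  nrep F' G' t i.
Proof.
move=> H; have [H1 H2] := H.
elim: t i => [x d|a IHa b IHb|a IHa b IHb] i r iN.
- by case: r => h1 h2 h3 [h4 h5 h6]; rewrite /= !H1 // !H2.
- have r0 := r.
  case: r => h1 h2 h3 [h4 [h5 hj] [h6 h6'] h7 h8].
  have [LN RN] : F 1 i < N /\ F 2 i < N by lia.
  rewrite /= H2 // !(H1 _ i) // (H1 3 (F 1 i)) //; split=> //; split=> //; last 2 first.
  + exact: IHa.
  + exact: IHb.
  split=> //.
  case: hj => j1 [j jl [j2 j3]].
  have lend : len (depth (TOr a b)) <= depth (TOr a b) by rewrite /len leq_subr.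
  have it j' : j' <= len (depth (TOr a b)) -> iter j' (F' 1) i = iter j' (F 1) i.
    by move=> hj'; apply: (iter_below H r0 iN); apply: leq_trans hj' lend.
  rewrite /jumpok !(H1 _ i) // it //; split=> //; exists j => //.
  rewrite it; last exact: ltnW.
  split=> // j' lj'; rewrite it; last exact: ltnW.
  have jd : j' < depth (TOr a b) by apply: leq_trans lj' lend.
  have jd' : j < depth (TOr a b) by apply: leq_trans jl lend.
  have [_ b1] := nrep_sub r0 (ltnW jd); have [_ b1'] := nrep_sub r0 (ltnW jd').
  have [_ b2] := nrep_offs a r0 jd; have [_ b2'] := nrep_offs a r0 jd'.
  rewrite (H1 2 (iter j' _ _)) // ?(H2 (F 2 _)); try lia.
  rewrite (H1 2 (F 6 i)) // ?j2; last by lia.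
  rewrite H2; last by lia.
  by rewrite -j2; apply: j3.
case: r => h1 h2 h3 [h4 [h5 h5'] [h6 h6'] h7 h8].
have [LN RN] : F 1 i < N /\ F 2 i < N by lia.
rewrite /= H2 // !(H1 _ i) //; split=> //; split=> //; [exact: IHa|exact: IHb].
Qed.

Lemma below_trans N N' F G F1 G1 F2 G2 : N <= N' ->
  below N F G F1 G1 -> below N' F1 G1 F2 G2 -> below N F G F2 G2.
Proof.
move=> NN [a1 a2] [b1 b2]; split=> [f i f20 iN|i iN].
  by rewrite b1 ?a1 //; lia.
by rewrite b2 ?a2 //; lia.
Qed.

(** Pending lists are persistent: their cells are objects as well, so subproblems share tails. *)
Fixpoint lrep F G (N : nat) (ps : seq (tree n m)) (p : nat) : Prop :=
  if ps is t :: ps' then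
    [/\ 0 < p < N, F fCG p < N, nrep F G t (F fCG p) & lrep F G N ps' (F fCN p)]
  else p = 0.

Lemma lrep_below N N' F G F' G' ps p : below N F G F' G' -> N <= N' ->
  lrep F G N ps p -> lrep F' G' N' ps p.
Proof.
move=> H NN; have [H1 H2] := H; elim: ps p => //= t ps IH p [h1 h2 h3 h4].
have pN : p < N by lia.
rewrite !H1 //; split; [lia|lia| |exact: IH].
exact: nrep_below H h3 h2.
Qed.

End Nodes.

Notation "a ;; b" := (Seq a b) (at level 90, right associativity).

(** * The program *)

(* Register 0 is the next free object. *)

Definition c_leaf :=
  Const 17 0;; St fK 0 17;; St fEX 0 0;; St fDP 0 17;; St fJP 0 0;;
  Leaf 0 5 6;; Mov 12 0;; AddK 0 0 1.

Definition c_and :=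
  St fK 0 4;; St fL 0 13;; St fR 0 14;; Const 17 0;; St fEX 0 0;; St fDP 0 17;;
  St fJP 0 0;; Ovl 0 13 14;; Mov 12 0;; AddK 0 0 1.

Definition c_better :=
  Ld 27 fR 25;; Ld 28 fR 26;; If (CW 27 28) (Mov 25 26) Skip.

Definition c_jump0 := St fJP 0 15;; St fJM 0 0.

Definition c_jump1 :=
  St fJP 0 21;; Mov 25 0;; Ld 26 fJM 15;; c_better;; Ld 26 fJM 18;; c_better;;
  St fJM 0 25.

(** Only an exit is its own jump target, which detects a child of depth 0. Jump lengths are
    differences of depths. *)
Definition c_or_jump :=
  Ld 18 fJP 15;;
  If (CNe 18 15)
    (Ld 20 fDP 18;; Ld 21 fJP 18;; Ld 22 fDP 21;; Subt 23 19 20;; Subt 24 20 22;;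
     If (CNe 23 24) c_jump0 c_jump1)
    c_jump0.

(** [Ovl 0 15 15] copies the assignment of the better child. *)
Definition c_or :=
  If (CW 13 14) (Mov 15 14;; Mov 16 13) (Mov 15 13;; Mov 16 14);;
  St fK 0 4;; St fL 0 15;; St fR 0 16;; Ld 17 fEX 15;; St fEX 0 17;;
  Ld 19 fDP 15;; AddK 17 19 1;; St fDP 0 17;; Ovl 0 15 15;; c_or_jump;;
  Mov 12 0;; AddK 0 0 1.

(* Tournament tree: the node covering the leaves [q z, q z + z), with [z] a power
   of two, is stored at index [z (2 q + 1)]; it holds the best live object, or 0. *)
Definition c_choose :=
  If (CNz 38) (If (CNz 39) (If (CW 38 39) (Mov 40 39) (Mov 40 38)) (Mov 40 38))
    (Mov 40 39).

Definition c_climb :=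
  While (CLt 33 30)
    (Add 35 33 33;; Half 34 34;; Add 36 34 34;; AddK 36 36 1;; Mul 37 35 36;;
     Subt 38 37 33;; Add 39 37 33;; Ld 38 fT 38;; Ld 39 fT 39;; c_choose;;
     St fT 37 40;; Mov 33 35).

Definition c_update :=
  Const 33 1;; Mov 34 31;; Add 37 31 31;; AddK 37 37 1;; St fT 37 32;; c_climb.

(** Doubling needs no rebuilding: the old tree stays in place as the left half of the new one, and
    only the new root must be given the old winner. *)
Definition c_insert :=
  While (CLe 30 31) (Ld 36 fT 30;; Add 30 30 30;; St fT 30 36);;
  Mov 32 31;; c_update.

(* Register 46 receives the node [y] of the segment [41, 42) whose other child has
   the best maximum. *)
Definition c_scan :=
  While (CNe 45 42)
    (Ld 48 fJP 45;; Ld 52 fDP 48;;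
     If (CLe 47 52) (Ld 49 fJM 45;; Mov 45 48) (Mov 49 45;; Ld 45 fL 45);;
     Ld 50 fR 46;; Ld 51 fR 49;; If (CW 50 51) (Mov 46 49) Skip).

Definition c_query := Mov 45 41;; Mov 46 41;; Ld 47 fDP 42;; c_scan.

(* Creates the subproblem for the segment [41, 42), the pending list 43 and the
   fixed values of the assignment of object 44. *)
Definition c_push :=
  c_query;;
  St fRV 0 41;; St fRX 0 42;; St fRY 0 46;; St fRP 0 43;; Ld 50 fR 46;; Ovl 0 44 50;;
  Mov 31 0;; AddK 0 0 1;; c_insert.

(** A conjunction postpones its second input; after a leaf the next pending tree is taken, and
    register 58 is cleared when there is none. *)
Definition c_next :=
  Ld 55 fK 57;;
  If (CNz 55)
    (Ld 55 fR 57;; St fCG 0 55;; St fCN 0 59;; Mov 59 0;; AddK 0 0 1;; Ld 56 fL 57)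
    (If (CNz 59) (Ld 56 fCG 59;; Ld 59 fCN 59) (Const 58 0)).

(* Fixes the node 56 and the pending nodes 59 to their maxima, creating a subproblem
   for each disjunction passed on the way. *)
Definition c_descend_loop :=
  While (CNz 58)
    (Ld 57 fEX 56;;
     If (CNe 57 56) (Mov 41 56;; Mov 42 57;; Mov 43 59;; c_push) Skip;;
     c_next).

Definition c_descend := Const 58 1;; c_descend_loop.

Definition c_push_seg := If (CNe 54 55) (Mov 41 54;; Mov 42 55;; c_push) Skip.

(* Removes the subproblem 44 from the queue and inserts a partition of its other
   elements. *)
Definition c_pop :=
  Mov 31 44;; Const 32 0;; c_update;;
  Ld 53 fRY 44;; Ld 43 fRP 44;; Ld 54 fRV 44;; Mov 55 53;; c_push_seg;;
  Ld 54 fL 53;; Ld 55 fRX 44;; c_push_seg;;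
  Ld 56 fR 53;; Ld 59 fRP 44;; c_descend.

(* Registers of the depth-first search: 1 stack pointer, 2 gate, 3 its offset,
   4 its kind, 5 number of inputs, 6 next input, 7 input gate, 8 its node. *)
Definition c_edge :=
  Ld 13 fSA 1;;
  If (CNz 13)
    (Mov 14 8;; Const 10 1;; If (CLe 4 10) c_or c_and;; St fSA 1 12)
    (St fSA 1 8);;
  AddK 6 6 1;; St fSI 1 6.

Definition c_enter := AddK 1 1 1;; Const 10 0;; St fSG 1 7;; St fSI 1 10;; St fSA 1 10.

Definition c_leave := St fND 2 10;; Const 10 1;; Subt 1 1 10.

Definition c_dfs_step :=
  Ld 2 fSG 1;; AddK 3 2 2;; Inp 3 3;; Inp 4 3;;
  If (CNz 4)
    (AddK 5 3 1;; Inp 5 5;; Ld 6 fSI 1;;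
     If (CLt 6 5)
       (Add 7 3 6;; AddK 7 7 2;; Inp 7 7;; Ld 8 fND 7;; If (CNz 8) c_edge c_enter)
       (Ld 10 fSA 1;; c_leave))
    (AddK 5 3 1;; AddK 6 3 2;; Inp 5 5;; Inp 6 6;; c_leaf;; Mov 10 12;; c_leave).

Definition c_dfs_loop := While (CNz 1) c_dfs_step.

Definition c_dfs :=
  Const 0 1;; Const 10 1;; Inp 7 10;; Const 1 1;; St fSG 1 7;;
  c_dfs_loop;;
  Const 10 1;; Inp 7 10;; Ld 44 fND 7.

(* The number of outputs computed in advance: the least number whose square is at least
   the number of objects. The logarithm of the number of objects is then at most twice
   that of the number of outputs, as long as any are left. *)
Definition c_root :=
  Const 60 0;; Const 63 0;;
  While (CLt 63 0) (AddK 60 60 1;; Mul 63 60 60).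

(** [Mov 60 61] lowers the bound of the loop to leave it when the queue is empty. *)
Definition c_buf_loop :=
  While (CLt 61 60)
    (If (CNz 44) (St fBUF 61 44;; AddK 61 61 1;; c_pop;; Ld 44 fT 30) (Mov 60 61)).

Definition c_buffer :=
  Const 30 1;; Const 61 0;; St fBUF 61 44;; Const 61 1;; Mov 56 44;; Const 59 0;;
  c_descend;; Ld 44 fT 30;; c_buf_loop.

Definition c_out_loop := While (CLt 62 61) (Ld 63 fBUF 62;; Out 63;; AddK 62 62 1).

Definition c_main_loop := While (CNz 44) (Out 44;; c_pop;; Ld 44 fT 30).

Definition c_main :=
  c_dfs;; c_root;; c_buffer;; Const 62 0;; c_out_loop;; Ld 44 fT 30;; c_main_loop.

Lemma wfc_main : wfc c_main.
Proof. by []. Qed.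

(** * Correctness of the program *)

Ltac wstep :=
  match goal with
  | V4 : is_true (4 <= ?V), HB : is_true (obase _ + _ <= ?B),
    HI : forall i, is_true (nth 0 _ i < ?V)
    |- _ =>
  lazymatch goal with
  | |- wp _ _ _ _ _ (Seq _ _) _ _ => apply: (wp_seq V4 HB)
  | |- wp _ _ _ _ _ (Const _ _) _ _ => apply: (wp_const _ _ V4 HB)
  | |- wp _ _ _ _ _ (Mov _ _) _ _ => apply: (wp_mov _ _ V4 HB)
  | |- wp _ _ _ _ _ (Subt _ _ _) _ _ => apply: (wp_sub _ _ V4 HB)
  | |- wp _ _ _ _ _ (Half _ _) _ _ => apply: (wp_half _ _ V4 HB)
  | |- wp _ _ _ _ _ (Ld _ _ _) _ _ => apply: (wp_ld _ _ V4 HB)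
  | |- wp _ _ _ _ _ (St _ _ _) _ _ => apply: (wp_st _ _ V4 HB)
  | |- wp _ _ _ _ _ (Inp _ _) _ _ => apply: (wp_inp _ V4 HB HI)
  | |- wp _ _ _ _ _ (Ovl _ _ _) _ _ => apply: (wp_ovl _ _ V4 HB)
  | |- wp _ _ _ _ _ (AddK _ _ _) _ _ => apply: (wp_addk _ _ V4 HB)
  | |- wp _ _ _ _ _ (Add _ _ _) _ _ => apply: (wp_add _ _ V4 HB)
  | |- wp _ _ _ _ _ (Mul _ _ _) _ _ => apply: (wp_mul _ _ V4 HB)
  | |- wp _ _ _ _ _ Skip _ _ => apply: wp_skip
  | |- wp _ _ _ _ _ (If _ _ _) _ _ => apply: (wp_if V4 HB)
  end
  end.

(** * Frame conditions *)

Section Frames.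
Variables (n m : nat).
Local Notation hst := (hst n m).

(** Values, immutability of objects, silence and cost are bundled in one relation, so that the
    effect of a routine on any invariant follows from lemmas on [upto] alone. *)
Record upto (L Fs : seq nat) (k : nat) (s s' : hst) : Prop := Upto {
  upto_rg : forall x, x \notin L -> rg s' x = rg s x;
  upto_fl : forall f, 20 <= f -> f \notin Fs -> fl s' f = fl s f;
  upto_le : rg s 0 <= rg s' 0;
  upto_below : below (rg s 0) (fl s) (ag s) (fl s') (ag s');
  upto_tr : tr s' = tr s;
  upto_tm : tm s' <= tm s + k }.

Lemma upto_trans L1 L2 L Fs1 Fs2 Fs k1 k2 k s s1 s2 :
  upto L1 Fs1 k1 s s1 -> upto L2 Fs2 k2 s1 s2 ->
  {subset L1 <= L} -> {subset L2 <= L} -> {subset Fs1 <= Fs} -> {subset Fs2 <= Fs} ->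
  k1 + k2 <= k -> upto L Fs k s s2.
Proof.
move=> [a1 a2 a3 a4 a5 a6] [b1 b2 b3 b4 b5 b6] sL1 sL2 sF1 sF2 kk; split.
- move=> x xL; rewrite b1 ?a1 //; [apply: contra xL; exact: sL1|].
  by apply: contra xL; apply: sL2.
- move=> f f20 fL; rewrite b2 ?a2 //; first by apply: contra fL; apply: sF1.
  by apply: contra fL; apply: sF2.
- exact: leq_trans a3 b3.
- exact: below_trans a3 a4 b4.
- by rewrite b5.
by lia.
Qed.

Lemma upto_refl L Fs k s : upto L Fs k s s.
Proof. by split=> //; rewrite leq_addr. Qed.

Lemma upto_setr L Fs k s s1 x v : upto L Fs k s s1 -> x \in L ->
  (x = 0 -> rg s 0 <= v) -> upto L Fs k.+1 s (setr s1 x v).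
Proof.
move=> [a1 a2 a3 a4 a5 a6] xL h; split=> //=.
- by move=> y yL; case: eqP => [E|_]; [rewrite E xL in yL|exact: a1].
- by case: x h {xL} => //= h; apply: h.
by rewrite addnS.
Qed.

Lemma upto_setf L Fs k s s1 f i v : all (leq 20) Fs -> upto L Fs k s s1 ->
  (f \in Fs) || (f < 20) && (rg s 0 <= i) -> upto L Fs k.+1 s (setf s1 f i v).
Proof.
move=> F20 [a1 a2 a3 [a4 a4'] a5 a6] h; split=> //=.
- move=> g g20 gF; case: (g =P f) => [E|_]; last exact: a2.
  by move: h; rewrite -E (negbTE gF) ltnNge g20.
- split=> // g j g20 jN /=; case: (g =P f) => [E|_]; last exact: a4.
  rewrite /=; case: (j =P i) => [Ej|_]; last by rewrite -E a4.
  case/orP: h => [/(allP F20)|]; rewrite -?E -?Ej; lia.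
by rewrite addnS.
Qed.

Lemma upto_seta L Fs k s s1 i a : upto L Fs k s s1 ->
  rg s 0 <= i -> upto L Fs k.+1 s (seta s1 i a).
Proof.
move=> [a1 a2 a3 [a4 a4'] a5 a6] h; split=> //=.
- by split=> // j jN /=; case: eqP => [Ej|_]; [lia|exact: a4'].
by rewrite addnS.
Qed.

Lemma upto_tick L Fs k s s1 : upto L Fs k s s1 -> upto L Fs k.+1 s (tick s1).
Proof. by move=> [a1 a2 a3 a4 a5 a6]; split=> //=; rewrite addnS. Qed.

Lemma upto_le_tm L Fs k k' s s1 : upto L Fs k s s1 -> k <= k' -> upto L Fs k' s s1.
Proof. by move=> [a1 a2 a3 a4 a5 a6] h; split=> //; lia. Qed.

Lemma upto_seq L Fs k k1 k2 s s1 L2 Fs2 s2 : upto L2 Fs2 k2 s1 s2 ->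
  all (mem L) L2 -> all (mem Fs) Fs2 -> k1 + k2 <= k -> upto L Fs k1 s s1 ->
  upto L Fs k s s2.
Proof.
move=> U2 /allP hL /allP hF kk U1; exact: upto_trans U1 U2 _ hL _ hF kk.
Qed.

Lemma upto_rg' L Fs k s s1 x : upto L Fs k s s1 -> x \notin L -> rg s1 x = rg s x.
Proof. by case=> h _ _ _ _ _; apply: h. Qed.

End Frames.

Ltac uptac :=
  repeat lazymatch goal with
  | |- upto _ _ _ _ (setr _ _ _) => apply: upto_setr; [|by []|try by []]
  | |- upto _ _ _ _ (setf _ _ _ _) => apply: upto_setf; [by []| |try by []]
  | |- upto _ _ _ _ (seta _ _ _) => apply: upto_seta; [|try by []]
  | |- upto _ _ _ _ (tick _) => apply: upto_tick
  end.

(** * Allocation of circuit nodes *)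

Section Routines.

Variables (n m : nat) (R : realType).
Variables (P : seq instr) (B V : nat) (input : seq nat) (w : passign n m -> R).
Hypothesis V4 : 4 <= V.
Hypothesis HB : obase n + V.+1 * width n <= B.
Hypothesis HI : forall i, nth 0 input i < V.

Local Notation WP := (wp P B V input w).
Local Notation hst := (hst n m).

Lemma nrep_upto L Fs k s s1 t i : upto L Fs k s s1 ->
  nrep w (fl s) (ag s) t i -> i < rg s 0 -> nrep w (fl s1) (ag s1) t i.
Proof. by case=> _ _ _ h _ _; apply: nrep_below. Qed.

Lemma wp_c_and (a b : tree n m) s (Q : hst -> Prop) :
  (rg s 0).+1 < V -> 0 < rg s 0 -> rg s 4 = 2 ->
  nrep w (fl s) (ag s) a (rg s 13) -> rg s 13 < rg s 0 ->
  nrep w (fl s) (ag s) b (rg s 14) -> rg s 14 < rg s 0 ->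
  (forall s', upto [:: 0; 12; 17] [::] 10 s s' ->
    rg s' 0 = (rg s 0).+1 -> rg s' 12 = rg s 0 ->
    nrep w (fl s') (ag s') (TAnd a b) (rg s 0) -> Q s') ->
  WP c_and Q s.
Proof.
move=> h0 N0 h4 ra ia rb ib HQ; rewrite /c_and.
do 19 (wstep; simpl); first by rewrite addn1.
match goal with |- Q ?s2 => set s1 := s2 end.
have U : upto [:: 0; 12; 17] [::] 10 s s1.
  by rewrite /s1; uptac; first [exact: upto_refl | simpl; lia].
apply: HQ => //; first by rewrite /= addn1.
have ra' := nrep_upto U ra ia; have rb' := nrep_upto U rb ib.
have [Ea Eb] := (nrep_best ra, nrep_best rb).
move: ra' rb'; rewrite /= ?eqxx Ea Eb h4 => ra' rb'; split=> //.
Qed.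

Lemma wp_c_leaf (x : 'I_n) (d : 'I_m) s (Q : hst -> Prop) :
  (rg s 0).+1 < V -> 0 < rg s 0 -> rg s 5 = x -> rg s 6 = d -> d.+1 < V ->
  (forall s', upto [:: 0; 12; 17] [::] 10 s s' ->
    rg s' 0 = (rg s 0).+1 -> rg s' 12 = rg s 0 ->
    nrep w (fl s') (ag s') (TLeaf x d) (rg s 0) -> Q s') ->
  WP c_leaf Q s.
Proof.
move=> h0 N0 Ex Ed dV HQ; rewrite /c_leaf.
do 11 (wstep; simpl); apply: (wp_leaf _ _ V4 HB (x := x) (d := d)) => //.
do 3 (wstep; simpl); first by rewrite addn1.
match goal with |- Q ?s2 => set s1 := s2 end.
have U : upto [:: 0; 12; 17] [::] 10 s s1.
  by rewrite /s1; uptac; first [exact: upto_refl | simpl; lia].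
apply: HQ => //; first by rewrite /= addn1.
by rewrite /= ?eqxx.
Qed.

Lemma wp_c_better s (Q : hst -> Prop) :
  (forall s', upto [:: 25; 27; 28] [::] 6 s s' -> rg s' 25 \in [:: rg s 25; rg s 26] ->
     fl s' = fl s -> ag s' = ag s ->
     (w (ag s (fl s fR (rg s 25))) <= w (ag s (fl s fR (rg s' 25))))%R ->
     (w (ag s (fl s fR (rg s 26))) <= w (ag s (fl s fR (rg s' 25))))%R -> Q s') ->
  WP c_better Q s.
Proof.
move=> HQ; rewrite /c_better; do 5 (wstep; simpl).
case: ifP => h; wstep; simpl; apply: HQ; rewrite ?inE ?eqxx ?orbT //=.
- by uptac; exact: upto_refl.
- by uptac; exact: upto_refl.
by case/orP: (le_total (w (ag s (fl s 2 (rg s 25)))) (w (ag s (fl s 2 (rg s 26))))); rewrite ?h.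
Qed.

(** Which input continues the chain and which becomes the alternative depends on [w], so the
    resulting tree is specified up to this choice. *)
Definition orpair (a b : tree n m) (t : tree n m) :=
  (t = TOr a b /\ (w (best b) <= w (best a))%R) \/
  (t = TOr b a /\ (w (best a) <= w (best b))%R).

Lemma wp_c_or_jump (a : tree n m) N s (Q : hst -> Prop) :
  rg s 0 = N -> nrep w (fl s) (ag s) a (rg s 15) ->
  fl s fL N = rg s 15 -> rg s 15 < N -> rg s 19 = depth a ->
  (forall s', upto [:: 18; 20; 21; 22; 23; 24; 25; 26; 27; 28] [::] 32 s s' ->
    (forall f i, f \notin [:: fJP; fJM] -> fl s' f i = fl s f i) -> ag s' = ag s ->
    jumpok w (fl s') (ag s') (depth a).+1 N -> Q s') ->
  WP c_or_jump Q s.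
Proof.
move=> EN ra EL pN Ed HQ; rewrite /c_or_jump.
have Ep := nrep_jp ra; have [rj dj] := nrep_jp_sub ra.
set L := [:: 18; 20; 21; 22; 23; 24; 25; 26; 27; 28] in HQ.
have PQ s2 : upto L [::] 30 s s2 ->
    (forall f i, f \notin [:: fJP; fJM] -> fl s2 f i = fl s f i) -> ag s2 = ag s ->
    jumpok w (fl s2) (ag s2) (depth a).+1 N -> Q (tick s2) /\ Q (tick (tick s2)).
  by move=> U h1 h2 h3; split; apply: HQ => //; [apply: upto_le_tm (upto_tick U) _|
     apply: upto_le_tm (upto_tick (upto_tick U)) _].
have fldok s1 : fl s1 = fl s -> forall v1 v2 f i, f \notin [:: fJP; fJM] ->
    fl (setf (setf s1 fJP N v1) fJM N v2) f i = fl s f i.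
  by move=> E v1 v2 f i; rewrite !inE !negb_or => /andP[f5 f6] /=;
     rewrite (negbTE f5) (negbTE f6) E.
have P0 s1 k : upto L [::] k s s1 -> k <= 28 -> fl s1 = fl s -> ag s1 = ag s ->
    J (depth a).+1 = depth a -> let s2 := setf (setf s1 fJP N (rg s 15)) fJM N N in
    Q (tick s2) /\ Q (tick (tick s2)).
  move=> U k28 Ef Ea EJ s2; apply: PQ => //.
  - by apply: (upto_le_tm (k := k.+2)) => //; rewrite /s2; uptac => //=; rewrite EN leqnn.
  - exact: fldok.
  by apply: (@jumpok0 _ _ _ _ _ _ _ (rg s 15)); rewrite ?Ef //= ?eqxx // Ef.
do 3 (wstep; simpl); rewrite Ep; set jp := iter _ _ _.
have le1 : len (depth a) <= depth a by rewrite /len leq_subr.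
have [_ jpp] := nrep_sub ra le1; rewrite -/jp in jpp.
case: eqP => [Ejp|Ejp] /=; last first.
  (* the best child is not an exit *)
  have d0 : 0 < depth a.
    by rewrite lt0n; apply/eqP => d0; apply: Ejp; rewrite /jp d0.
  do 7 (wstep; simpl). do 4 (wstep; simpl).
  have Ejp' : jp = fl s fJP (rg s 15) by rewrite Ep.
  have El1 : rg s 19 - fl s 4 jp = len (depth a).
    by rewrite Ed Ejp' (nrep_dp rj) dj.
  have El2 : fl s 4 jp - fl s 4 (fl s 5 jp) = len (J (depth a)).
    by have [rjj djj] := nrep_jp_sub rj; rewrite Ejp' (nrep_dp rjj) (nrep_dp rj) djj dj.
  rewrite El1 El2; case: eqP => El /=; last first.
    rewrite /c_jump0; do 3 (wstep; simpl); rewrite EN.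
    match goal with |- Q (tick (tick (setf (setf ?x _ _ _) _ _ _))) =>
      have [] := P0 x 10 end => //.
      by uptac; exact: upto_refl.
    by rewrite JlenS; move/eqP/negbTE: El => ->.
  rewrite /c_jump1; do 7 (wstep; simpl).
  apply: wp_c_better => s1 U1 B1 Ef1 Ea1 ub1 ub1' /=.
  rewrite /= in B1 ub1 ub1' Ef1 Ea1; rewrite EN in B1 ub1 ub1' Ef1 Ea1.
  have E18 : rg s1 18 = jp by rewrite (upto_rg' U1).
  do 3 (wstep; simpl).
  apply: wp_c_better => s2 U2 B2 Ef2 Ea2 ub2 ub2' /=.
  have E0' : rg s2 0 = N by rewrite (upto_rg' U2) //= (upto_rg' U1).
  rewrite /= Ef1 Ea1 E18 in B2 ub2 ub2' Ef2 Ea2; rewrite /= in B2 ub2 ub2' Ef2 Ea2.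
  wstep; rewrite E0'; set b := rg s2 25 in B2 ub2 ub2' *.
  have Us : upto L [::] 28 s s2.
    apply: (upto_seq (k1 := 22) U2) => //; uptac.
    apply: (upto_seq (k1 := 15) U1) => //.
    by uptac; first [exact: upto_refl | rewrite /= EN leqnn].
  have [] // := PQ (setf s2 6 N b).
  - by apply: (upto_le_tm (k := 29)) => //; uptac => //=; rewrite EN leqnn.
  - move=> f i; rewrite !inE !negb_or => /andP[f5 f6] /=.
    by rewrite (negbTE f6) Ef2 /= (negbTE f5).
  have neN i : i < N -> (i == N) = false by move=> iN; rewrite ltn_eqF.
  apply: (@jumpok1 _ _ _ _ _ _ _ (rg s 15) _ b) => //=; rewrite ?Ef2 ?Ea2 //= ?eqxx //.
  - apply: (nrep_below (N := N)) ra pN; split=> // f i f20 iN /=.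
    case: (f =P 6) => [->|_] /=; first by rewrite neN.
    by case: (f =P 5) => [->|_] //=; rewrite neN.
  - by rewrite !neN // -Ejp' ?neN; lia.
  - rewrite !neN // -Ejp' ?neN; try lia.
    move: B2 B1; rewrite !inE => /orP[/eqP ->|/eqP ->]; last by rewrite eqxx !orbT.
    by case/orP=> /eqP ->; rewrite eqxx ?orbT.
  rewrite !neN // -Ejp' ?neN; try lia.
  move=> c; rewrite !inE => /or3P[] /eqP ->.
  - exact: le_trans ub1 ub2.
  - exact: le_trans ub1' ub2.
  exact: ub2'.
rewrite /c_jump0; do 3 (wstep; simpl); rewrite EN.
match goal with |- Q (tick (setf (setf ?x _ _ _) _ _ _)) => have [] := P0 x 2 end => //.
  by uptac; exact: upto_refl.
(* A jump to itself has length 0, which happens at depth 0 only. *)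
have d0 : depth a = 0.
  apply/eqP; rewrite -leqn0 leqNgt; apply/negP => d0.
  by move: jpp; rewrite Ejp /len; have := J_lt d0; lia.
by rewrite d0.
Qed.

Lemma ovlxx (a : passign n m) : ovl a a = a.
Proof. by apply/ffunP => x; rewrite ffunE; case: (a x). Qed.

Lemma wp_c_or (a b : tree n m) s (Q : hst -> Prop) :
  (rg s 0).+1 < V -> (forall t, orpair a b t -> depth t < V) ->
  0 < rg s 0 -> rg s 4 = 1 ->
  nrep w (fl s) (ag s) a (rg s 13) -> rg s 13 < rg s 0 ->
  nrep w (fl s) (ag s) b (rg s 14) -> rg s 14 < rg s 0 ->
  (forall s' t, orpair a b t ->
    upto [:: 0; 12; 15; 16; 17; 18; 19; 20; 21; 22; 23; 24; 25; 26; 27; 28] [::] 60 s s' ->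
    rg s' 0 = (rg s 0).+1 -> rg s' 12 = rg s 0 ->
    nrep w (fl s') (ag s') t (rg s 0) -> Q s') ->
  WP c_or Q s.
Proof.
move=> h0 hD N0 h4 ra ia rb ib HQ; rewrite /c_or.
set L := [:: 0; 12; 15; 16; 17; 18; 19; 20; 21; 22; 23; 24; 25; 26; 27; 28] in HQ.
(* [p] and [o] are the better and the other child *)
have main (s1 : hst) (p o : tree n m) : upto L [::] 5 s s1 -> fl s1 = fl s -> ag s1 = ag s ->
    nrep w (fl s) (ag s) p (rg s1 15) -> rg s1 15 < rg s 0 ->
    nrep w (fl s) (ag s) o (rg s1 16) -> rg s1 16 < rg s 0 ->
    rg s1 0 = rg s 0 -> rg s1 4 = 1 -> orpair a b (TOr p o) ->
    WP (St fK 0 4;; St fL 0 15;; St fR 0 16;; Ld 17 fEX 15;; St fEX 0 17;;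
      Ld 19 fDP 15;; AddK 17 19 1;; St fDP 0 17;; Ovl 0 15 15;; c_or_jump;;
      Mov 12 0;; AddK 0 0 1) Q s1.
  move=> U1 Ef Ea rp ip ro io E0 E4 Hor.
  do 14 (wstep; simpl).
    by rewrite Ef (nrep_dp rp) addn1; exact: (hD _ Hor).
  do 5 (wstep; simpl).
  set s2 := seta _ _ _.
  have U2 : upto L [::] 14 s s2.
    by rewrite /s2; uptac; rewrite ?E0; first [exact: U1 | simpl; lia].
  have N2 : (rg s1 15 == rg s 0) = false by rewrite ltn_eqF.
  apply: (@wp_c_or_jump p (rg s 0)) => //.
  - exact: (nrep_upto U2 rp ip).
  - by rewrite /= E0 eqxx.
  - by rewrite /= Ef (nrep_dp rp).
  move=> s3 U3 f3 Ea3 J3; do 3 (wstep; simpl).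
    by rewrite (upto_rg' U3) //= E0 addn1.
  have E03 : rg s3 0 = rg s 0 by rewrite (upto_rg' U3).
  have U4 : upto L [::] 46 s s3 by apply: (upto_seq (k1 := 14) U3).
  have rp3 := nrep_upto U4 rp ip; have ro3 := nrep_upto U4 ro io.
  apply: (HQ _ (TOr p o)) => //=.
  - apply: (upto_le_tm (k := 48)) => //; uptac => //=; lia.
  - by rewrite E03 addn1.
  have e f i : f \notin [:: 5; 6] -> fl s3 f i = fl s2 f i by exact: f3.
  have e1 : fl s3 1 (rg s 0) = rg s1 15 by rewrite e //= E0 eqxx.
  have e2 : fl s3 2 (rg s 0) = rg s1 16 by rewrite e //= E0 eqxx.
  have e3 : fl s3 3 (rg s 0) = fl s3 3 (rg s1 15) by rewrite !e //= E0 eqxx N2.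
  rewrite e1 e2; split=> //.
  - by rewrite Ea3 /= E0 eqxx Ea (nrep_best rp) ovlxx.
  - by rewrite e //= E0 eqxx Ef (nrep_dp rp) addn1.
  by split=> //; rewrite e //= E0 eqxx.
wstep; wstep; simpl.
case: ifP => h.
  do 3 (wstep; simpl); apply: (main _ b a) => //=.
  - by uptac; exact: upto_refl.
  - by right; split=> //; rewrite -(nrep_best ra) -(nrep_best rb).
do 3 (wstep; simpl); apply: (main _ a b) => //=.
- by uptac; exact: upto_refl.
left; split=> //; rewrite -(nrep_best ra) -(nrep_best rb).
by case/orP: (le_total (w (ag s (rg s 13))) (w (ag s (rg s 14)))); rewrite ?h.
Qed.
End Routines.

(** * The tournament tree *)

(** Every positive integer has a unique form [2 ^ j * (2 * q + 1)], so the cells of all levels share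
    one array without a height fixed in advance. *)
Definition tix j q := 2 ^ j * q.*2.+1.

Lemma tix_inj j q j' q' : tix j q = tix j' q' -> j = j' /\ q = q'.
Proof.
rewrite /tix => E.
have lE i p : logn 2 (2 ^ i * p.*2.+1) = i.
  by rewrite lognM ?expn_gt0 // lognX logn_prime // eqxx muln1 (@lognE 2 p.*2.+1) //= 
    dvdn2 /= odd_double addn0.
have Ej : j = j' by rewrite -(lE j q) E lE.
split=> //; move: E; rewrite Ej => /eqP; rewrite eqn_pmul2l ?expn_gt0 // eqSS => /eqP.
by move/double_inj.
Qed.

Section Tournament.
Variables (n m : nat) (R : realType).
Variables (P : seq instr) (B V : nat) (input : seq nat) (w : passign n m -> R).
Hypothesis V4 : 4 <= V.
Hypothesis HB : obase n + V.+1 * width n <= B.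
Hypothesis HI : forall i, nth 0 input i < V.
Local Notation WP := (wp P B V input w).
Local Notation hst := (hst n m).

Definition bestof (G : nat -> passign n m) (A : nat -> bool) (c : nat) : Prop :=
  if c == 0 then forall r, ~~ A r
  else A c /\ forall r, A r -> (w (G r) <= w (G c))%R.

Lemma bestof_ext G G' (A A' : nat -> bool) c : A =1 A' -> (forall r, A r -> G r = G' r) ->
  bestof G A c -> bestof G' A' c.
Proof.
move=> E EG; rewrite /bestof; case: eqP => _ h; first by move=> r; rewrite -E.
case: h => Ac h; rewrite -E; split=> // r; rewrite -E => Ar.
by rewrite -!EG //; apply: h.
Qed.

Definition cell (A : nat -> bool) j q r := A r && (r %/ 2 ^ j == q).

Definition tok h (F : nat -> nat -> nat) G (A : nat -> bool) :=
  [/\ forall r, A r -> 0 < r < 2 ^ h,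
      forall j q, j <= h -> bestof G (cell A j q) (F fT (tix j q))
    & forall j q, h < j -> F fT (tix j q) = 0].

Lemma tok_ext h F G F' G' (A A' : nat -> bool) : A =1 A' -> F fT =1 F' fT ->
  (forall r, A r -> G r = G' r) -> tok h F G A -> tok h F' G' A'.
Proof.
move=> EA EF EG [h1 h2 h3]; split.
- by move=> r; rewrite -EA; apply: h1.
- move=> j q jh; rewrite -EF; apply: bestof_ext (h2 j q jh).
    by move=> r; rewrite /cell EA.
  by move=> r /andP[/EG].
by move=> j q hj; rewrite -EF h3.
Qed.

Definition better G a b :=
  if a == 0 then b else if b == 0 then a else
  if (w (G a) <= w (G b))%R then b else a.

Lemma bestof_better G A j q a b :
  bestof G (cell A j q.*2) a -> bestof G (cell A j q.*2.+1) b ->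
  bestof G (cell A j.+1 q) (better G a b).
Proof.
have E r : cell A j.+1 q r = cell A j q.*2 r || cell A j q.*2.+1 r.
  rewrite /cell -andb_orr expnSr divnMA divn2; congr (_ && _).
  set x := r %/ _; apply/eqP/orP => [<-|[]/eqP ->]; last 2 first.
  - by rewrite doubleK.
  - by rewrite -addn1 halfD doubleK odd_double /= addn0.
  by case Eo: (odd x); [right|left]; rewrite -{1}(odd_double_half x) Eo.
rewrite /bestof /better; case: (a =P 0) => [_|/eqP/negbTE a0].
  move=> ha; case: eqP => [_ hb r|_ [hb hb']]; first by rewrite E (negbTE (ha r)) (negbTE (hb r)).
  rewrite E hb orbT; split=> // r; rewrite E (negbTE (ha r)) /=; exact: hb'.
move=> [ha ha']; case: (b =P 0) => [_ hb|/eqP/negbTE b0 [hb hb']].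
  rewrite a0 E ha; split=> // r; rewrite E (negbTE (hb r)) orbF; exact: ha'.
case: (boolP (w (G a) <= w (G b))%R) => h.
  rewrite b0 E hb orbT; split=> // r; rewrite E => /orP[/ha'|/hb'] // h2.
  exact: le_trans h2 h.
rewrite a0 E ha; split=> // r; rewrite E => /orP[/ha'|/hb'] // h2.
apply: le_trans h2 _; case/orP: (le_total (w (G a)) (w (G b))) => //.
by rewrite (negbTE h).
Qed.

(** [v] is [i] for an insertion and 0 for a removal. *)
Definition live (A : nat -> bool) i v r := if r == i then v != 0 else A r.

(* The tree is correct for the new live set up to level [j], and above except on
   the path of [i]. *)
Definition tpart h (F : nat -> nat -> nat) G (A : nat -> bool) i j :=
  [/\ forall r, A r -> 0 < r < 2 ^ h,
      forall j' q, j' <= h -> j' <= j \/ q != i %/ 2 ^ j' ->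
        bestof G (cell A j' q) (F fT (tix j' q))
    & forall j' q, h < j' -> F fT (tix j' q) = 0].

Lemma wp_choose s (Q : hst -> Prop) :
  (forall s', upto [:: 40] [::] 7 s s' -> fl s' = fl s -> ag s' = ag s ->
     rg s' 40 = better (ag s) (rg s 38) (rg s 39) -> Q s') ->
  WP c_choose Q s.
Proof.
move=> HQ; rewrite /c_choose; wstep; simpl; rewrite /better in HQ.
case: ifP => [a0|a0]; last first.
  wstep; apply: HQ => //=; first by uptac; exact: upto_refl.
  by move/negbFE: a0 => ->.
rewrite (negbTE a0) in HQ; wstep; simpl; case: ifP => [b0|b0]; last first.
  wstep; apply: HQ => //=; first by uptac; exact: upto_refl.
  by move/negbFE: b0 => ->.
rewrite (negbTE b0) in HQ; wstep; simpl; case: ifP => h; rewrite h in HQ; wstep;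
  apply: HQ => //=; uptac; exact: upto_refl.
Qed.

(** The children of the cell with index [p] on level [j + 1] have indices [p - 2 ^ j] and
    [p + 2 ^ j]. Each turn repairs one more cell on the path of [i]. *)
Lemma wp_update_loop h A i k j s (Q : hst -> Prop) :
  h - j = k -> j <= h -> rg s 30 = 2 ^ h -> rg s 33 = 2 ^ j ->
  rg s 34 = i %/ 2 ^ j -> i < 2 ^ h -> 4 * 2 ^ h <= V ->
  tpart h (fl s) (ag s) A i j ->
  (forall s', upto [:: 33; 34; 35; 36; 37; 38; 39; 40] [:: fT] (22 * k + 1) s s' ->
     ag s' = ag s -> (forall f, f != fT -> fl s' f = fl s f) ->
     tok h (fl s') (ag s') A -> Q s') ->
  WP c_climb Q s.
Proof.
rewrite /c_climb; elim: k j s Q => [|k IH] j s Q Ek jh E30 E33 E34 ih hV tp HQ;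
  apply: (wp_while V4 HB); rewrite /= E30 E33 ltn_exp2l //.
  have jE : j = h by lia.
  rewrite jE ltnn; apply: HQ => //=.
    by apply: upto_tick; apply: upto_refl.
  case: tp => t1 t2 t3; split=> // j' q j'h; apply: t2 => //; left; lia.
have jh' : j < h by lia.
rewrite jh'.
have p0 : 0 < 2 ^ j by rewrite expn_gt0.
have pS : 2 ^ j.+1 = 2 ^ j + 2 ^ j by rewrite expnS; lia.
have ph : 2 ^ j.+1 <= 2 ^ h by apply: leq_pexp2l.
set q := i %/ 2 ^ j.+1.
have qE : (i %/ 2 ^ j)./2 = q by rewrite /q expnSr divnMA divn2.
have qi : q * 2 ^ j.+1 <= i by apply: leq_divM.

have q2 : q <= q * 2 ^ j.+1 by rewrite leq_pmulr // expn_gt0.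
have pE : tix j.+1 q = q * 2 ^ j.+1 + q * 2 ^ j.+1 + 2 ^ j.+1.
  by rewrite /tix -addnn mulnC mulSn mulnDl; lia.
have pl : tix j.+1 q < V by rewrite pE; lia.
have hiE : tix j q.*2.+1 = tix j.+1 q + 2 ^ j by rewrite /tix expnS -!addnn; nia.
have loE : tix j q.*2 = tix j.+1 q - 2 ^ j by rewrite /tix expnS -!addnn; nia.
do 2 (wstep; simpl); rewrite ?E33; first by lia.
do 4 (wstep; simpl); rewrite ?E34 ?qE; first by lia.
do 2 (wstep; simpl); first by lia.
have Etix : (2 ^ j + 2 ^ j) * (q + q + 1) = tix j.+1 q by rewrite /tix -pS addn1 addnn.
do 2 (wstep; simpl); rewrite Etix //.
do 4 (wstep; simpl); rewrite E33; first by rewrite pE; lia.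
rewrite -hiE -loE.
do 5 (wstep; simpl); apply: wp_choose => s1 U1 Ef1 Ea1 /= E40.
do 3 (wstep; simpl).
set F := fl s in tp E40; rewrite /= -/F in E40 Ef1 Ea1.
apply: (IH j.+1) => //=.
- by lia.
- by rewrite (upto_rg' U1).
- by rewrite (upto_rg' U1).
- by rewrite (upto_rg' U1).
- rewrite (upto_rg' U1) //= Ef1 Ea1; case: tp => t1 t2 t3; split=> //=.
    move=> j' q' j'h; case: (tix j' q' =P tix j.+1 q) => [E|ne].
      have [-> ->] := tix_inj E.
      rewrite E40; move=> _; apply: bestof_better; apply: t2; try (by left); lia.
    case=> [j'j|q'i]; last by apply: t2 => //; right.
    apply: t2 => //; move: j'j; rewrite leq_eqVlt ltnS => /orP[/eqP E|]; last by left.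
    by right; apply/eqP => E'; case: ne; rewrite E' E.
  move=> j' q' hj'; case: (tix j' q' =P tix j.+1 q) => [/tix_inj[E _]|_]; [lia|exact: t3].
move=> s2 U2 Ea2 f2 tk; apply: HQ => //.
- apply: (upto_seq (k1 := 22) U2) => //; first by lia.
  uptac; apply: (upto_seq (k1 := 12) U1) => //; uptac; exact: upto_refl.
- by rewrite Ea2 /= Ea1.
by move=> f f24; rewrite f2 //= (negbTE f24) Ef1.
Qed.

Lemma wp_update h A i v s (Q : hst -> Prop) :
  rg s 30 = 2 ^ h -> rg s 31 = i -> rg s 32 = v -> 0 < i < 2 ^ h -> 4 * 2 ^ h <= V ->
  (v == 0) || (v == i) -> tok h (fl s) (ag s) A ->
  (forall s', upto [:: 33; 34; 35; 36; 37; 38; 39; 40] [:: fT] (22 * h + 6) s s' ->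
     ag s' = ag s -> (forall f, f != fT -> fl s' f = fl s f) ->
     tok h (fl s') (ag s') (live A i v) -> Q s') ->
  WP c_update Q s.
Proof.
move=> E30 E31 E32 /andP[i0 ih] hV vi [t1 t2 t3] HQ; rewrite /c_update.
do 6 (wstep; simpl); rewrite ?E31; first by lia.
do 2 (wstep; simpl); first by lia.
do 2 (wstep; simpl); rewrite E32.
have Et : i + i + 1 = tix 0 i by rewrite /tix expn0 mul1n addn1 addnn.
rewrite Et; apply: (@wp_update_loop h (live A i v) i h 0) => //=.
- by rewrite subn0.
- by rewrite expn0 divn1.
- split=> /=.
  + move=> r; rewrite /live; case: eqP => [-> _|_ /t1 //]; first by rewrite i0.
  + move=> j' q j'h hj; case: (tix j' q =P tix 0 i) => [E|ne].
      have [Ej Eq] := tix_inj E; rewrite Ej Eq /bestof /cell /live.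
      case: (v =P 0) vi => [v0 _|v0 /= /eqP vi].
        by move=> r; rewrite expn0 divn1; case: (r =P i) => //=; rewrite andbF.
      rewrite vi !eqxx expn0 divn1 eqxx; split=> // r.
      by rewrite divn1 => /andP[_ /eqP ->].
    have {hj} qi : q != i %/ 2 ^ j'.
      case: hj => //; rewrite leqn0 => /eqP j0; rewrite j0 expn0 divn1.
      by apply/eqP => qi; apply: ne; rewrite j0 qi.
    apply: bestof_ext (t2 j' q j'h) => // r; rewrite /cell /live.
    by case: (r =P i) => [->|//]; rewrite eq_sym (negbTE qi) !andbF.
  move=> j' q hj; case: (tix j' q =P tix 0 i) => [/tix_inj[E _]|_]; last exact: t3.
  by rewrite E in hj.
move=> s' U Ea f2 tk; apply: HQ => //.
- apply: (upto_seq (k1 := 5) U) => //; first by lia.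
  by uptac; exact: upto_refl.
by move=> f f24; rewrite f2 //= (negbTE f24).
Qed.

Definition c_grow := While (CLe 30 31) (Ld 36 fT 30;; Add 30 30 30;; St fT 30 36).

(** [K] only drives the induction. The cost is proportional to the levels added, and the height
    stays logarithmic in the largest index inserted. *)
Lemma wp_grow K h A i s (Q : hst -> Prop) :
  rg s 30 = 2 ^ h -> rg s 31 = i -> i < 2 ^ (h + K) -> 2 * i < V ->
  tok h (fl s) (ag s) A ->
  (forall s' h', upto [:: 30; 36] [:: fT] (7 * (h' - h) + 1) s s' ->
     ag s' = ag s -> (forall f, f != fT -> fl s' f = fl s f) ->
     rg s' 30 = 2 ^ h' -> i < 2 ^ h' -> h <= h' -> (h' = h \/ 2 ^ h' <= 2 * i) ->
     tok h' (fl s') (ag s') A -> Q s') ->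
  WP c_grow Q s.
Proof.
rewrite /c_grow.
elim: K h s Q => [|K IH] h s Q E30 E31 iK iV tk HQ; apply: (wp_while V4 HB); rewrite /= E30 E31.
  rewrite addn0 in iK; rewrite leqNgt iK /=.
  apply: (HQ _ h) => //=; last by left.
  by rewrite subnn muln0; apply: upto_tick; apply: upto_refl.
case: ltnP => hi.
  apply: (HQ _ h) => //=; last by left.
  by rewrite subnn muln0; apply: upto_tick; apply: upto_refl.
do 4 (wstep; simpl); rewrite ?E30; first by lia.
wstep; simpl.
have pS : 2 ^ h + 2 ^ h = 2 ^ h.+1 by rewrite expnS; lia.
have Et : 2 ^ h.+1 = tix h.+1 0 by rewrite /tix muln1.
have Et' : 2 ^ h = tix h 0 by rewrite /tix muln1.
case: (tk) => t1 t2 t3.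
apply: (IH h.+1) => //=; first by rewrite addSnnS.
  split=> /=.
  - by move=> r /t1 /andP[-> rh]; rewrite -pS; lia.
  - move=> j q jh; rewrite pS Et; case: (tix j q =P tix h.+1 0) => [/tix_inj[-> ->]|ne].
      rewrite Et'; apply: bestof_ext (t2 h 0 (leqnn _)) => // r.
      rewrite /cell; case Ar: (A r) => //=.
      by have /andP[_ rh] := t1 r Ar; rewrite !divn_small // -?pS; lia.
    move: jh; rewrite leq_eqVlt ltnS => /orP[/eqP Ej|]; last exact: t2.
    rewrite t3 ?Ej // /bestof eqxx => r; rewrite /cell; apply/negP => /andP[Ar].
    have /andP[_ rh] := t1 r Ar; rewrite divn_small -?pS; last by lia.
    by move/eqP => q0; apply: ne; rewrite Ej -q0.
  move=> j q hj; rewrite pS Et; case: (tix j q =P tix h.+1 0) => [/tix_inj[E _]|_].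
    by rewrite E ltnn in hj.
  by apply: t3; exact: ltnW.
move=> s' h' U Ea f2 E ih' hh hc tk'; apply: (HQ _ h') => //.
- apply: (upto_seq (k1 := 5) U) => //; first by lia.
  by uptac; exact: upto_refl.
- by move=> f f24; rewrite f2 //= (negbTE f24).
- exact: ltnW.
right; case: hc => [->|//]; rewrite -pS; lia.
Qed.

Lemma wp_insert h A i s (Q : hst -> Prop) :
  rg s 30 = 2 ^ h -> rg s 31 = i -> 0 < i -> 4 * 2 ^ h <= V -> 8 * i <= V ->
  tok h (fl s) (ag s) A ->
  (forall s' h', upto [:: 30; 32; 33; 34; 35; 36; 37; 38; 39; 40] [:: fT] (29 * h' + 9) s s' ->
     ag s' = ag s -> (forall f, f != fT -> fl s' f = fl s f) ->
     rg s' 30 = 2 ^ h' -> (h' = h \/ 2 ^ h' <= 2 * i) ->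
     tok h' (fl s') (ag s') (fun r => (r == i) || A r) -> Q s') ->
  WP c_insert Q s.
Proof.
move=> E30 E31 i0 hV iV tk HQ; rewrite /c_insert -/c_grow; wstep.
have iK : i < 2 ^ (h + i).
  by apply: leq_trans (ltn_expl i (isT : 1 < 2)) _; apply: leq_pexp2l => //; lia.
apply: (wp_grow E30 E31 iK _ tk); first by lia.
move=> s1 h' U1 Ea1 f1 E1 ih' hh hc tk1; do 2 (wstep; simpl).
have E31' : rg s1 31 = i by rewrite (upto_rg' U1).
rewrite E31'; apply: (@wp_update h' A i i) => //.
- by rewrite i0.
- by case: hc => [->|]; lia.
- by rewrite eqxx orbT.
move=> s2 U2 Ea2 f2 tk2; apply: (HQ _ h') => //.
- apply: (upto_seq (k1 := 7 * h' + 3) U2) => //; first by lia.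
  rewrite addn3; uptac; apply: (upto_seq (k1 := 0) U1) => //; first by lia.
  exact: upto_refl.
- by rewrite Ea2 /= Ea1.
- by move=> f f24; rewrite f2 //= f1.
- by rewrite (upto_rg' U2).
apply: tok_ext tk2 => // r; rewrite /live; case: eqP => //= _.
by rewrite -lt0n i0.
Qed.

End Tournament.

(** * Subproblems *)

Section Query.
Variables (n m : nat) (R : realType).
Variables (P : seq instr) (B V : nat) (input : seq nat) (w : passign n m -> R).
Hypothesis V4 : 4 <= V.
Hypothesis HB : obase n + V.+1 * width n <= B.
Hypothesis HI : forall i, nth 0 input i < V.
Local Notation WP := (wp P B V input w).
Local Notation hst := (hst n m).
Variables (F : nat -> nat -> nat) (G : nat -> passign n m).
Variables (t : tree n m) (v k : nat).
Hypothesis rt : nrep w F G t v.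
Hypothesis kd : k <= depth t.
Local Notation at_ c := (iter c (F fL) v).

Lemma at_lt c c' : c < c' -> c' <= depth t -> at_ c' < at_ c.
Proof using rt.
clear V4 HB HI kd.
move=> cc' c'd; have [r _] := nrep_sub rt (leq_trans (ltnW cc') c'd).
have h : c' - c <= depth (sub t c) by rewrite depth_sub; lia.
have [_] := nrep_sub r h; rewrite -iterD subnK; lia.
Qed.

Lemma at_eq c c' : c <= depth t -> c' <= depth t -> (at_ c == at_ c') = (c == c').
Proof using rt.
clear V4 HB HI kd.
move=> h h'; case: (ltngtP c c') => [cc|cc|->]; last by rewrite eqxx.
  by rewrite gtn_eqF // at_lt.
by rewrite ltn_eqF // at_lt.
Qed.

Definition dom y c := forall j, j < c -> (w (G (F fR (at_ j))) <= w (G (F fR y)))%R.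

(** The induction follows [hop], which measures positions by their depth above the exit: the node
    [c] places down the chain has depth [depth t - c]. *)
Lemma wp_scan d h c s j (Q : hst -> Prop) : hop (depth t - k) d h ->
  d = depth t - c -> c <= k -> fl s = F -> ag s = G ->
  rg s 45 = at_ c -> rg s 46 = at_ j -> rg s 42 = at_ k -> rg s 47 = depth t - k ->
  j < k -> dom (at_ j) c ->
  (forall s' j', upto [:: 45; 46; 48; 49; 50; 51; 52] [::] (16 * h + 1) s s' ->
     fl s' = F -> ag s' = G -> rg s' 46 = at_ j' -> j' < k -> dom (at_ j') k -> Q s') ->
  WP c_scan Q s.
Proof.
move=> H; elim: H c s j Q => {d h} [d db|d h bd bJ H IH|d h bd Jb H IH] c s j Q Ed ck Ef Ea
  E45 E46 E42 E47 jk dm HQ; rewrite /c_scan; apply: (wp_while V4 HB); rewrite /= E45 E42 at_eq;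
  try lia.
- have -> : c = k by lia.
  rewrite eqxx /=; apply: (HQ _ j) => //=; first by apply: upto_tick; exact: upto_refl.
  by have <- : c = k by lia.
- have -> /= : (c == k) = false by lia.
  have cd : c <= depth t by lia.
  have [rc _] := nrep_sub rt cd; have dc := depth_sub cd; rewrite -Ed in dc.
  have [rj dj] := nrep_jp_sub rc; rewrite dc in rj dj.
  have d0 : 0 < depth (sub t c) by lia.
  have [_ [j1 j1l [j1E j1M]]] := nrep_jump rc d0; rewrite dc in j1l j1M.
  have Ejp : F 5 (at_ c) = at_ (c + len d) by rewrite (nrep_jp rc) dc addnC iterD.
  have lk : c + len d <= k by rewrite /len; lia.
  do 6 (wstep; simpl); rewrite Ef E45 E47 (nrep_dp rj) dj bJ /=.
  do 3 (wstep; simpl); rewrite E45 Ef Ejp.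
  do 5 (wstep; simpl); rewrite E46 Ef Ea.
  have domJ j' : j' < c + len d -> (c <= j') ->
      (w (G (F fR (at_ j'))) <= w (G (F fR (F fJM (at_ c)))))%R.
    move=> h1 h2; have := j1M (j' - c); rewrite -iterD subnK //; apply; lia.
  have EJM : F fJM (at_ c) = at_ (c + j1) by rewrite j1E addnC iterD.
  rewrite EJM in domJ *.
  have fin s1 j' : fl s1 = F -> ag s1 = G -> rg s1 45 = at_ (c + len d) ->
      rg s1 46 = at_ j' -> upto [:: 45; 46; 48; 49; 50; 51; 52] [::] 16 s s1 -> j' < k ->
      dom (at_ j') (c + len d) -> WP c_scan Q s1.
    move=> Ef1 Ea1 E1 E1' U j'k dm'; apply: (IH (c + len d) s1 j') => //.
    - by rewrite /len; have := J_le d; lia.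
    - by rewrite (upto_rg' U).
    - by rewrite (upto_rg' U).
    move=> s2 j2 U2 *; apply: (HQ s2 j2) => //.
    by apply: (upto_seq (k1 := 16) U2) => //; lia.
  case: ifP => hw; wstep; simpl.
    apply: (fin _ (c + j1)) => //=; [by uptac; exact: upto_refl|lia|].
    move=> j' j'l; have [j'c|cj'] := ltnP j' c; last exact: domJ.
    exact: le_trans (dm _ j'c) hw.
  apply: (fin _ j) => //=; first by uptac; exact: upto_refl.
  move=> j' j'l; have [j'c|cj'] := ltnP j' c; first exact: dm.
  apply: le_trans (domJ _ j'l cj') _.
  by case/orP: (le_total (w (G (F 2 (at_ j)))) (w (G (F 2 (at_ (c + j1)))))) => //; rewrite hw.
have -> /= : (c == k) = false by lia.
have cd : c <= depth t by lia.
have [rc _] := nrep_sub rt cd; have dc := depth_sub cd; rewrite -Ed in dc.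
have [rj dj] := nrep_jp_sub rc; rewrite dc in rj dj.
do 6 (wstep; simpl); rewrite Ef E45 E47 (nrep_dp rj) dj leqNgt Jb /=.
do 3 (wstep; simpl); rewrite E45 Ef.
do 5 (wstep; simpl); rewrite E46 Ef Ea.
have fin s1 j' : fl s1 = F -> ag s1 = G -> rg s1 45 = at_ c.+1 ->
    rg s1 46 = at_ j' -> upto [:: 45; 46; 48; 49; 50; 51; 52] [::] 16 s s1 -> j' < k ->
    dom (at_ j') c.+1 -> WP c_scan Q s1.
  move=> Ef1 Ea1 E1 E1' U j'k dm'; apply: (IH c.+1 s1 j') => //.
  - lia.
  - lia.
  - by rewrite (upto_rg' U).
  - by rewrite (upto_rg' U).
  move=> s2 j2 U2 *; apply: (HQ s2 j2) => //.
  by apply: (upto_seq (k1 := 16) U2) => //; lia.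
case: ifP => hw; wstep; simpl.
  apply: (fin _ c) => //=; [by uptac; exact: upto_refl|lia|].
  move=> j'; rewrite ltnS leq_eqVlt => /orP[/eqP -> //|j'c].
  exact: le_trans (dm _ j'c) hw.
apply: (fin _ j) => //=; first by uptac; exact: upto_refl.
move=> j'; rewrite ltnS leq_eqVlt => /orP[/eqP ->|]; last exact: dm.
by case/orP: (le_total (w (G (F 2 (at_ j)))) (w (G (F 2 (at_ c))))) => //; rewrite hw.
Qed.

Lemma wp_query K s (Q : hst -> Prop) : 0 < k -> v < 2 ^ K ->
  fl s = F -> ag s = G -> rg s 41 = v -> rg s 42 = at_ k ->
  (forall s' j', upto [:: 45; 46; 47; 48; 49; 50; 51; 52] [::] (64 * K + 40) s s' ->
     fl s' = F -> ag s' = G -> rg s' 46 = at_ j' -> j' < k -> dom (at_ j') k -> Q s') ->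
  WP c_query Q s.
Proof.
move=> k0 vK Ef Ea E41 E42 HQ; rewrite /c_query; do 6 (wstep; simpl).
have dK : depth t < 2 ^ K by apply: leq_ltn_trans vK; have [_] := nrep_sub rt (leqnn _); lia.
have [h H hK] := hop_bound (depth t - k) dK.
have [rk _] := nrep_sub rt kd.
apply: (@wp_scan _ h 0 _ 0 _ H) => //=.
- by rewrite subn0.
- by rewrite Ef E42 (nrep_dp rk) depth_sub.
move=> s' j' U *; apply: (HQ s' j') => //; apply: (upto_seq (k1 := 3) U) => //; first by lia.
by uptac; exact: upto_refl.
Qed.

End Query.

(** * The queue of subproblems and its counting invariant *)

Section Queue.
Variables (n m : nat) (R : realType).
Variables (P : seq instr) (B V : nat) (input : seq nat) (w : passign n m -> R).
Hypothesis V4 : 4 <= V.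
Hypothesis HB : obase n + V.+1 * width n <= B.
Hypothesis HI : forall i, nth 0 input i < V.
Hypothesis mono : subset_monotone w.
Local Notation WP := (wp P B V input w).
Local Notation hst := (hst n m).
Implicit Types (F : nat -> nat -> nat) (G : nat -> passign n m) (t : tree n m).

(* The subproblem [r] stands for a choice of one of the trees [os], with variables
   [Y], followed by the trees [ps]; its assignment is its maximum. *)
Definition recok N F G r Y os ps : Prop :=
  exists t k j, let v := F fRV r in
  [/\ nrep w F G t v /\ v < N, wft w t /\ vars t = Y, 0 < k <= depth t /\ j < k,
    [/\ F fRX r = iter k (F fL) v, F fRY r = iter j (F fL) v & dom w F G v (F fRY r) k]
  & [/\ os = take k (offs t), lrep w F G N ps (F fRP r) & okl w (nth t os j :: ps) (G r)]].

Lemma recok_below N N' F G F' G' r Y os ps : below N F G F' G' -> N <= N' -> r < N ->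
  recok N F G r Y os ps -> recok N' F' G' r Y os ps.
Proof.
move=> H NN rN [t [k [j [[rv vN] wt [/andP[k0 kd] jk] [Ex Ey dm] [Eo lp ok]]]]].
have [H1 H2] := H.
exists t, k, j; rewrite /= !(H1 _ r) // H2 //.
have it c : c <= depth t -> iter c (F' fL) (F fRV r) = iter c (F fL) (F fRV r).
  exact: (iter_below H rv vN).
have jd : j < depth t by apply: leq_trans jk kd.
split=> //.
- by split; [exact: nrep_below rv vN|apply: leq_trans NN].
- by rewrite k0 kd.
- rewrite !it ?(ltnW jd) //; split=> // c ck.
  have cd : c < depth t by apply: leq_trans ck kd.
  rewrite it; last exact: ltnW.
  have [_ b1] := nrep_sub rv (ltnW cd); have [_ b1'] := nrep_sub rv (ltnW jd).
  have [_ b2] := nrep_offs t rv cd; have [_ b2'] := nrep_offs t rv jd.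
  move: (dm c ck); rewrite Ey => dmc.
  by rewrite !(H1 fR) // ?H2 //; lia.
by split=> //; apply: lrep_below lp.
Qed.

Lemma recok_opt N F G r Y os ps tau : recok N F G r Y os ps ->
  0 < Dc Y os ps (G r) tau -> (w tau <= w (G r))%R.
Proof.
move=> [t [k [j [[rv vN] [wt Ev] [/andP[k0 kd] jk] [Ex Ey dm] [Eo lp ok]]]]].
have ho : everyT (okoff w Y) os.
  have := offs_ok wt; rewrite -(cat_take_drop k (offs t)) Ev -Eo => /everyT_cat[//].
have so : size os = k by rewrite Eo size_takel.
have nthE c : c < k -> nth t os c = nth t (offs t) c by move=> ck; rewrite Eo nth_take.
apply: (Dc_opt mono ho _ _ ok).
  by have /(everyT_nth _ _ t) := ho; apply; rewrite so.
apply/(everyT_nth _ _ t) => c; rewrite so => ck.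
have [r1 _] := nrep_offs t rv (leq_trans ck kd).
have [r2 _] := nrep_offs t rv (leq_trans jk kd).
by rewrite !nthE // -(nrep_best r1) -(nrep_best r2) -Ey; apply: dm.
Qed.

(** [D] keeps only what each subproblem contributes to the count, hiding the choice of [Y], [os] and
    [ps] made for it. *)
Definition queue (s : hst) h (H : seq nat) (D : nat -> passign n m -> nat) : Prop :=
  [/\ rg s 30 = 2 ^ h, 2 ^ h <= 2 * rg s 0, tok w h (fl s) (ag s) (mem H), uniq H
  & forall r, r \in H -> r < rg s 0 /\ exists Y os ps,
      recok (rg s 0) (fl s) (ag s) r Y os ps /\ forall tau, D r tau = Dc Y os ps (ag s r) tau].

(** Seen from outside, the queue is the multiplicity [S tau] with which each assignment is still
    covered. *)
Definition PQ (s : hst) (S : passign n m -> nat) : Prop :=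
  exists h H D, queue s h H D /\ forall tau, S tau = \sum_(r <- H) D r tau.

Lemma PQ_upto L Fs k s s' S : upto L Fs k s s' -> 30 \notin L -> fT \notin Fs ->
  PQ s S -> PQ s' S.
Proof.
move=> [u1 u2 u3 u4 _ _] L30 FsT [h [H [D [[q1 q2 q3 q4 q5] ES]]]].
exists h, H, D; split=> //; split=> //.
- by rewrite u1.
- by apply: leq_trans q2 _; rewrite leq_mul2l u3 orbT.
- apply: tok_ext q3 => //; first by move=> x; rewrite u2.
  by move=> r rH; have [rN _] := q5 r rH; case: u4 => _ ->.
move=> r rH; have [rN [Y [os [ps [ok E]]]]] := q5 r rH; split; first by lia.
exists Y, os, ps; split; first exact: recok_below u4 u3 rN ok.
by move=> tau; rewrite E; case: u4 => _ ->.
Qed.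

Lemma PQ_ext s S S' : (forall tau, S tau = S' tau) -> PQ s S -> PQ s S'.
Proof.
by move=> E [h [H [D [q ES]]]]; exists h, H, D; split=> // tau; rewrite -E ES.
Qed.

(** [CM] caps the number of objects and [K] bits hold it; all costs below are affine in [K]. *)
Variables (CM K : nat).
Hypothesis CMV : 8 * CM.+1 <= V.
Hypothesis CMK : CM < 2 ^ K.

Definition pushregs := [:: 0; 30; 31; 32; 33; 34; 35; 36; 37; 38; 39; 40;
  45; 46; 47; 48; 49; 50; 51; 52].
(** Per bit, 64 for the scan and 29 for the insertion. *)
Definition pushcost := 93 * K + 100.

Lemma log_le h N : 2 ^ h <= 2 * N -> N <= CM -> h <= K.+1.
Proof.
move=> hN NC; rewrite leqNgt; apply/negP => Kh.
have := leq_pexp2l (isT : 0 < 2) Kh; rewrite !expnS; lia.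
Qed.

Lemma wp_push t k ps S s (Q : hst -> Prop) :
  rg s 0 < CM -> 0 < rg s 0 ->
  nrep w (fl s) (ag s) t (rg s 41) -> rg s 41 < rg s 0 -> wft w t ->
  0 < k <= depth t -> rg s 42 = iter k (fl s fL) (rg s 41) ->
  lrep w (fl s) (ag s) (rg s 0) ps (rg s 43) ->
  okl w ps (ag s (rg s 44)) -> [disjoint vars t & pvars ps] -> PQ s S ->
  (forall s', upto pushregs [:: fT] pushcost s s' -> rg s' 0 = (rg s 0).+1 ->
     PQ s' (fun tau => S tau + Dc (vars t) (take k (offs t)) ps (ag s (rg s 44)) tau) -> Q s') ->
  WP c_push Q s.
Proof.
move=> NC N0 rt vN wt /andP[k0 kd] E42 lp okp dis [h [H [D [[q1 q2 q3 q4 q5] ES]]]] HQ.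
rewrite /c_push; wstep.
have vK : rg s 41 < 2 ^ K by lia.
apply: (wp_query _ V4 HB rt kd k0 vK) => // s1 j U1 Ef1 Ea1 E46 jk dm.
have [E0 [E41 E42' E43 E44]] : rg s1 0 = rg s 0 /\ [/\ rg s1 41 = rg s 41, rg s1 42 = rg s 42,
  rg s1 43 = rg s 43 & rg s1 44 = rg s 44] by rewrite !(upto_rg' U1).
do 16 (wstep; simpl); first by lia.
rewrite E0 E41 E42' E43 E44 E46 Ef1 Ea1.
set N := rg s 0 in E0 N0 NC q2 q5 vN lp *; set v := rg s 41 in E41 rt vN vK *.
have jd : j < depth t := leq_trans jk kd.
have [rj bj] := nrep_sub rt (ltnW jd); have [ro bo] := nrep_offs t rt jd.
set y := iter j _ _ in E46 dm rj bj ro bo *; set o := nth t (offs t) j in ro.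
have yN : (y == N) = false by lia.
set al := ovl _ _; set s2 := setr _ 0 _.
have alE : al = ovl (ag s (rg s 44)) (best o) by rewrite /al (nrep_best ro).
have U2 : upto pushregs [::] (64 * K + 50) s s2.
  rewrite (_ : 64 * K + 50 = (64 * K + 42).+4.+4); last by lia.
  rewrite /s2; uptac; try (simpl; lia).
  by apply: (upto_seq (k1 := 0) U1) => //; [lia|exact: upto_refl].
have rt2 := nrep_upto U2 rt vN.
apply: (wp_insert _ V4 HB (h := h) (A := mem H) (i := N)) => //.
- by rewrite /= (upto_rg' U1).
- have := log_le q2 (ltnW NC); lia.
- by lia.
- apply: tok_ext q3 => //= [x|r rH]; first by rewrite Ef1.
  by have [rN _] := q5 r rH; rewrite Ea1 ltn_eqF.
move=> s3 h' U3 Ea3 f3 E30 hc tk.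
have E03 : rg s3 0 = N.+1 by rewrite (upto_rg' U3) //= addn1.
have hN : 2 ^ h' <= 2 * N.+1 by case: hc => [->|]; lia.
have hK := log_le hN NC.
have U4 : upto pushregs [:: fT] pushcost s s3.
  apply: (upto_seq (k1 := 64 * K + 50) U3) => //; first by rewrite /pushcost; lia.
  by apply: (upto_seq (k1 := 0) U2) => //; exact: upto_refl.
apply: HQ => //; exists h', (N :: H), (fun r => if r == N then
   Dc (vars t) (take k (offs t)) ps (ag s (rg s 44)) else D r).
have NH : N \notin H by apply/negP => /q5[]; rewrite ltnn.
split; last first.
  move=> tau; rewrite big_cons eqxx ES addnC; congr (_ + _).
  by apply: eq_big_seq => r rH; case: eqP => // E; rewrite E (negbTE NH) in rH.
split=> //; rewrite ?E03 //=; last first.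
- move=> r; rewrite inE; case: eqP => [-> _|_ /=]; last first.
    move=> /q5[rN [Y [os [ps' [ok E]]]]]; split; first exact: ltnW.
    have [_ _ u3 u4 _ _] := U4.
    exists Y, os, ps'; split; first exact: recok_below u4 (leqnSn N) rN ok.
    by move=> tau; rewrite E; case: u4 => _ ->.
  split=> //; exists (vars t), (take k (offs t)), ps.
  have e f : f != fT -> fl s3 f = fl s2 f by exact: f3.
  have EG : ag s3 N = al by rewrite Ea3 /= eqxx.
  have [wo Eo] : okoff w (vars t) o.
    by have /(everyT_nth _ _ t) := offs_ok wt; apply.
  (* The overlay changes variables of [t] only, and there [Dc] makes no comparison with the fixed
     values. *)
  have agr x : x \notin vars t :|: pvars ps -> ag s (rg s 44) x = al x.
    by rewrite inE negb_or => /andP[xt _]; rewrite alE (ovl_out _ wo) ?Eo.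
  split; last by move=> tau; rewrite EG; apply: Dc_ext.
  have [_ _ _ u4 _ _] := U4.
  have it c : c <= depth t -> iter c (fl s3 fL) v = iter c (fl s fL) v.
    exact: (iter_below u4 rt vN).
  have e7 : fl s3 fRV N = v by rewrite e //= eqxx.
  have e8 : fl s3 fRX N = iter k (fl s fL) v by rewrite e //= eqxx.
  have e9 : fl s3 fRY N = y by rewrite e //= eqxx.
  have e10 : fl s3 fRP N = rg s 43 by rewrite e //= eqxx.
  exists t, k, j; rewrite /= e7 e8 e9 e10 EG !it ?kd // ?(ltnW jd) //.
  split=> //.
  + by split; [exact: nrep_upto U4 rt vN|lia].
  + by rewrite k0.
  + split=> // c ck; have cd : c < depth t := leq_trans ck kd.
    have [_ b1] := nrep_sub rt (ltnW cd); have [_ b2] := nrep_offs t rt cd.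
    rewrite it; last exact: ltnW.
    have [u4f u4g] := u4; rewrite !u4f //; try lia.
    rewrite !u4g; [exact: dm|lia|lia].
  split=> //.
    exact: lrep_below u4 (leqnSn N) lp.
  rewrite nth_take // -/o; split=> //.
  + by rewrite Eo.
  + by move=> x xo; rewrite alE (ovl_in _ wo).
  apply: okl_ext okp _ => x xp; rewrite alE (ovl_out _ wo) //.
  by rewrite Eo (disjointFl dis).
by rewrite NH.
Qed.

Lemma okl_exit t ps al : okl w (t :: ps) al -> okl w (exitt t :: ps) al.
Proof.
case=> h1 h2 h3 h4; split; rewrite ?exit_vars ?exit_best //; exact: exit_wft.
Qed.

Lemma okl_and a b ps al : okl w (TAnd a b :: ps) al -> okl w (a :: b :: ps) al.
Proof.
move=> [[wa wb ab] d h ok].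
have da : [disjoint vars a & pvars ps] by apply: disjointWl d; apply: subsetUl.
have db : [disjoint vars b & pvars ps] by apply: disjointWl d; apply: subsetUr.
split=> //.
- rewrite pvars_cons -setI_eq0 setIUr setU_eq0 !setI_eq0; exact/andP.
- move=> x xa; rewrite h /= ?inE ?xa // (ovl_out _ wb) //.
  by rewrite (disjointFr ab xa).
split=> // x xb; rewrite h /= ?inE ?xb ?orbT //; exact: (ovl_in _ wb).
Qed.

Lemma weight_cons (p : tree n m) ps : weight (p :: ps) = (2 * #|vars p|).-1 + weight ps.
Proof. by rewrite /weight big_cons. Qed.

Lemma weight_exit t ps : weight (exitt t :: ps) = weight (t :: ps).
Proof. by rewrite !weight_cons exit_vars. Qed.

Lemma weight_and (a b : tree n m) ps : [disjoint vars a & vars b] ->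
  weight (TAnd a b :: ps) = (weight (a :: b :: ps)).+1.
Proof.
move=> ab; rewrite !weight_cons.
have -> : #|vars (TAnd a b)| = #|vars a| + #|vars b|.
  by rewrite /= cardsU disjoint_setI0 // cards0 subn0.
have := vars_gt0 a; have := vars_gt0 b.
by move: #|vars a| #|vars b| => x y; lia.
Qed.

Definition descregs := pushregs ++ [:: 41; 42; 43; 55; 56; 57; 58; 59].

(** Each turn lowers the weight by exactly one and allocates at most a subproblem and a list cell,
    whence the factor 2. The last equation is a conservation law: all that [g] and [ps] contribute
    gets queued, except the assignment being output. *)
Lemma wp_descend_loop W g ps S s (Q : hst -> Prop) :
  weight (g :: ps) = W -> rg s 58 != 0 -> rg s 0 + 2 * W <= CM -> 0 < rg s 0 ->
  nrep w (fl s) (ag s) g (rg s 56) -> rg s 56 < rg s 0 -> rg s 44 < rg s 0 ->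
  lrep w (fl s) (ag s) (rg s 0) ps (rg s 59) ->
  okl w (g :: ps) (ag s (rg s 44)) -> PQ s S ->
  (forall s' S', upto descregs [:: fT] (W * (pushcost + 24) + 1) s s' ->
     rg s' 0 <= rg s 0 + 2 * W -> PQ s' S' ->
     (forall tau, S' tau + (tau == ag s (rg s 44)) = S tau + Ec g ps (ag s (rg s 44)) tau) ->
     Q s') ->
  WP c_descend_loop Q s.
Proof.
rewrite /c_descend_loop; elim: W g ps S s Q => [|W IH] g ps S s Q EW E58 hC N0 rG gN rN lp ok pq HQ.
  by move: EW; rewrite weight_cons; have := vars_gt0 g; lia.
apply: (wp_while V4 HB); rewrite /= E58.
have [re eN Ee] := nrep_exit rG.
have [wg dg ag_ okp] := ok.
set al := ag s (rg s 44) in ok HQ ag_ okp.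
do 4 (wstep; simpl).
set S1 := fun tau => S tau + Dc (vars g) (offs g) ps al tau.
(* The common end of both branches: the alternatives of the chain, if any, have been queued, and its
   exit remains to be expanded. *)
have mid s1 : upto descregs [:: fT] (pushcost + 10) s s1 -> rg s1 0 <= rg s 0 + 1 ->
    rg s1 57 = fl s fEX (rg s 56) -> rg s1 59 = rg s 59 -> rg s1 44 = rg s 44 ->
    rg s1 58 = rg s 58 -> PQ s1 S1 ->
    WP c_next
     (fun s' => WP c_descend_loop Q (tick s')) s1.
  move=> U1 N1 E57 E59 E44 E58' pq1; have [_ _ u3 u4 _ _] := U1.
  have al1 : ag s1 (rg s1 44) = al by rewrite E44; case: u4 => _ ->.
  have re1 := nrep_upto U1 re (leq_ltn_trans eN gN).
  have lp1 := lrep_below u4 u3 lp.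
  have okx := okl_exit ok.
  have Wx : weight (exitt g :: ps) = W.+1 by rewrite weight_exit.
  have ES tau : S tau + Ec g ps al tau = S1 tau + Ec (exitt g) ps al tau.
    by rewrite /S1 (Ec_split _ _ _ wg) // addnAC addnA.
  rewrite /c_next; do 3 (wstep; simpl); rewrite E57.
  have e1N : fl s 3 (rg s 56) < rg s1 0 by lia.
  case: (exitt g) re1 okx Wx ES (exit_not_or g) => [x d|//|a b] re1 okx Wx ES _.
    have [_ _ _ [-> _ _]] := re1; rewrite /=.
    wstep; simpl; rewrite E59.
    have Ux s2 : upto [:: 55; 56; 58; 59] [::] 10 s1 s2 ->
        upto descregs [:: fT] (pushcost + 22) s s2 /\ PQ s2 S1.
      move=> U2; split; last exact: PQ_upto U2 _ _ pq1.
      by apply: (upto_seq (k1 := pushcost + 10) U2) => //; lia.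
    case Ep: ps => [|p ps'].
      rewrite Ep /= in lp; rewrite lp /=; wstep; simpl.
      apply: (wp_while V4 HB); rewrite /=.
      match goal with |- Q ?x =>
        have [U2 pq2] : upto descregs [:: fT] (pushcost + 22) s x /\ PQ x S1 end.
        by apply: Ux; uptac; exact: upto_refl.
      apply: (HQ _ S1) => //.
      - by apply: (upto_le_tm U2); rewrite mulSn; lia.
      - by rewrite /=; lia.
      move=> tau; rewrite ES Ep (@Ec_leaf_nil _ _ x d) //.
      by have [_ _ -> //] := okx; rewrite /= ?inE // ffunE eqxx.
    have lp1' := lp1; rewrite Ep in lp1'; case: lp1' => /andP[p0 pN] gN1 rp lps.
    have -> /= : rg s 59 != 0 by lia.
    do 3 (wstep; simpl); rewrite E59.
    match goal with |- WP _ _ ?x =>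
      have [U2 pq2] : upto descregs [:: fT] (pushcost + 22) s x /\ PQ x S1 end.
      by apply: Ux; uptac; exact: upto_refl.
    rewrite Ep in okx Wx ES.
    apply: (IH p ps' S1) => //=.
    - by move: Wx; rewrite !weight_cons /= cards1 => -[].
    - by rewrite E58'.
    - by lia.
    - by lia.
    - by rewrite E44; lia.
    - by have [_ _ _] := okx; rewrite al1.
    move=> s2 S2 U3 N2 pq3 E3; apply: (HQ s2 S2) => //.
    - by apply: (upto_seq (k1 := pushcost + 22) U3) => //; rewrite mulSn; lia.
    - by lia.
    by move=> tau; have := E3 tau; rewrite /= al1 => ->; rewrite Ep ES (Ec_leaf_cons _ okx).
  have [_ _ _ [-> _ [La Rb] ra rb]] := re1; rewrite /=.
  do 10 (wstep; simpl); first by lia.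
  wstep; simpl; rewrite E57 E59.
  have eN1 : (fl s 3 (rg s 56) == rg s1 0) = false by rewrite ltn_eqF.
  match goal with |- WP _ _ ?x => set s2 := x end.
  have U2 : upto [:: 0; 55; 56; 58; 59] [::] 10 s1 s2.
    by rewrite /s2; uptac; first [exact: upto_refl | simpl; lia].
  have pq2 : PQ s2 S1 by exact: PQ_upto U2 _ _ pq1.
  have U2' : upto descregs [:: fT] (pushcost + 22) s s2.
    by apply: (upto_seq (k1 := pushcost + 10) U2) => //; lia.
  have RbN : fl s1 2 (fl s 3 (rg s 56)) < rg s1 0 by lia.
  have LaN : fl s1 1 (fl s 3 (rg s 56)) < rg s1 0 by lia.
  have rb2 := nrep_upto U2 rb RbN; have ra2 := nrep_upto U2 ra LaN.
  have ab : [disjoint vars a & vars b] by case: okx => -[].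
  have okab := okl_and okx.
  apply: (IH a (b :: ps) S1) => //.
  - by move: Wx; rewrite weight_and // => -[].
  - by rewrite /= E58'.
  - by rewrite /=; lia.
  - by rewrite /=; lia.
  - by rewrite /=; lia.
  - by rewrite /= E44; lia.
  - rewrite /= eqxx; split; rewrite ?eqxx //; [lia|lia|].
    have [_ _ u3' u4' _ _] := U2; apply: lrep_below u4' _ lp1; rewrite /=; lia.
  - by rewrite /= al1.
  move=> s3 S3 U3 N3 pq3 E3; rewrite /= in N3; apply: (HQ s3 S3) => //.
  - by apply: (upto_seq (k1 := pushcost + 22) U3) => //; rewrite mulSn; lia.
  - by lia.
  by move=> tau; have := E3 tau; rewrite /= al1 => ->; rewrite ES Ec_and.
case: eqP => [Eeg|Neg] /=.
  wstep; simpl; apply: mid => //=.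
  - by apply: (upto_le_tm (k := 10)); [uptac; apply: upto_refl|rewrite leq_addl].
  - by rewrite leq_addr.
  apply: (PQ_ext (S := S)); last first.
    by apply: (PQ_upto (L := [:: 57]) (Fs := [::]) (k := 10)) pq => //; uptac; apply: upto_refl.
  move=> tau; rewrite /S1; suff -> : offs g = [::] by rewrite /Dc mul0n addn0.
  by apply: size0nil; have [_] := nrep_sub rG (leqnn _); rewrite -Ee Eeg /depth; lia.
do 6 (wstep; simpl).
apply: (@wp_push g (depth g) ps S) => //=.
- by lia.
- rewrite leqnn andbT lt0n; apply/eqP => d0; apply: Neg; by rewrite Ee d0.
move=> s1 U1 N1 pq1.
have U0 : upto descregs [:: fT] (pushcost + 10) s (tick s1).
  rewrite addnS; apply: upto_tick.
  apply: (upto_seq (k1 := 9) U1) => //; first by lia.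
  by uptac; exact: upto_refl.
apply: mid => //=; rewrite ?N1 ?(upto_rg' U1) ?addn1 //.
rewrite /depth take_size in pq1.
exact: (PQ_upto (upto_tick (upto_refl [::] [::] 0 s1)) isT isT pq1).
Qed.

Lemma wp_descend W g ps S s (Q : hst -> Prop) :
  weight (g :: ps) <= W -> rg s 0 + 2 * W <= CM -> 0 < rg s 0 ->
  nrep w (fl s) (ag s) g (rg s 56) -> rg s 56 < rg s 0 -> rg s 44 < rg s 0 ->
  lrep w (fl s) (ag s) (rg s 0) ps (rg s 59) ->
  okl w (g :: ps) (ag s (rg s 44)) -> PQ s S ->
  (forall s' S', upto descregs [:: fT] (W * (pushcost + 24) + 2) s s' ->
     rg s' 0 <= rg s 0 + 2 * W -> PQ s' S' ->
     (forall tau, S' tau + (tau == ag s (rg s 44)) = S tau + Ec g ps (ag s (rg s 44)) tau) ->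
     Q s') ->
  WP c_descend Q s.
Proof.
move=> hW hC N0 rG gN rN lp ok pq HQ; rewrite /c_descend; do 2 (wstep; simpl).
apply: (@wp_descend_loop _ g ps S) => //=; first by lia.
move=> s' S' U N' pq' E; apply: (HQ _ S') => //; last by lia.
apply: (upto_seq (k1 := 1) U) => //.
  by have := leq_mul2r (pushcost + 24) (weight (g :: ps)) W; rewrite hW orbT; lia.
by uptac; exact: upto_refl.
Qed.

(** The variable sets are disjoint, so their sizes add up to at most [n]. *)
Lemma weight_le ps al : okl w ps al -> weight ps <= 2 * n.
Proof.
move=> ok; suff h : weight ps <= 2 * #|pvars ps|.
  apply: leq_trans h _; rewrite leq_mul2l /=.
  by have := max_card (mem (pvars ps)); rewrite card_ord.
elim: ps ok => [|p ps IH] /=; first by rewrite /weight big_nil.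
case=> _ d _ /IH h; rewrite weight_cons pvars_cons.
have -> : #|vars p :|: pvars ps| = #|vars p| + #|pvars ps|.
  by rewrite cardsU disjoint_setI0 // cards0 subn0.
by rewrite mulnDr leq_add // leq_pred.
Qed.

Lemma wp_push_seg t k ps S s (Q : hst -> Prop) :
  rg s 0 < CM -> 0 < rg s 0 ->
  nrep w (fl s) (ag s) t (rg s 54) -> rg s 54 < rg s 0 -> wft w t ->
  k <= depth t -> rg s 55 = iter k (fl s fL) (rg s 54) ->
  lrep w (fl s) (ag s) (rg s 0) ps (rg s 43) ->
  okl w ps (ag s (rg s 44)) -> [disjoint vars t & pvars ps] -> PQ s S ->
  (forall s', upto (pushregs ++ [:: 41; 42]) [:: fT] (pushcost + 4) s s' ->
     rg s' 0 <= (rg s 0).+1 ->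
     PQ s' (fun tau => S tau + Dc (vars t) (take k (offs t)) ps (ag s (rg s 44)) tau) -> Q s') ->
  WP c_push_seg Q s.
Proof.
move=> NC N0 rt vN wt kd E55 lp okp dis pq HQ; rewrite /c_push_seg; wstep; simpl.
have kE : (rg s 54 == rg s 55) = (k == 0).
  by rewrite E55 -[X in X == _]/(iter 0 (fl s fL) (rg s 54)) (at_eq rt) // eq_sym.
rewrite kE; case: eqP => [k0|k0] /=.
  wstep; apply: HQ => /=.
  - by apply: (upto_le_tm (k := 2)); [uptac; exact: upto_refl|lia].
  - exact: leqnSn.
  by apply: PQ_ext pq => tau; rewrite k0 take0 /Dc mul0n addn0.
do 4 (wstep; simpl); apply: (@wp_push t k ps S) => //=; first by rewrite kd andbT lt0n; apply/eqP.
move=> s1 U1 N1 pq1; apply: HQ => //=; last by rewrite N1.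
rewrite addn4; uptac; apply: (upto_seq (k1 := 3) U1) => //; uptac; exact: upto_refl.
Qed.

(** The popped segment falls into the alternatives before position [j], those after it, and the tree
    at [j] without its maximum; the three counts add up to what was removed, less the output
    itself. *)
Lemma wp_pop W S r s (Q : hst -> Prop) :
  rg s 44 = r -> r = fl s fT (rg s 30) -> r != 0 ->
  rg s 0 + 2 * W + 2 <= CM -> 2 * n <= W -> 0 < rg s 0 -> PQ s S ->
  (forall s' S', upto (descregs ++ [:: 53; 54]) [:: fT]
       (W * (pushcost + 24) + 3 * pushcost + 60) s s' ->
     rg s' 0 <= rg s 0 + 2 * W + 2 -> PQ s' S' ->
     (forall tau, S' tau + (tau == ag s r) = S tau) -> 
     (forall tau, 0 < S tau -> (w tau <= w (ag s r))%R) -> Q s') ->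
  WP c_pop Q s.
Proof.
move=> E44 Er r0 hC nW N0 [h [H [D [[q1 q2 q3 q4 q5] ES]]]] HQ.
have [t1 t2 t3] := q3.
(* The root of a tree of height [h] is the cell on level [h] at position 0, with index [2 ^ h]. *)
have Eroot : fl s fT (rg s 30) = fl s fT (tix h 0) by rewrite q1 /tix muln1.
have [rH rmax] : r \in H /\ forall r', r' \in H -> (w (ag s r') <= w (ag s r))%R.
  have := t2 h 0 (leqnn _); rewrite -Eroot -Er /bestof (negbTE r0) /cell => -[/andP[rH _] hm].
  split=> // r' r'H; apply: hm; apply/andP; split=> //; rewrite divn_small //.
  by have /andP[] := t1 r' r'H.
have Smax tau : 0 < S tau -> (w tau <= w (ag s r))%R.
  rewrite ES lt0n sum_nat_seq_neq0 => /hasP[r' r'H /= D0].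
  have [_ [Y' [os' [ps' [ok' ED']]]]] := q5 r' r'H.
  apply: le_trans (rmax _ r'H); apply: (recok_opt ok').
  by rewrite -ED' lt0n.
have [rN [Y [os [ps [ok ED]]]]] := q5 r rH.
set S1 := fun tau => \sum_(r' <- rem r H) D r' tau.
have ES1 tau : S tau = S1 tau + D r tau by rewrite ES (perm_big _ (perm_to_rem rH)) big_cons addnC.
rewrite /c_pop; do 4 (wstep; simpl); wstep.
apply: (wp_update _ V4 HB (h := h) (A := mem H) (i := r) (v := 0)) => //=.
- exact: t1.
- have := log_le q2; lia.
move=> s1 U1 Ea1 f1 tk1.
have hK : h <= K.+1 by apply: log_le q2 _; lia.
have U1' : upto (descregs ++ [:: 53; 54]) [:: fT] (pushcost + 10) s s1.
  apply: (upto_seq (k1 := 2) U1) => //; first by rewrite /pushcost; lia.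
  by uptac; exact: upto_refl.
have E44' : rg s1 44 = r by rewrite (upto_rg' U1).
have E0 : rg s1 0 = rg s 0 by rewrite (upto_rg' U1).
have [_ _ u3 u4 _ _] := U1'.
have Er1 : ag s1 r = ag s r by rewrite Ea1.
have pq1 : PQ s1 S1.
  exists h, (rem r H), D; split=> //; split.
  - by rewrite (upto_rg' U1).
  - by rewrite E0.
  - apply: tok_ext tk1 => // x; rewrite /live /= mem_rem_uniq // inE.
    by case: eqP.
  - exact: rem_uniq.
  move=> r' r'H; have {}r'H := mem_rem r'H.
  have [r'N [Y' [os' [ps' [ok' E']]]]] := q5 r' r'H; rewrite E0; split=> //.
  exists Y', os', ps'; split; last by move=> tau; rewrite E' Ea1.
  exact: recok_below u4 (leqnn _) r'N ok'.
have ok1 : recok (rg s1 0) (fl s1) (ag s1) r Y os ps by apply: recok_below u4 u3 rN ok.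
case: ok1 => t [k [j [[rv vN] [wt Ev] [/andP[k0 kd] jk] [Ex Ey dm] [Eo lp okr]]]].
have jd : j < depth t := leq_trans jk kd.
set v := fl s1 fRV r in rv vN Ex Ey dm.
have nthE : nth t os j = nth t (offs t) j by rewrite Eo nth_take.
rewrite nthE in okr; set o := nth t (offs t) j in okr nthE.
have [wo Eo'] : okoff w Y o by have /(everyT_nth _ _ t) := offs_ok wt; rewrite Ev; apply.
have [_ dis okv okp] := okr.
have disY : [disjoint vars t & pvars ps] by rewrite Ev -Eo'.
do 8 (wstep; simpl); wstep; rewrite E44' Ey.
set s2 := setr _ 55 _.
have U2 : upto (descregs ++ [:: 53; 54]) [:: fT] (pushcost + 14) s s2.
  by apply: (upto_le_tm (k := (pushcost + 10).+4)); [rewrite /s2; uptac|lia].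
apply: (@wp_push_seg t j ps S1) => //=; rewrite ?E44' //; try lia.
move=> s3 U3 N3 pq3.
have U3' : upto (descregs ++ [:: 53; 54]) [:: fT] (2 * pushcost + 18) s s3.
  by apply: (upto_seq (k1 := pushcost + 14) U3) => //; lia.
have [_ _ u3' u4' _ _] := U3.
have N3' : rg s3 0 <= (rg s1 0).+1 by exact: N3.
have u3s : rg s1 0 <= rg s3 0 by exact: u3'.
have E3 x : x \notin pushregs ++ [:: 41; 42] -> rg s3 x = rg s2 x by exact: (upto_rg' U3).
have E343 : rg s3 43 = fl s1 fRP r by rewrite (E3 43) //= E44'.
have E344 : rg s3 44 = r by rewrite (E3 44).
have E353 : rg s3 53 = iter j (fl s1 1) v by rewrite (E3 53) //= E44' Ey.
have Ef3 f i : f < 20 -> i < rg s1 0 -> fl s3 f i = fl s1 f i by case: u4' => e _; apply: e.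
have Eag3 i : i < rg s1 0 -> ag s3 i = ag s1 i by case: u4' => _ e; apply: e.
have rN1 : r < rg s1 0 by rewrite E0.
have [ryj yb] := nrep_sub rv (ltnW jd).
have [ro ob] := nrep_offs t rv jd.
have [ryj' yb'] := nrep_sub rv jd.
have yN : iter j (fl s1 1) v < rg s1 0 by lia.
have LyN : iter j.+1 (fl s1 1) v < rg s1 0 by lia.
do 5 (wstep; simpl); rewrite E353 E344.
rewrite (Ef3 1) // (Ef3 8) // -[fl s1 1 _]/(iter j.+1 (fl s1 1) v) Ex.
set s4 := setr _ 55 _.
have U4 : upto (descregs ++ [:: 53; 54]) [:: fT] (2 * pushcost + 20) s s4.
  by apply: (upto_le_tm (k := (2 * pushcost + 18).+2)); [rewrite /s4; uptac|lia].
have kj : k = (k - j.+1) + j.+1 by lia.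
have itN c : c <= k - j.+1 -> iter c (fl s3 1) (iter j.+1 (fl s1 1) v) =
    iter c (fl s1 1) (iter j.+1 (fl s1 1) v).
  move=> hc; apply: (iter_below (N := rg s1 0) u4' ryj'); first by lia.
  by rewrite depth_sub; lia.
apply: (@wp_push_seg (sub t j.+1) (k - j.+1) ps
   (fun tau => S1 tau + Dc (vars t) (take j (offs t)) ps (ag s1 r) tau)).
- by rewrite /=; lia.
- by rewrite /=; lia.
- exact: (nrep_below u4' ryj' LyN).
- exact: leq_trans LyN u3s.
- exact: wft_sub.
- by rewrite depth_sub; lia.
- by rewrite /= itN // -iterD -kj.
- by rewrite /= E343; exact: lrep_below u4' u3s lp.
- by rewrite /= E344 Eag3.
- by rewrite vars_sub.
- exact: pq3.
move=> s5 U5 N5 pq5.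
have U5' : upto (descregs ++ [:: 53; 54]) [:: fT] (3 * pushcost + 24) s s5.
  by apply: (upto_seq (k1 := 2 * pushcost + 20) U5) => //; lia.
have [_ _ u5 u6 _ _] := U5.
have E5 x : x \notin pushregs ++ [:: 41; 42] -> rg s5 x = rg s4 x by exact: (upto_rg' U5).
have E553 : rg s5 53 = iter j (fl s1 1) v by rewrite (E5 53).
have E544 : rg s5 44 = r by rewrite (E5 44).
have u7 : below (rg s1 0) (fl s1) (ag s1) (fl s5) (ag s5) by exact: below_trans u3' u4' u6.
have N5' : rg s5 0 <= (rg s3 0).+1 by exact: N5.
have N15 : rg s1 0 <= rg s5 0 by apply: leq_trans u3' u5.
have [u7f u7g] := u7.
do 4 (wstep; simpl); rewrite E553 E544 (u7f 2) // (u7f 10) //.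
apply: (@wp_descend W o ps (fun tau => S1 tau + Dc (vars t) (take j (offs t)) ps (ag s1 r) tau +
    Dc (vars (sub t j.+1)) (take (k - j.+1) (offs (sub t j.+1))) ps (ag s4 (rg s4 44)) tau)) => //=.
- by apply: leq_trans (weight_le okr) nW.
- by lia.
- lia.
- by apply: nrep_below u7 ro _; lia.
- lia.
- by rewrite E544; lia.
- exact: lrep_below u7 N15 lp.
- by rewrite E544 u7g.
move=> s6 S6 U6 N6 pq6 ES6.
apply: (HQ s6 S6) => //.
- apply: (upto_seq (k1 := 3 * pushcost + 26) U6) => //; first by lia.
  by apply: (upto_le_tm (k := (3 * pushcost + 24).+2)); [uptac|lia].
- by move: N6; rewrite /=; lia.
move=> tau; have := ES6 tau.
have -> : ag s5 (rg s5 44) = ag s r by rewrite E544 u7g.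
have -> : ag s3 (rg s3 44) = ag s r by rewrite E344 Eag3.
rewrite Er1 vars_sub ES1 ED Ev => ->.
have -> : os = take j (offs t) ++ o :: take (k - j.+1) (offs (sub t j.+1)).
  have -> : os = take (j + (k - j.+1).+1) (offs t) by rewrite Eo; congr take; lia.
  by rewrite takeD (drop_nth t jd) offs_sub.
by rewrite Dc_split //; lia.
Qed.
End Queue.

(** * From circuits to trees *)

Section Circuit.
Variables (n m : nat) (R : realType) (w : passign n m -> R) (C : circuit n m).
Hypothesis dec : decomposable C.
Hypothesis smo : smooth C.
Hypothesis det : deterministic C.
Implicit Types (t : tree n m) (tau sigma : passign n m) (v u : nat) (us : seq nat).

Lemma invar_inp v x d y : gate_at C v = GInp x d -> invar C v y <-> y = x.
Proof.
move=> E; split=> [[u [d' [r Eu]]]|->]; last by exists v, d; split=> //; apply: reach_refl.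
case: r E Eu => [v' -> [] //|u' w' v' _]; by rewrite /edges => + E; rewrite E.
Qed.

Lemma invar_edges v y : (if gate_at C v is GInp _ _ then False else True) ->
  invar C v y <-> exists2 u, u \in edges C v & invar C u y.
Proof.
move=> H; split=> [[u [d [r Eu]]]|[u uv [u' [d [r E]]]]].
  case: r H Eu => [v' + E|u' w' v' r wv _ E]; first by rewrite E.
  by exists w' => //; exists u', d.
by exists u', d; split=> //; apply: reach_step r uv.
Qed.

Lemma relg_on_var v tau : relg C v tau -> on_var C v tau.
Proof.
case=> // v' x d tau' E H y; rewrite (invar_inp y E) H.
by case: eqP => [->|ne]; split.
Qed.

(** Trees ignore variables outside [vars t], so their semantics is matched with membership of the
    restriction. *)
Definition grepr v t :=
  [/\ wft w t, forall x, x \in vars t <-> invar C v x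
    & forall tau, msem t tau <-> restr_in_rel C v tau].

Lemma grepr_leaf v x d : gate_at C v = GInp x d -> grepr v (TLeaf x d).
Proof.
move=> E; split=> //= [y|tau].
  by rewrite inE (invar_inp y E); split=> /eqP.
split=> [/eqP Ex|[sigma]].
  exists [ffun y => if y == x then Some d else None].
    by apply: relg_inp E _ => y; rewrite ffunE.
  by move=> y /(invar_inp y E) ->; rewrite ffunE eqxx.
move=> r ag; rewrite -ag; last exact/(invar_inp x E).
case: r E => [v' x' d' tau' -> H []|v' s tau' ->|v' s tau' ->] //.
by move=> <- <-; rewrite H eqxx.
Qed.

Lemma restr_some u tau x : restr_in_rel C u tau -> invar C u x -> tau x <> None.
Proof. by case=> sigma /relg_on_var ov ag ix; rewrite -ag //; apply/ov. Qed.

(** [us] will be a prefix of the inputs of a gate, as inputs are folded one by one into binary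
    nodes. *)
Definition arepr us t :=
  [/\ wft w t, forall x, x \in vars t <-> exists2 u, u \in us & invar C u x
    & forall tau, msem t tau <-> forall u, u \in us -> restr_in_rel C u tau].

Definition orepr us t :=
  [/\ wft w t, forall x, x \in vars t <-> exists2 u, u \in us & invar C u x
    & forall tau, msem t tau <-> exists2 u, u \in us & restr_in_rel C u tau].

Lemma arepr1 u t : grepr u t -> arepr [:: u] t.
Proof.
case=> h1 h2 h3; split=> // [x|tau].
  by rewrite h2; split=> [h|[u']]; [exists u; rewrite ?inE|rewrite inE => /eqP ->].
rewrite h3; split=> [h u'|]; first by rewrite inE => /eqP ->.
by apply; rewrite inE.
Qed.

Lemma orepr1 u t : grepr u t -> orepr [:: u] t.
Proof.
case=> h1 h2 h3; split=> // [x|tau].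
  by rewrite h2; split=> [h|[u']]; [exists u; rewrite ?inE|rewrite inE => /eqP ->].
by rewrite h3; split=> [h|[u']]; [exists u; rewrite ?inE|rewrite inE => /eqP ->].
Qed.

Lemma arepr_rcons v s us u a b : gate_at C v = GAnd n m s -> {subset us <= s} -> u \in s ->
  u \notin us -> arepr us a -> grepr u b -> arepr (rcons us u) (TAnd a b).
Proof.
move=> E sub us' un [a1 a2 a3] [b1 b2 b3]; split=> /= [|x|tau].
- split=> //; rewrite disjoint_subset; apply/subsetP => x /a2[u' u'us xu']; rewrite inE.
  apply/negP => /b2 xu; apply: (dec E (sub _ u'us) us' _ (conj xu' xu)).
  by move=> E'; rewrite -E' u'us in un.
- rewrite inE; split=> [/orP[/a2[u' h1 h2]|/b2 h]|[u']].
  + by exists u' => //; rewrite mem_rcons inE h1 orbT.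
  + by exists u => //; rewrite mem_rcons inE eqxx.
  rewrite mem_rcons inE => /orP[/eqP -> h|h1 h2]; apply/orP; [right|left].
    exact/b2.
  by apply/a2; exists u'.
split=> [/andP[/a3 h1 /b3 h2] u'|h].
  by rewrite mem_rcons inE => /orP[/eqP -> //|/h1].
apply/andP; split.
  by apply/a3 => u' h'; apply: h; rewrite mem_rcons inE h' orbT.
by apply/b3; apply: h; rewrite mem_rcons inE eqxx.
Qed.

Lemma agrees_sub u v s1 s2 s3 : (forall x, invar C u x -> invar C v x) ->
  agrees_on C u s1 s2 -> agrees_on C v s2 s3 -> agrees_on C u s1 s3.
Proof. by move=> sub h1 h2 x ix; rewrite h1 // h2 //; apply: sub. Qed.

Lemma grepr_and v s t : gate_at C v = GAnd n m s -> s <> [::] -> arepr s t -> grepr v t.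
Proof.
move=> E s0 [h1 h2 h3].
have Ee : edges C v = s by rewrite /edges E.
have iv x : invar C v x <-> exists2 u, u \in s & invar C u x.
  by rewrite -Ee; apply: invar_edges; rewrite E.
split=> // [x|tau]; first by rewrite h2 iv.
rewrite h3; split=> [h|[sigma r ag] u us].
  pose sigma : passign n m := [ffun x => if x \in vars t then tau x else None].
  exists sigma; last by move=> x /iv/h2 xt; rewrite ffunE xt.
  apply: relg_and E _ _ => [x|u us].
    rewrite ffunE iv -h2; case xt: (x \in vars t); last by split.
    split=> // _; have /h2[u us xu] := xt; exact: restr_some (h u us) xu.
  have [s' r' ag'] := h u us; exists s' => // x xu; rewrite ag' // ffunE ifT //.
  by apply/h2; exists u.
case: r E ag => [v' x d tau' ->|v' s' tau' E' _ H|v' s' tau' ->] // E ag.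
move: E; rewrite E' => -[Es]; rewrite -Es in us; have [s2 r2 ag2] := H u us.
exists s2 => //; apply: agrees_sub ag2 ag => x xu.
apply/(invar_edges x); first by rewrite E'.
by exists u; rewrite // /edges E'.
Qed.

(** By smoothness each input has all variables of the gate, so a witness for one input already
    belongs to the relation of the gate. *)
Lemma or_restrict v s tau : gate_at C v = GOr n m s ->
  (exists2 u, u \in s & restr_in_rel C u tau) ->
  exists2 sigma, relg C v sigma & forall x, invar C v x -> sigma x = tau x.
Proof.
move=> E [u us ru].
have iv x : invar C v x <-> exists2 u, u \in s & invar C u x.
  by have := invar_edges x; move=> /(_ v); rewrite /edges E; apply.
have iu x : invar C v x <-> invar C u x.
  rewrite iv; split=> [[u' u's xu']|xu]; last by exists u.
  by apply/(smo E us u's x).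
have [s' r' ag'] := ru.
exists s'; last by move=> x /iu; apply: ag'.
apply: relg_or E _ _; last by exists u => //; exists s'.
by move=> x; rewrite (relg_on_var r' x) iu.
Qed.

Lemma grepr_or v s t : gate_at C v = GOr n m s -> s <> [::] -> orepr s t -> grepr v t.
Proof.
move=> E s0 [h1 h2 h3].
have Ee : edges C v = s by rewrite /edges E.
have iv x : invar C v x <-> exists2 u, u \in s & invar C u x.
  by rewrite -Ee; apply: invar_edges; rewrite E.
split=> // [x|tau]; first by rewrite h2 iv.
rewrite h3; split=> [/(or_restrict E)[sigma r ag]|[sigma r ag]]; first by exists sigma.
case: r E ag => [v' x d tau' ->|v' s' tau' ->|v' s' tau' E' _ [u us [s2 r2 ag2]]] // E ag.
move: E; rewrite E' => -[Es]; exists u; first by rewrite -Es.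
exists s2 => //; apply: agrees_sub ag2 ag => x xu.
apply/(invar_edges x); first by rewrite E'.
by exists u; rewrite // /edges E'.
Qed.

Lemma orepr_rcons v s us u a b t : gate_at C v = GOr n m s -> {subset us <= s} -> u \in s ->
  us <> [::] -> u \notin us -> orepr us a -> grepr u b ->
  orpair w a b t -> orepr (rcons us u) t.
Proof.
move=> E sub us' us0 un [a1 a2 a3] [b1 b2 b3] ab.
have Ev : vars a = vars b.
  case: us sub us0 un a2 a3 => // u0 us sub _ un a2 a3.
  have u0s : u0 \in s by apply: sub; rewrite inE eqxx.
  apply/setP => x; apply/idP/idP => [/a2[u' u'us xu']|/b2 xu].
    by apply/b2/(smo E us' (sub _ u'us) x).
  by apply/a2; exists u0; [rewrite inE eqxx|apply/(smo E us' u0s x)].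
(* Determinism speaks of members of the relation of [v], so [tau] is first cut down to such a
   [sigma]. *)
have dis tau : ~~ (msem a tau && msem b tau).
  apply/negP => /andP[/a3[u1 u1us r1] /b3 r2].
  have [sigma rs ags] := or_restrict E (ex_intro2 _ _ u us' r2).
  have tr u' : u' \in s -> restr_in_rel C u' tau -> restr_in_rel C u' sigma.
    move=> u's [s2 r ag]; exists s2 => // x xu; rewrite ag // ags //.
    by have := invar_edges x; move=> /(_ v); rewrite /edges E => ->; [exists u'|].
  apply: (det E (sub _ u1us) us' _ rs); last by split; apply: tr => //; apply: sub.
  by move=> E'; rewrite -E' u1us in un.
have sem (p : nat -> Prop) : (exists2 u', u' \in us & p u') \/ p u <->
    exists2 u', u' \in rcons us u & p u'.
  split=> [[[u' h1 h2]|h]|[u']].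
  - by exists u' => //; rewrite mem_rcons inE h1 orbT.
  - by exists u => //; rewrite mem_rcons inE eqxx.
  rewrite mem_rcons inE => /orP[/eqP -> h|h1 h2]; [by right|by left; exists u'].
have va x : x \in vars a <-> exists2 u', u' \in rcons us u & invar C u' x.
  rewrite -sem; split=> [/a2|[/a2 //|/b2]]; first by left.
  by rewrite Ev.
have sab tau : msem a tau || msem b tau <->
    exists2 u', u' \in rcons us u & restr_in_rel C u' tau.
  rewrite -sem; split=> [/orP[/a3|/b3]|[/a3 ->|/b3 ->]];
    [by left|by right|by []|by rewrite orbT].
case: ab => -[-> hw]; split=> //=.
- by split=> // tau; rewrite andbC.
- by move=> x; rewrite -Ev.
by move=> tau; rewrite orbC.
Qed.

End Circuit.

(** * Reading the circuit *)

Lemma size_offsets b l : size (offsets b l) = size l.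
Proof. by elim: l b => //= e l IH b; rewrite IH. Qed.

Lemma nth_offsets b l v : v < size l ->
  nth 0 (offsets b l) v = b + size (flatten (take v l)).
Proof.
elim: l b v => //= e l IH b [|v] /= h; first by rewrite addn0.
by rewrite IH // size_cat addnA.
Qed.

Lemma nth_flatten_take (l : seq (seq nat)) v i : v < size l -> i < size (nth [::] l v) ->
  nth 0 (flatten l) (size (flatten (take v l)) + i) = nth 0 (nth [::] l v) i
  /\ size (flatten (take v l)) + i < size (flatten l).
Proof.
elim: l v => //= e l IH [|v] /= h hi.
  by rewrite add0n nth_cat hi size_cat; split=> //; apply: ltn_addr.
have [h1 h2] := IH v h hi; rewrite !size_cat nth_cat -addnA ltnNge leq_addr /= addKn.
by rewrite ltn_add2l.
Qed.

Section Encoding.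
Variables (n m : nat) (C : circuit n m).

Lemma encode_root : nth 0 (encode C) 1 = outg C.
Proof. by []. Qed.

Lemma encode_gate v : v < size (gates C) ->
  forall i, i < size (enc_gate (gate_at C v)) ->
    nth 0 (encode C) (nth 0 (encode C) (v + 2) + i) = nth 0 (enc_gate (gate_at C v)) i
    /\ nth 0 (encode C) (v + 2) + i < size (encode C).
Proof.
move=> vG i hi; set encs := map (@enc_gate n m) (gates C).
have sE : size encs = size (gates C) by rewrite size_map.
have nE : nth [::] encs v = enc_gate (gate_at C v).
  by rewrite (nth_map (GOr n m [::])).
have oE : nth 0 (encode C) (v + 2) = 2 + size (gates C) + size (flatten (take v encs)).
  by rewrite addn2 /encode /= -/encs nth_cat size_offsets sE vG nth_offsets ?sE.
rewrite oE; rewrite -nE in hi *; have [] := nth_flatten_take _ hi; rewrite ?sE //.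
move=> h1 h2; rewrite -h1 /encode -/encs -!addnA !add2n /= nth_cat size_offsets sE.
rewrite ltnNge leq_addr /= addKn; split=> //.
by rewrite size_cat size_offsets sE !ltnS ltn_add2l.
Qed.

Lemma enc_size v : v < size (gates C) -> size (edges C v) + 2 <= size (enc_gate (gate_at C v)).
Proof. by rewrite /edges; case: (gate_at C v) => //= s _; rewrite addn2. Qed.

Lemma encode_size : circuit_size C + size (gates C) + 2 <= size (encode C).
Proof.
rewrite /encode /= size_cat size_offsets size_map size_flatten /shape -map_comp.
have h : circuit_size C <= sumn (map (size \o @enc_gate n m) (gates C)).
  rewrite sumnE big_map; apply: leq_sum => g _ /=; case: g => //= s; lia.
by rewrite addn2 !ltnS addnC leq_add2l.
Qed.

End Encoding.

Section Progress.
(* [nd v] is nonzero when gate [v] has been translated; [wt v] pays for it. *)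
Variables (G : nat) (wt rk : nat -> nat).

Definition done_wt (nd : nat -> nat) := \sum_(u < G | nd u != 0) wt u.
(** Ranks decrease along edges, so processing a gate of rank [r] can only enter these gates. *)
Definition left_wt r (nd : nat -> nat) := \sum_(u < G | (nd u == 0) && (rk u < r)) wt u.

(** Weight passes from one sum to the other as long as only gates of rank below [r] get
    translated. *)
Lemma done_left r nd nd' : (forall u, u < G -> nd u != 0 -> nd' u != 0) ->
  (forall u, u < G -> nd u == 0 -> nd' u != 0 -> rk u < r) ->
  done_wt nd' + left_wt r nd' = done_wt nd + left_wt r nd.
Proof.
move=> h1 h2; rewrite /done_wt /left_wt big_mkcond [X in _ + X]big_mkcond -big_split /=.
rewrite [X in _ = X + _]big_mkcond [X in _ = _ + X]big_mkcond -big_split /=.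
apply: eq_bigr => u _.
case: (nd u =P 0) => [E|/eqP ne]; case: (nd' u =P 0) => [E'|/eqP ne'] //=.
- by rewrite add0n addn0 (h2 u) // E.
by have := h1 u (ltn_ord u) ne; rewrite E'.
Qed.

Lemma done_set nd v x : v < G -> nd v = 0 -> x != 0 ->
  done_wt (upd nd v x) = done_wt nd + wt v.
Proof.
move=> vG v0 x0; rewrite /done_wt (bigD1 (Ordinal vG)) /= ?eqxx // addnC; congr (_ + _).
apply: eq_bigl => u; rewrite -val_eqE /=; case: (nat_of_ord u =P v) => [->|_];
  last by rewrite andbT.
by rewrite v0 andbF.
Qed.

Lemma left_mono r r' nd : r <= r' -> left_wt r nd <= left_wt r' nd.
Proof.
move=> rr; rewrite /left_wt big_mkcond [X in _ <= X]big_mkcond; apply: leq_sum => u _.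
by case: (nd u == 0) => //=; case: ifP => // h; rewrite (leq_trans h rr).
Qed.

Lemma left_set r nd v : v < G -> nd v = 0 -> rk v < r ->
  left_wt (rk v) nd + wt v <= left_wt r nd.
Proof.
move=> vG v0 vr; rewrite [X in _ <= X](bigD1 (Ordinal vG)) /= ?v0 ?eqxx // addnC leq_add2l.
rewrite /left_wt big_mkcond [X in _ <= X]big_mkcond; apply: leq_sum => u _.
case: (nd u == 0) => //=; case: ifP => // h; rewrite (ltn_trans h vr) -val_eqE /=.
by case: eqP => // E; rewrite E ltnn in h.
Qed.

End Progress.

(** * Depth-first translation of the circuit *)

Section Search.
Variables (n m : nat) (R : realType).
Variables (P : seq instr) (B V : nat) (input : seq nat) (w : passign n m -> R).
Variable C : circuit n m.
Hypothesis Einp : input = encode C.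
Hypothesis V4 : 4 <= V.
Hypothesis HB : obase n + V.+1 * width n <= B.
Hypothesis HI : forall i, nth 0 input i < V.
Hypothesis HI1 : forall i, (nth 0 input i).+1 < V.
Hypothesis HS : size input < V.
Local Notation WP := (wp P B V input w).
Local Notation hst := (hst n m).
Local Notation G := (size (gates C)).

Hypothesis dec : decomposable C.
Hypothesis smo : smooth C.
Hypothesis det : deterministic C.
Hypothesis edges_lt : forall v u, v < G -> u \in edges C v -> u < G.
Hypothesis edges_uniq : forall v, v < G -> uniq (edges C v).
Hypothesis edges_ne : forall v, v < G ->
  match gate_at C v with GInp _ _ => True | _ => edges C v <> [::] end.
Variable rk : nat -> nat.
Hypothesis rk_lt : forall v u, v < G -> u \in edges C v -> rk u < rk v.
Hypothesis rk_le : forall v, v < G -> rk v < G.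
Variable X : nat.
Hypothesis XV : X < V.

Local Notation deg v := (size (edges C v)).
(** One unit for each input and one for the gate; a unit pays for 200 ticks and one object. *)
Definition gwt v := (deg v).+1.
Local Notation nd s := (fl s fND).
Local Notation done s := (done_wt G gwt (nd s)).
Local Notation left r s := (left_wt G gwt rk r (nd s)).

Definition inner v := if gate_at C v is GInp _ _ then false else true.
Definition kind v := match gate_at C v with GInp _ _ => 0 | GOr _ => 1 | GAnd _ => 2 end.
Definition prep v us t :=
  match gate_at C v with
  | GInp _ _ => False
  | GOr _ => orepr w C us t
  | GAnd _ => arepr w C us t
  end.

Lemma encode_inner v : v < G -> inner v ->
  let off := nth 0 input (v + 2) in
  [/\ nth 0 input off = kind v, nth 0 input (off + 1) = deg v,
     forall i, i < deg v -> nth 0 input (off + i + 2) = nth 0 (edges C v) i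
   & off + deg v + 1 < size input].
Proof.
move=> vG iv off; have H := encode_gate vG; rewrite -Einp in H; have S := enc_size vG.
rewrite -/off in H; split.
- have [] := H 0; first by lia.
  by rewrite addn0 => -> _; move: iv; rewrite /inner /kind; case: gate_at.
- have [] := H 1; first by lia.
  by move=> -> _; move: iv; rewrite /inner /edges; case: gate_at.
- move=> i ideg; have [] := H (i + 2); first by lia.
  rewrite addnA => -> _; move: iv; rewrite /inner /edges addn2.
  by case: gate_at.
have [] := H (deg v + 1); first by lia.
by rewrite addnA.
Qed.

Definition stored (s : hst) i t := nrep w (fl s) (ag s) t i /\ i < rg s 0.

(** Reachability is recorded because translated gates are paid for by edges of the circuit in
    [done_le]. *)
Definition ndok (s : hst) := forall v, v < G -> nd s v != 0 ->
  reach C v (outg C) /\ exists2 t, grepr w C v t & stored s (nd s v) t.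

Definition dregs := [:: 0; 1; 2; 3; 4; 5; 6; 7; 8; 10; 12; 13; 14; 15; 16; 17; 18; 19;
  20; 21; 22; 23; 24; 25; 26; 27; 28].
Definition dfields := [:: fND; fSG; fSI; fSA].

(** Time and objects are charged to the gates finished in between; [k] and [e] are the debts of a
    gate still open. Frames below [p] are kept, and no gate of rank [r] or more gets translated. *)
Record dfs_rel (r p e k : nat) (s s' : hst) : Prop := DfsRel {
  dr_upto : upto dregs dfields (200 * (done s' - done s) + k) s s';
  dr_done : done s <= done s';
  dr_stack : forall f j, f \in [:: fSG; fSI; fSA] -> j < p -> fl s' f j = fl s f j;
  dr_ok : ndok s';
  dr_mono : forall u, u < G -> nd s u != 0 -> nd s' u != 0;
  dr_new : forall u, u < G -> nd s u == 0 -> nd s' u != 0 -> rk u < r;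
  dr_cnt : rg s' 0 + done s <= rg s 0 + done s' + e }.

Lemma dfs_trans r p e1 e2 k1 k2 e k s s1 s2 :
  dfs_rel r p e1 k1 s s1 -> dfs_rel r p e2 k2 s1 s2 -> e1 + e2 <= e -> k1 + k2 <= k ->
  dfs_rel r p e k s s2.
Proof.
move=> [a1 a2 a3 a4 a5 a6 a7] [b1 b2 b3 b4 b5 b6 b7] he hk; split=> //.
- apply: (upto_seq b1) a1 => //.
  rewrite (_ : done s2 - done s = (done s1 - done s) + (done s2 - done s1)); last by lia.
  by rewrite mulnDr; lia.
- exact: leq_trans a2 b2.
- by move=> f j fS jp; rewrite b3 ?a3.
- by move=> u uG /(a5 _ uG)/(b5 _ uG).
- move=> u uG u0 u2; case u1: (nd s1 u == 0); first exact: b6.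
  by apply: a6 => //; rewrite u1.
lia.
Qed.

Lemma dfs_weak r p r' p' e k s s' : r <= r' -> p' <= p ->
  dfs_rel r p e k s s' -> dfs_rel r' p' e k s s'.
Proof.
move=> rr pp [a1 a2 a3 a4 a5 a6 a7]; split=> //.
- by move=> f j fS jp; apply: a3 => //; apply: leq_trans pp.
by move=> u uG u0 u1; apply: leq_trans (a6 u uG u0 u1) rr.
Qed.

Lemma dfs_same r p e k s s' : upto dregs dfields k s s' -> fl s' fND =1 fl s fND ->
  (forall f j, f \in [:: fSG; fSI; fSA] -> j < p -> fl s' f j = fl s f j) ->
  ndok s -> rg s' 0 <= rg s 0 + e -> dfs_rel r p e k s s'.
Proof.
move=> U E ES ok N.
have Ed : done s' = done s by rewrite /done_wt; apply: eq_bigl => u /=; rewrite E.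
split; rewrite ?Ed ?subnn ?muln0 ?add0n //.
- move=> v vG; rewrite E => /(ok v vG)[rc [t gt [rt tN]]]; split=> //.
  exists t => //; split; first exact: nrep_upto U rt tN.
  by apply: leq_trans tN _; case: U.
- by move=> u uG; rewrite E.
- by move=> u uG u0; rewrite E u0.
lia.
Qed.

Lemma dfs_refl r p s : ndok s -> dfs_rel r p 0 0 s s.
Proof. by move=> ok; apply: dfs_same => //; [exact: upto_refl|rewrite addn0]. Qed.

(** The weight of [v] becomes available when [v] is finished and covers the debts [k] and [e]. *)
Lemma dfs_store p e k k' s0 s s' v x t : dfs_rel (rk v) p e k s0 s ->
  v < G -> nd s v = 0 -> x != 0 ->
  upto dregs dfields k' s s' -> fl s' fND =1 upd (fl s fND) v x -> k + k' <= 200 * gwt v ->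
  (forall f j, f \in [:: fSG; fSI; fSA] -> j < p -> fl s' f j = fl s f j) ->
  reach C v (outg C) -> grepr w C v t -> stored s' x t ->
  rg s' 0 + e <= rg s 0 + gwt v -> dfs_rel (rk v).+1 p 0 0 s0 s'.
Proof.
move=> [a1 a2 a3 ok a5 a6 a7] vG v0 x0 U E kk ES rc gt st N.
have Ed : done s' = done s + gwt v.
  by rewrite -(done_set _ vG v0 x0) /done_wt; apply: eq_bigl => u; rewrite E.
split; rewrite ?Ed ?addn0.
- apply: (upto_seq U) a1 => //.
  rewrite -addnA; have -> : done s + gwt v - done s0 = done s - done s0 + gwt v by lia.
  by rewrite mulnDr leq_add2l.
- by lia.
- by move=> f j fS jp; rewrite ES ?a3.
- move=> u uG; rewrite E /=; case: (u =P v) => [-> _|ne]; first by split=> //; exists t.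
  move=> /(ok u uG)[rc' [t' gt' [rt' tN']]]; split=> //.
  exists t' => //; split; first exact: nrep_upto U rt' tN'.
  by apply: leq_trans tN' _; case: U.
- by move=> u uG /(a5 u uG); rewrite E /=; case: (u =P v).
- move=> u uG u0; rewrite E /=; case: (u =P v) => [E'|ne u1]; first by rewrite E'.
  by apply: leqW; apply: a6.
lia.
Qed.

Definition c_inner :=
  If (CLt 6 5)
    (Add 7 3 6;; AddK 7 7 2;; Inp 7 7;; Ld 8 fND 7;; If (CNz 8) c_edge c_enter)
    (Ld 10 fSA 1;; c_leave).

Lemma wp_dfs_inner v p s (Q : hst -> Prop) : v < G -> inner v ->
  rg s 1 = p -> 0 < p -> fl s fSG p = v ->
  (forall s1, upto [:: 2; 3; 4; 5; 6] [::] 9 s s1 -> fl s1 = fl s -> ag s1 = ag s ->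
     rg s1 2 = v -> rg s1 3 = nth 0 input (v + 2) -> rg s1 4 = kind v -> rg s1 5 = deg v ->
     rg s1 6 = fl s fSI p ->
     WP c_inner (fun s' => WP c_dfs_loop Q (tick (tick s'))) s1) ->
  WP c_dfs_loop Q s.
Proof.
move=> vG iv E1 p0 Ev H; rewrite /c_dfs_loop; apply: (wp_while V4 HB) => /=.
have -> /= : rg s 1 != 0 by lia.
have [e0 e1 e2 e3] := encode_inner vG iv; have GS := encode_size C; rewrite -Einp in GS.
rewrite /c_dfs_step; do 4 (wstep; simpl); rewrite E1 Ev; first by lia.
do 5 (wstep; simpl); rewrite e0.
have -> /= : kind v != 0 by move: iv; rewrite /inner /kind; case: gate_at.
do 2 (wstep; simpl); first by lia.
do 4 (wstep; simpl); rewrite e1 E1.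
apply: H => //.
by uptac; exact: upto_refl.
Qed.

Lemma wp_dfs_leaf v p x d s (Q : hst -> Prop) : v < G -> gate_at C v = GInp x d ->
  rg s 1 = p -> 0 < p -> p <= G -> fl s fSG p = v -> (rg s 0).+1 < V -> 0 < rg s 0 ->
  nd s v = 0 -> ndok s -> reach C v (outg C) ->
  (forall s', dfs_rel (rk v).+1 p 0 0 s s' -> rg s' 1 = p.-1 -> nd s' v != 0 ->
     WP c_dfs_loop Q s') ->
  WP c_dfs_loop Q s.
Proof.
move=> vG Eg E1 p0 pG Ev N1 N0 nv ok rc HQ; rewrite {1}/c_dfs_loop; apply: (wp_while V4 HB) => /=.
have -> /= : rg s 1 != 0 by lia.
have GS := encode_size C; rewrite -Einp in GS.
have H := encode_gate vG; rewrite -Einp Eg in H.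
have [h0 h0'] := H 0 isT; have [h1 h1'] := H 1 isT; have [h2 h2'] := H 2 isT.
rewrite /= ?addn0 in h0 h0' h1 h1' h2 h2'.
rewrite /c_dfs_step; do 4 (wstep; simpl); rewrite E1 Ev; first by lia.
do 5 (wstep; simpl); rewrite h0 /=.
do 2 (wstep; simpl); first by lia.
do 2 (wstep; simpl); first by lia.
do 5 (wstep; simpl); rewrite h1 h2.
have dV : d.+1 < V by rewrite -h2.
apply: (wp_c_leaf _ V4 HB (x := x) (d := d)) => //= s1 U1 N1' E12 rt.
have E11 : rg s1 1 = p by rewrite (upto_rg' U1).
have E21 : rg s1 2 = v by rewrite (upto_rg' U1).
rewrite /c_leave; do 7 (wstep; simpl); rewrite E12 E11 E21 subn1.
match goal with |- wp _ _ _ _ _ _ _ ?x => set s2 := x end.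
have U2 : upto dregs dfields 40 s s2.
  rewrite /s2; uptac.
  apply: (upto_seq (k1 := 15) U1) => //; uptac; exact: upto_refl.
have [_ u2 _ _ _ _] := U1.
apply: HQ => //; last by rewrite /= eqxx -lt0n.
apply: (dfs_store (dfs_refl _ _ ok) vG nv _ U2 (x := rg s 0) (t := TLeaf x d)) => //.
- by rewrite -lt0n.
- by move=> u; rewrite /= u2.
- by rewrite /gwt; lia.
- by move=> f j; rewrite !inE => /or3P[] /eqP -> _; rewrite /= u2.
- exact: grepr_leaf.
- by split; [exact: rt|rewrite /= N1'].
by rewrite /= N1' /gwt; lia.
Qed.

Lemma stored_upto L Fs k s s1 i t : upto L Fs k s s1 -> stored s i t -> stored s1 i t.
Proof.
move=> U [h1 h2]; split; first exact: nrep_upto U h1 h2.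
by apply: leq_trans h2 _; case: U.
Qed.

(** The first [i] inputs have been folded into the accumulator of the frame, which is 0 before the
    first one. *)
Definition acc_ok (s : hst) v p i :=
  if i == 0 then fl s fSA p = 0
  else exists2 t, prep v (take i (edges C v)) t & stored s (fl s fSA p) t.

Lemma acc_upto L Fs k s s1 v p i : upto L Fs k s s1 -> fl s1 fSA p = fl s fSA p ->
  acc_ok s v p i -> acc_ok s1 v p i.
Proof.
move=> U E; rewrite /acc_ok E; case: eqP => // _ [t h1 h2]; exists t => //.
exact: stored_upto U h2.
Qed.

Lemma prep1 v u t : inner v -> grepr w C u t -> prep v [:: u] t.
Proof.
by rewrite /inner /prep; case: gate_at => // s _ g; [exact: orepr1|exact: arepr1].
Qed.

Lemma prep_all v t : v < G -> prep v (edges C v) t -> grepr w C v t.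
Proof.
move=> vG; rewrite /prep /edges; have := edges_ne vG; rewrite /edges.
by case E: (gate_at C v) => [x d|s|s] //= ne h;
  [exact: (grepr_or smo E ne h)|exact: (grepr_and E ne h)].
Qed.

Lemma nth_take_notin (T : eqType) (x0 : T) (l : seq T) i : uniq l -> i < size l ->
  nth x0 l i \notin take i l.
Proof.
move=> ul il; rewrite -(cat_take_drop i l) cat_uniq (drop_nth x0 il) /= in ul.
by case/and3P: ul => _ /norP[].
Qed.

Lemma prep_step v i a b t : v < G -> 0 < i < deg v -> prep v (take i (edges C v)) a ->
  grepr w C (nth 0 (edges C v) i) b ->
  (kind v = 1 /\ orpair w a b t) \/ (kind v = 2 /\ t = TAnd a b) ->
  prep v (take i.+1 (edges C v)) t.
Proof.
move=> vG /andP[i0 ideg] pa gb ht; rewrite (take_nth 0) //.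
have ui := nth_take_notin 0 (edges_uniq vG) ideg.
have mu := mem_nth 0 ideg; have sub := @mem_take i _ (edges C v).
have ne : take i (edges C v) <> [::].
  by move=> E; have := size_takel (ltnW ideg); rewrite E /=; lia.
move: pa ht ui mu sub ne gb; rewrite /prep /kind /edges.
case E: (gate_at C v) => [x d|s|s] //= pa ht ui mu sub ne gb.
  case: ht => [[_ ht]|[]//]; exact: (orepr_rcons smo det E sub mu ne ui pa gb ht).
by case: ht => [[]//|[_ ->]]; exact: (arepr_rcons dec E sub mu ui pa gb).
Qed.

(* The frame [p] of the stack is about to process the input number [i] of [v]. *)
Definition frame (s : hst) v p i :=
  [/\ rg s 1 = p, fl s fSG p = v, fl s fSI p = i & acc_ok s v p i].

Lemma wp_leave v p s0 s (Q : hst -> Prop) : v < G -> inner v -> 0 < p ->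
  frame s v p (deg v) -> dfs_rel (rk v) p (deg v) (200 * deg v) s0 s -> nd s v = 0 ->
  reach C v (outg C) ->
  (forall s', dfs_rel (rk v).+1 p 0 0 s0 s' -> rg s' 1 = p.-1 -> nd s' v != 0 ->
     WP c_dfs_loop Q s') ->
  WP c_dfs_loop Q s.
Proof.
move=> vG iv p0 [E1 Ev Ei Ea] D nv rc HQ.
apply: (wp_dfs_inner vG iv E1 p0 Ev) => s1 U1 Ef1 Ea1 E12 E13 E14 E15 E16.
have E11 : rg s1 1 = p by rewrite (upto_rg' U1).
have d0 : deg v != 0.
  have := edges_ne vG; rewrite /edges; move: iv; rewrite /inner.
  by case: gate_at => // -[].
move: Ea; rewrite /acc_ok (negbTE d0) take_size => -[t pt st].
rewrite /c_inner; wstep; simpl; rewrite E15 E16 Ei ltnn.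
rewrite /c_leave; do 7 (wstep; simpl); rewrite E11 E12 Ef1 subn1.
match goal with |- wp _ _ _ _ _ _ _ ?x => set s2 := x end.
have U2 : upto dregs dfields 40 s s2.
  rewrite /s2; uptac.
  by apply: (upto_seq (k1 := 0) U1) => //; exact: upto_refl.
apply: HQ => //=; last first.
  by rewrite eqxx -lt0n; case: st => rt _; exact: nrep_gt0 rt.
apply: (dfs_store D vG nv _ U2 (x := fl s fSA p) (t := t)) => //.
- by case: st => rt _; rewrite -lt0n; exact: nrep_gt0 rt.
- by move=> u; rewrite /= Ef1.
- by rewrite /gwt; lia.
- by move=> f j; rewrite !inE => /or3P[] /eqP -> _; rewrite /= Ef1.
- exact: prep_all.
- exact: stored_upto U2 st.
by rewrite /= (upto_rg' U1) // /gwt; lia.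
Qed.

Lemma wp_enter v p i s (Q : hst -> Prop) : v < G -> inner v -> 0 < p -> i < deg v ->
  p.+1 < V -> frame s v p i -> nd s (nth 0 (edges C v) i) = 0 -> ndok s ->
  (forall s', dfs_rel (rk v) p.+1 0 60 s s' -> frame s' (nth 0 (edges C v) i) p.+1 0 ->
     fl s' fND =1 fl s fND -> WP c_dfs_loop Q s') ->
  WP c_dfs_loop Q s.
Proof.
move=> vG iv p0 id pV [E1 Ev Ei Ea] nu ok HQ.
have [e0 e1 e2 e3] := encode_inner vG iv.
apply: (wp_dfs_inner vG iv E1 p0 Ev) => s1 U1 Ef1 Ea1 E12 E13 E14 E15 E16.
have E11 : rg s1 1 = p by rewrite (upto_rg' U1).
rewrite /c_inner; wstep; simpl; rewrite E15 E16 Ei id.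
do 2 (wstep; simpl); rewrite E13 E16 Ei; first by lia.
do 2 (wstep; simpl); first by lia.
do 5 (wstep; simpl); rewrite e2 // Ef1 nu /=.
rewrite /c_enter; do 2 (wstep; simpl); rewrite E11 addn1; first by lia.
do 7 (wstep; simpl).
match goal with |- wp _ _ _ _ _ _ _ ?x => set s2 := x end.
have U2 : upto dregs dfields 60 s s2.
  rewrite /s2; uptac.
  by apply: (upto_seq (k1 := 0) U1) => //; exact: upto_refl.
apply: HQ.
  apply: (dfs_same _ U2) => //.
  - by move=> u; rewrite /= Ef1.
  - by move=> f j; rewrite !inE => /or3P[] /eqP -> jp; rewrite /= Ef1 ltn_eqF.
  by rewrite /= (upto_rg' U1) // addn0.
  by split; rewrite /= ?eqxx // /acc_ok /= eqxx.
by move=> x; rewrite /= Ef1.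
Qed.

Lemma wp_edge v p i s (Q : hst -> Prop) : v < G -> inner v -> 0 < p -> i < deg v ->
  (rg s 0).+1 < V -> 0 < rg s 0 ->
  frame s v p i -> nd s (nth 0 (edges C v) i) != 0 -> ndok s ->
  (forall s', dfs_rel (rk v) p 1 130 s s' -> frame s' v p i.+1 -> WP c_dfs_loop Q s') ->
  WP c_dfs_loop Q s.
Proof.
move=> vG iv p0 id NV N0 [E1 Ev Ei Ea] nu ok HQ.
have [e0 e1 e2 e3] := encode_inner vG iv.
apply: (wp_dfs_inner vG iv E1 p0 Ev) => s1 U1 Ef1 Ea1 E12 E13 E14 E15 E16.
have E11 : rg s1 1 = p by rewrite (upto_rg' U1).
have E10 : rg s1 0 = rg s 0 by rewrite (upto_rg' U1).
rewrite /c_inner; wstep; simpl; rewrite E15 E16 Ei id.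
do 2 (wstep; simpl); rewrite E13 E16 Ei; first by lia.
do 2 (wstep; simpl); first by lia.
set u := nth 0 (edges C v) i in nu HQ e2.
do 5 (wstep; simpl); rewrite e2 // Ef1 nu /=.
have uG : u < G by apply: (edges_lt vG); exact: mem_nth.
have [_ [b gb [rb bN]]] := ok u uG nu.
rewrite /c_edge; do 4 (wstep; simpl); rewrite E11 Ef1.
set fin := (forall s2 k, upto dregs dfields k s s2 -> k <= 120 -> rg s2 6 = i -> rg s2 1 = p ->
   fl s2 fND =1 fl s fND -> fl s2 fSG =1 fl s fSG -> fl s2 fSI =1 fl s fSI ->
   (forall j, j < p -> fl s2 fSA j = fl s fSA j) -> rg s2 0 <= rg s 0 + 1 ->
   acc_ok s2 v p i.+1 ->
   WP (AddK 6 6 1;; St fSI 1 6) (fun s' => WP c_dfs_loop Q (tick (tick (tick (tick s'))))) s2).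
have Hfin : fin.
  move=> s2 k U2 k120 E26 E21 En Eg Es Eacc N2 acc.
  do 2 (wstep; simpl); rewrite E26 ?E21; first by lia.
  wstep; simpl; rewrite E21 addn1.
  apply: HQ.
    apply: dfs_same => //=.
    - by apply: (upto_le_tm (k := k + 6)); [rewrite addnC; uptac|lia].
    - move=> f j; rewrite !inE => /or3P[] /eqP -> jp /=; rewrite ?Eg ?(ltn_eqF jp) ?Es //.
      exact: Eacc.
  split=> //=; rewrite ?Eg ?eqxx //.
  by apply: (acc_upto (L := [:: 6]) (Fs := [:: fSI]) (k := 10) _ _ acc) => //;
    uptac; exact: upto_refl.
case: (i =P 0) => [i0|/eqP i0].
  rewrite i0 in Ea; rewrite Ea /=; wstep; simpl; rewrite E11.
  match goal with |- wp _ _ _ _ _ _ _ ?x => set s2 := x end.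
  have U2 : upto dregs dfields 40 s s2.
    rewrite /s2; uptac.
    by apply: (upto_seq (k1 := 0) U1) => //; exact: upto_refl.
  apply: (Hfin s2 40 U2) => //.
  - by rewrite i0 /=  E16 Ei i0.
  - by move=> j; rewrite /= Ef1.
  - by move=> j; rewrite /= Ef1.
  - by move=> j; rewrite /= Ef1.
  - by move=> j jp; rewrite /= Ef1 ltn_eqF.
  - by rewrite /= E10 leq_addr.
  rewrite i0 /acc_ok /= eqxx; exists b; last exact: (stored_upto U2 (conj rb bN)).
  rewrite (take_nth 0) ?take0 /=; last by rewrite i0 in id.
  by have := prep1 iv gb; rewrite /u i0.
have := Ea; rewrite /acc_ok (negbTE i0) => -[a pa [ra aN]].
have -> /= : fl s fSA p != 0 by rewrite -lt0n; exact: nrep_gt0 ra.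
do 5 (wstep; simpl).
match goal with |- wp _ _ _ _ _ _ _ ?x => set s3 := x end.
have U3 : upto dregs dfields 40 s s3.
  rewrite /s3; uptac.
  by apply: (upto_seq (k1 := 0) U1) => //; exact: upto_refl.
have E30 : rg s3 0 = rg s 0 by rewrite /= (upto_rg' U1).
have ra3 : nrep w (fl s3) (ag s3) a (rg s3 13) by rewrite /= Ef1 Ea1.
have rb3 : nrep w (fl s3) (ag s3) b (rg s3 14) by rewrite /= Ef1 Ea1.
have E34 : rg s3 4 = kind v by [].
have E36 : rg s3 6 = i by rewrite /= E16.
have node s4 t : upto [:: 0; 12; 15; 16; 17; 18; 19; 20; 21; 22; 23; 24; 25; 26; 27; 28]
      [::] 62 s3 s4 -> rg s4 0 = (rg s 0).+1 -> rg s4 12 = rg s 0 ->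
    nrep w (fl s4) (ag s4) t (rg s 0) ->
    (kind v = 1 /\ orpair w a b t) \/ (kind v = 2 /\ t = TAnd a b) ->
    WP (St fSA 1 12) (fun s' => WP (AddK 6 6 1;; St fSI 1 6)
      (fun s'0 => WP c_dfs_loop Q (tick (tick (tick (tick s'0))))) (tick s')) s4.
  move=> U4 N4 E412 rt ht; have [_ u4 _ _ _ _] := U4.
  have E41 : rg s4 1 = p by rewrite (upto_rg' U4).
  wstep; rewrite E41 E412; set s5 := tick _.
  have U5 : upto dregs dfields 110 s s5.
    by rewrite /s5; uptac; apply: (upto_seq (k1 := 40) U4).
  apply: (Hfin s5 110 U5) => //.
  - by rewrite /= (upto_rg' U4).
  - by move=> j; rewrite /= u4 //= Ef1.
  - by move=> j; rewrite /= u4 //= Ef1.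
  - by move=> j; rewrite /= u4 //= Ef1.
  - by move=> j jp; rewrite /= ltn_eqF // u4 //= Ef1.
  - by rewrite /= N4 addn1.
  rewrite /acc_ok /= eqxx; exists t.
    by apply: prep_step pa gb ht => //; rewrite lt0n i0.
  have U45 : upto [::] [:: fSA] 10 s4 s5 by rewrite /s5; uptac; exact: upto_refl.
  by apply: (stored_upto U45); split=> //; rewrite N4.
wstep; rewrite [evc _ _ _]/=; rewrite E14.
move: iv; rewrite /inner; case Eg: (gate_at C v) => [//|l|l] _; rewrite {1}/kind Eg /=.
  apply: (wp_c_or _ V4 HB (a := a) (b := b)) => //.
  - by rewrite /= E10; lia.
  - move=> t [[-> _]|[-> _]]; rewrite /depth /=.
      by have [_] := nrep_sub ra (leqnn _); rewrite /depth; lia.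
    by have [_] := nrep_sub rb (leqnn _); rewrite /depth; lia.
  - by rewrite /= E10.
  - by rewrite /= E14 /kind Eg.
  - by rewrite /= E10.
  - by rewrite /= E10.
  move=> s4 t ht U4 N4 E12' rt; apply: (node (tick s4) t) => //.
  - apply: upto_tick; apply: (upto_seq (k1 := 1) U4) => //; uptac; exact: upto_refl.
  - by rewrite /= N4 /= E10.
  - by rewrite /= E12' /= E10.
  - by move: rt; rewrite /= E10.
  by left; rewrite /kind Eg.
apply: (wp_c_and _ V4 HB (a := a) (b := b)) => //.
- by rewrite /= E10; lia.
- by rewrite /= E10.
- by rewrite /= E14 /kind Eg.
- by rewrite /= E10.
- by rewrite /= E10.
move=> s4 U4 N4 E12' rt; apply: (node (tick s4) (TAnd a b)) => //.
- apply: upto_tick; apply: (upto_seq (k1 := 1) U4) => //; uptac; exact: upto_refl.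
- by rewrite /= N4 /= E10.
- by rewrite /= E12' /= E10.
- by move: rt; rewrite /= E10.
by right; rewrite /kind Eg.
Qed.

Lemma reach_trans a b c : reach C a b -> reach C b c -> reach C a c.
Proof. by move=> ab bc; elim: bc ab => // u x v _ IH xv ab; apply: reach_step (IH ab) xv. Qed.

(** Induction on the rank, with an inner one on the remaining inputs. Stack height plus rank stays
    within the number of gates, and objects plus outstanding weight within [X], which keeps all
    values below [V]. *)
Lemma wp_dfs_gate v p s (Q : hst -> Prop) : v < G -> 0 < p -> p + rk v <= G ->
  frame s v p 0 -> nd s v = 0 -> ndok s -> 0 < rg s 0 ->
  rg s 0 + left (rk v).+1 s <= X -> reach C v (outg C) ->
  (forall s', dfs_rel (rk v).+1 p 0 0 s s' -> rg s' 1 = p.-1 -> nd s' v != 0 ->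
     WP c_dfs_loop Q s') ->
  WP c_dfs_loop Q s.
Proof.
have [r] := ubnP (rk v); elim: r v p s Q => // r IH v p s Q rv vG p0 pG fr nv ok N0 NX rc HQ.
have GS := encode_size C; rewrite -Einp in GS.
have lft := @left_set G gwt rk (rk v).+1 (nd s) v vG nv (leqnn _).
have NX' : rg s 0 + left (rk v) s + gwt v <= X by lia.
have gE : gwt v = (deg v).+1 by [].
case iv: (inner v); last first.
  move: iv; rewrite /inner; case E: (gate_at C v) => [x d|//|//] _.
  case: fr => E1 Ev _ _; apply: (wp_dfs_leaf vG E E1 p0 _ Ev) => //; first by lia.
  by apply: leq_ltn_trans XV; lia.
suff loop k i s1 : i + k = deg v -> dfs_rel (rk v) p i (200 * i) s s1 ->
    frame s1 v p i -> WP c_dfs_loop Q s1.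
  by apply: (loop (deg v) 0) => //; exact: dfs_refl.
elim: k i s1 => [|k IHk] i s1 ik D1 f1.
  have ei : i = deg v by lia.
  rewrite ei in D1 f1; apply: (wp_leave vG iv p0 f1 D1) => //.
  apply/eqP; apply: contraT => h; have := dr_new D1 vG; rewrite nv eqxx => /(_ isT h).
  by rewrite ltnn.
have id : i < deg v by lia.
have ue := mem_nth 0 id; set u := nth 0 (edges C v) i in ue.
have uG := edges_lt vG ue; have ru := rk_lt vG ue.
have ok1 := dr_ok D1.
have [a1 a2 a3 a4 a5 a6 a7] := D1.
have dl := @done_left G gwt rk (rk v) (nd s) (nd s1) a5 a6.
have N1X : rg s1 0 + left (rk v) s1 < X by lia.
have N10 : 0 < rg s1 0 by case: a1 => _ _ h _ _ _; lia.
(* After a recursive visit the same input is examined again and is now found translated, so both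
   cases end with this step. *)
have adv s2 : dfs_rel (rk v) p i (200 * i + 60) s s2 -> frame s2 v p i -> nd s2 u != 0 ->
    WP c_dfs_loop Q s2.
  move=> D2 f2 nu; have [b1 b2 b3 b4 b5 b6 b7] := D2.
  have dl2 := @done_left G gwt rk (rk v) (nd s) (nd s2) b5 b6.
  apply: (wp_edge vG iv p0 id _ _ f2 nu b4).
  - by apply: leq_ltn_trans XV; lia.
  - by case: b1 => _ _ h _ _ _; lia.
  move=> s3 D3 f3; apply: (IHk i.+1 s3) => //; first by lia.
  by apply: (dfs_trans D2 D3); lia.
case nu: (nd s1 u == 0); last first.
  apply: adv => //; last by rewrite nu.
  by apply: (dfs_trans D1 (dfs_refl _ _ ok1)); lia.
apply: (wp_enter vG iv p0 id _ f1 _ ok1); [by lia|exact/eqP|].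
rewrite -/u => s2 D2 f2 n2; have [b1 b2 b3 b4 b5 b6 b7] := D2.
have Ed : done s2 = done s1 by rewrite /done_wt; apply: eq_bigl => x /=; rewrite n2.
have El : left (rk v) s2 = left (rk v) s1 by rewrite /left_wt; apply: eq_bigl => x /=; rewrite n2.
have lm := @left_mono G gwt rk _ _ (nd s2) ru.
have N20 : rg s1 0 <= rg s2 0 by case: b1.
apply: (IH u p.+1 s2) => //; try lia.
- by rewrite n2; exact/eqP.
- by apply: reach_trans rc; apply: reach_step ue; exact: reach_refl.
move=> s3 D3 E31 nu3; have [c1 _ c3 _ _ _ _] := D3.
apply: adv => //.
  apply: (@dfs_trans _ _ i 0 (200 * i + 60) 0) (dfs_weak ru (leqnSn p) D3) _ _ => //; try lia.
  by apply: (@dfs_trans _ _ i 0 (200 * i) 60) D1 (dfs_weak (leqnn _) (leqnSn p) D2) _ _; lia.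
case: f1 => E1 Ev Ei Ea; split=> //.
- by rewrite c3 ?b3.
- by rewrite c3 ?b3.
by apply: (acc_upto c1); rewrite ?c3 //; apply: (acc_upto b1); rewrite ?b3.
Qed.

Lemma reach_parent u v : reach C u v -> u = v \/ exists2 p, u \in edges C p & reach C p v.
Proof.
elim=> [a|a x b _ IH xb]; first by left.
right; case: IH => [->|[p h1 h2]]; first by exists b => //; exact: reach_refl.
by exists p => //; apply: reach_step h2 xb.
Qed.

Lemma reach_lt u v : v < G -> reach C u v -> u < G.
Proof. by move=> vG r; elim: r vG => // a x b _ IH xb bG; apply: IH; exact: edges_lt xb. Qed.

Lemma circuit_size_deg : circuit_size C = \sum_(u < G) deg u.
Proof.
rewrite /circuit_size (big_nth (GOr n m [::])) big_mkord; apply: eq_bigr => u _.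
by rewrite /edges.
Qed.

(** A translated gate is reachable, hence the output gate or an input of some gate: there are at
    most [circuit_size C + 1] of them. Gates that no edge touches are not paid for by the size. *)
Lemma done_le s : outg C < G -> ndok s -> done s <= 2 * circuit_size C + 1.
Proof.
move=> oG ok; have -> : done s = \sum_(u < G | nd s u != 0) deg u + \sum_(u < G | nd s u != 0) 1.
  by rewrite /done_wt -big_split /=; apply: eq_bigr => u _; rewrite addn1.
have h1 : \sum_(u < G | nd s u != 0) deg u <= circuit_size C.
  by rewrite circuit_size_deg big_mkcond leq_sum // => u _; case: ifP.
suff h2 : \sum_(u < G | nd s u != 0) 1 <= (circuit_size C).+1 by lia.
rewrite -(big_mkord (fun u => nd s u != 0) (fun=> 1)) sum1_count -size_filter.
have -> : (circuit_size C).+1 = size (outg C :: flatten [seq edges C v | v <- index_iota 0 G]).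
  rewrite /= size_flatten /shape -map_comp sumnE big_map circuit_size_deg.
  by rewrite -(big_mkord xpredT (fun u => deg u)).
apply: uniq_leq_size; first by rewrite filter_uniq // iota_uniq.
move=> u; rewrite mem_filter mem_index_iota /= => /andP[nu uG].
have [rc _] := ok u uG nu; rewrite inE.
case: (reach_parent rc) => [->|[p up rp]]; first by rewrite eqxx.
apply/orP; right; apply/flatten_mapP; exists p => //.
by rewrite mem_index_iota /=; exact: reach_lt rp.
Qed.

Lemma wp_dfs (Q : hst -> Prop) : outg C < G -> circuit_size C + G + 2 <= X ->
  (forall s' t, grepr w C (outg C) t -> nrep w (fl s') (ag s') t (rg s' 44) ->
     rg s' 44 < rg s' 0 -> (forall i, fl s' fT i = 0) -> tr s' = [::] ->
     tm s' <= 400 * circuit_size C + 300 -> rg s' 0 <= 2 * circuit_size C + 3 -> Q s') ->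
  WP c_dfs Q (hst0 n m).
Proof.
move=> oG EX HQ; have GS := encode_size C; rewrite -Einp in GS.
rewrite /c_dfs; have Er : nth 0 input 1 = outg C by rewrite Einp encode_root.
do 10 (wstep; simpl); rewrite Er; wstep.
match goal with |- wp _ _ _ _ _ _ _ ?x => set s1 := x end.
have nd0 u : nd s1 u = 0 by [].
have ok1 : ndok s1 by move=> u uG; rewrite nd0.
have d0 : done s1 = 0 by rewrite /done_wt big1 // => u.
have l0 : left (rk (outg C)).+1 s1 <= circuit_size C + G.
  have -> : circuit_size C + G = \sum_(u < G) gwt u.
    rewrite circuit_size_deg -[X in _ + X]card_ord -sum1_card -big_split /=.
    by apply: eq_bigr => u _; rewrite addn1.
  by rewrite /left_wt big_mkcond leq_sum // => u _; case: ifP.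
apply: (@wp_dfs_gate (outg C) 1 s1) => //.
- by rewrite add1n; exact: rk_le.
- by have -> : rg s1 0 = 1 by []; move: (left _ _) l0 EX => z; lia.
- exact: reach_refl.
move=> s2 [c1 c2 c3 c4 c5 c6 c7] E21 n2; rewrite d0 subn0 in c1 c2 c7.
have dl := done_le oG c4.
rewrite /c_dfs_loop; apply: (wp_while V4 HB); rewrite /= E21 /=.
do 5 (wstep; simpl); rewrite Er.
have [_ [t gt [rt tN]]] := c4 _ oG n2.
have [_ u2 _ _ u5 u6] := c1.
apply: (HQ _ t) => //=.
- by move=> i; rewrite u2.
- by rewrite /= in u6; lia.
by rewrite /= in c7; lia.
Qed.

End Search.

(** * Enumeration *)

Section Emission.
Variables (n m : nat) (R : realType) (w : passign n m -> R).
Variable t : tree n m.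
Implicit Types (O : seq (passign n m)) (S : passign n m -> nat).

Lemma msem_some t' tau x : wft w t' -> msem t' tau -> x \in vars t' -> tau x != None.
Proof.
elim: t' => [y d|a IHa b IHb|a IHa b IHb] /=.
- by move=> _ /eqP E; rewrite inE => /eqP ->; rewrite E.
- by case=> wa wb E _ _ /orP[/(IHa wa)|/(IHb wb)] h; rewrite ?E // -E; apply: h.
by case=> wa wb _ /andP[/(IHa wa) ha /(IHb wb) hb]; rewrite inE => /orP[].
Qed.

(* [O] has been emitted, and [S] counts what is still to come. *)
Definition emitted O S :=
  [/\ forall tau, count_mem tau O + S tau = msem t tau,
      sorted (fun a b => (w b <= w a)%R) O
    & forall o tau, o \in O -> 0 < S tau -> (w tau <= w o)%R].

(** Bounds the number of outputs, and thereby the memory ever used. *)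
Definition nsol := #|[pred tau : passign n m | msem t tau]|.

Lemma emitted_msem O S tau : emitted O S -> tau \in O -> msem t tau.
Proof.
by case=> /(_ tau) + _ _; rewrite -has_pred1 has_count => h h1; move: h; case: msem => //; lia.
Qed.

Lemma emitted_uniq O S : emitted O S -> uniq O.
Proof.
move=> e; apply: count_mem_uniq => tau; case: (boolP (tau \in O)) => h /=; last first.
  by apply/count_memPn.
have := emitted_msem e h; case: e => /(_ tau) + _ _.
move: h; rewrite -has_pred1 has_count; case: msem => //=; set c := count _ _; lia.
Qed.

Lemma emitted_size O S : emitted O S -> size O <= nsol.
Proof.
move=> e; rewrite -(card_uniqP (emitted_uniq e)); apply: subset_leq_card.
by apply/subsetP => tau /(emitted_msem e).
Qed.

Lemma emitted_ext O S S' : (forall tau, S tau = S' tau) -> emitted O S -> emitted O S'.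
Proof.
by move=> E [h1 h2 h3]; split=> // [tau|o tau]; rewrite -E; [apply: h1|apply: h3].
Qed.

Lemma emitted_rcons O S S' o : emitted O S -> (forall tau, S' tau + (tau == o) = S tau) ->
  (forall tau, 0 < S tau -> (w tau <= w o)%R) -> emitted (rcons O o) S'.
Proof.
move=> [h1 h2 h3] ES So; have So0 : 0 < S o by rewrite -ES eqxx addn1.
split=> [tau||o' tau].
- by rewrite -cats1 count_cat /= addn0 -h1 -ES (eq_sym o) -addnA (addnC _ (S' tau)).
- case: (O) h2 h3 => //= x O' h2 h3; rewrite rcons_path h2 /=; apply: h3 => //.
  exact: mem_last.
rewrite mem_rcons inE => /orP[/eqP ->|oO] St.
  by apply: So; rewrite -ES; lia.
by apply: h3 => //; rewrite -ES; lia.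
Qed.

End Emission.

(** * Buffering, output and pacing *)

Section Enumeration.
Variables (n m : nat) (R : realType).
Variables (P : seq instr) (B V : nat) (input : seq nat) (w : passign n m -> R).
Hypothesis V4 : 4 <= V.
Hypothesis HB : obase n + V.+1 * width n <= B.
Hypothesis HI : forall i, nth 0 input i < V.
Hypothesis mono : subset_monotone w.
Local Notation WP := (wp P B V input w).
Local Notation hst := (hst n m).
Implicit Types (O : seq (passign n m)) (S : passign n m -> nat).

Variable t : tree n m.
Hypothesis wt : wft w t.
Hypothesis vT : vars t = setT.
Local Notation emitted := (emitted w t).
Local Notation nsol := (nsol t).

Lemma okl_pend ps (al : passign n m) : okl w ps al -> pend ps al.
Proof.
elim: ps => //= p ps IH [wp _ E /IH h]; rewrite /pend /= -/(pend ps al) h andbT.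
by rewrite (msem_ext wp E) (best_msem wp).
Qed.

(** A queued subproblem contains its own maximum; so the queue is nonempty only if some assignment
    is still to come. *)
Lemma recok_gt0 N F G r Y os ps : recok w N F G r Y os ps -> 0 < Dc Y os ps (G r) (G r).
Proof.
move=> [t' [k [j [_ [wt' _] [/andP[_ kd] jk] _ [Eo _ ok]]]]].
rewrite /Dc muln_gt0 lt0b -has_count; apply/andP; split; last first.
  by case: ok => _ _ _ /okl_pend -> /=; apply/agree_outP.
have js : j < size os by rewrite Eo size_takel.
apply/(has_nthP t'); exists j => //; case: ok => wo _ E _.
by rewrite (msem_ext wo E) (best_msem wo).
Qed.

Lemma PQ_root s S : PQ w s S ->
  if fl s fT (rg s 30) == 0 then forall tau, S tau = 0
  else fl s fT (rg s 30) < rg s 0 /\ 0 < S (ag s (fl s fT (rg s 30))).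
Proof.
move=> [h [H [D [[q1 q2 [t1 t2 t3] q4 q5] ES]]]].
have -> : fl s fT (rg s 30) = fl s fT (tix h 0) by rewrite q1 /tix muln1.
have := t2 h 0 (leqnn _); rewrite /bestof /cell; case: eqP => [_|_] hb; last first.
  case: hb => /andP[rH _] _; have [rN [Y [os [ps [ok E]]]]] := q5 _ rH; split=> //.
  by rewrite ES (perm_big _ (perm_to_rem rH)) big_cons addn_gt0 E (recok_gt0 ok).
move=> tau; rewrite ES big_seq big1 // => r rH; have := hb r.
have /andP[_ rh] := t1 r rH.
by rewrite divn_small // eqxx andbT => /negP.
Qed.

Lemma PQ_congr s s' S : rg s' 0 = rg s 0 -> rg s' 30 = rg s 30 -> fl s' = fl s ->
  ag s' = ag s -> PQ w s S -> PQ w s' S.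
Proof.
move=> E1 E2 E3 E4 [h [H [D [q ES]]]]; exists h, H, D; split=> //.
by move: q; rewrite /queue E1 E2 E3 E4.
Qed.

Definition popcost k := 2 * n * (pushcost k + 24) + 3 * pushcost k + 60.
Definition popregs := descregs ++ [:: 53; 54].

Lemma wp_pop_emit k S O s (Q : hst -> Prop) :
  rg s 44 = fl s fT (rg s 30) -> rg s 44 != 0 ->
  8 * (rg s 0 + 4 * n + 3) <= V -> rg s 0 + 4 * n + 2 < 2 ^ k -> 0 < rg s 0 ->
  PQ w s S -> emitted O S ->
  (forall s' S', upto popregs [:: fT] (popcost k) s s' ->
     rg s' 0 <= rg s 0 + 4 * n + 2 -> PQ w s' S' ->
     emitted (rcons O (ag s (rg s 44))) S' -> Q s') ->
  WP c_pop Q s.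
Proof.
move=> E44 r0 hV hK N0 pq em HQ.
apply: (wp_pop _ V4 HB mono (CM := rg s 0 + 4 * n + 2) (K := k) (W := 2 * n) (S := S)
  _ _ (erefl _)) => //; try lia.
move=> s' S' U N' pq' E1 E2; apply: HQ U _ pq' _; first by lia.
exact: emitted_rcons em E1 E2.
Qed.

Lemma wp_root s (Q : hst -> Prop) : 0 < rg s 0 -> rg s 0 * rg s 0 < V ->
  (forall s', upto [:: 60; 63] [::] (4 * rg s' 60 + 3) s s' -> 0 < rg s' 60 ->
     rg s' 60 <= rg s 0 ->
     rg s 0 <= rg s' 60 * rg s' 60 -> (rg s' 60).-1 * (rg s' 60).-1 < rg s 0 -> Q s') ->
  WP c_root Q s.
Proof.
move=> N0 NV HQ; rewrite /c_root; do 4 (wstep; simpl).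
set N := rg s 0 in N0 NV HQ *.
suff loop k s1 : rg s1 60 + k = N ->
    upto [:: 60; 63] [::] (4 * rg s1 60 + 2) s s1 -> rg s1 63 = rg s1 60 * rg s1 60 ->
    (rg s1 60 = 0 \/ (rg s1 60).-1 * (rg s1 60).-1 < N) ->
    WP (While (CLt 63 0) (AddK 60 60 1;; Mul 63 60 60)) Q s1.
  by apply: (loop N) => //=; [uptac; exact: upto_refl|left].
elim: k s1 => [|k IH] s1 Ek U E63 pr; apply: (wp_while V4 HB) => /=;
  rewrite E63 (upto_rg' (x := 0) U) // -/N.
  rewrite addn0 in Ek; have h : N <= rg s1 60 * rg s1 60 by rewrite Ek leq_pmulr.
  rewrite ltnNge h /=; apply: HQ => //=; rewrite ?Ek //.
    by apply: (upto_le_tm (upto_tick U)); rewrite Ek; lia.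
  by rewrite Ek in pr; case: pr => // h0; rewrite h0 in N0.
set j := rg s1 60 in Ek pr *.
case: ltnP => jN /=.
  have jj : (j + 1) * (j + 1) < V.
    by apply: leq_ltn_trans NV; apply: leq_mul; lia.
  wstep; simpl; wstep; simpl; first by apply: leq_ltn_trans jj; rewrite leq_pmulr ?addn1.
  wstep; simpl; first by [].
  apply: IH => //=; first by lia.
    apply: (upto_le_tm (k := (4 * j + 2).+4)); last by rewrite -/j; lia.
    by uptac.
  by right; rewrite addn1.
apply: HQ => //=.
- by apply: (upto_le_tm (upto_tick U)); rewrite -/j; lia.
- by rewrite -/j; case: (j) jN N0 => //; lia.
- by rewrite -/j; lia.
by rewrite -/j; case: pr jN => // -> ; lia.
Qed.

(* Words of [logb k] bits hold the number of objects in use at the [k]-th output, as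
   the data structure built by the search has at most quadratic size in [k]. *)
Definition logb k := 4 * n + 3 + 2 * (trunc_log 2 k.+1).+1.

Lemma logb_gt k : (4 * n + 3) * (k * k) < 2 ^ logb k.
Proof.
have h : k < 2 ^ (trunc_log 2 k.+1).+1.
  by apply: ltn_trans (ltnSn k) _; rewrite trunc_log_ltn.
have E j : 2 ^ (2 * j) = 2 ^ j * 2 ^ j by rewrite mul2n -addnn expnD.
rewrite /logb expnD E; set a := 2 ^ (trunc_log _ _).+1 in h *.
have h2 : 4 * n + 3 < 2 ^ (4 * n + 3) by rewrite ltn_expl.
have h3 : 0 < a * a by rewrite muln_gt0; lia.
apply: leq_ltn_trans (_ : (4 * n + 3) * (a * a) < _); last by rewrite ltn_mul2r h3.
by rewrite leq_mul2l; apply/orP; right; apply: leq_mul; apply: ltnW.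
Qed.

Definition gapb k := popcost (logb k) + 10.

(** The first output is exempt, as its time counts as preprocessing. *)
Definition paced (ts : seq nat) :=
  forall k, 0 < k < size ts -> nth 0 ts k <= nth 0 ts k.-1 + gapb k.

Lemma paced_rcons ts u : paced ts ->
  (0 < size ts -> u <= last 0 ts + gapb (size ts)) -> paced (rcons ts u).
Proof.
move=> pt h k; rewrite size_rcons ltnS => /andP[k0].
rewrite leq_eqVlt => /orP[/eqP Ek|kt].
  have := h; rewrite -Ek => /(_ k0) hu; rewrite !nth_rcons -Ek ltnn eqxx.
  by rewrite ltn_predL k0 -(nth_last 0) -Ek in hu *.
by rewrite !nth_rcons kt (leq_ltn_trans (leq_pred _) kt); apply: pt; rewrite k0.
Qed.

(** The number of objects after the translation; every output adds at most [4 * n + 2] more. *)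
Variable M0 : nat.
Hypothesis MV : 8 * (M0 + (4 * n + 2) * nsol.+1 + 1) <= V.

Record final t0 (s : hst) : Prop := Final {
  final_emitted : emitted (map snd (tr s)) (fun=> 0);
  final_paced : paced (rcons (map fst (tr s)) (tm s));
  final_first : 0 < size (tr s) /\ nth 0 (map fst (tr s)) 0 <= t0 }.

(** Induction on the solutions not yet output. [M0 <= size (tr s) * size (tr s)] makes [logb k] bits
    enough for all objects, so that the cost of a pop is bounded in terms of the number of outputs
    alone. *)
Lemma wp_main_loop t0 s S (Q : hst -> Prop) :
  PQ w s S -> emitted (map snd (tr s)) S -> paced (map fst (tr s)) ->
  0 < size (tr s) -> nth 0 (map fst (tr s)) 0 <= t0 ->
  tm s + 2 <= last 0 (map fst (tr s)) + gapb (size (tr s)) ->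
  rg s 44 = fl s fT (rg s 30) -> 0 < rg s 0 ->
  rg s 0 <= M0 + (4 * n + 2) * size (tr s) ->
  (rg s 44 != 0 -> M0 <= size (tr s) * size (tr s)) ->
  (forall s', final t0 s' -> Q s') -> WP c_main_loop Q s.
Proof.
move=> + + + + + + + + + + HQ.
have [z] := ubnP (nsol - size (tr s)); elim: z s S => // z IH s S hz pq em pc s0 f0 ht E44 N0 N1 hM.
apply: (wp_while V4 HB) => /=; case: eqP => E0 /=.
  apply: HQ; split=> //=.
  - apply: emitted_ext em; have := PQ_root pq; rewrite -E44 E0 eqxx => h tau; exact: h.
  by apply: paced_rcons => // _; rewrite size_map; lia.
move/eqP: E0 => r0; have {}hM := hM r0.
have [r44 So] : rg s 44 < rg s 0 /\ 0 < S (ag s (rg s 44)).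
  by have := PQ_root pq; rewrite -E44 (negbTE r0).
set k := (size (tr s)).+1.
have hk : rg s 0 + 4 * n + 2 < 2 ^ logb k.
  apply: leq_ltn_trans (logb_gt k); apply: (@leq_trans (M0 + (4 * n + 2) * k)).
    by rewrite /k mulnS; lia.
  have h1 : M0 <= k * k by apply: leq_trans hM _; rewrite /k leq_mul.
  have h2 : (4 * n + 2) * k <= (4 * n + 2) * (k * k) by rewrite leq_mul2l leq_pmulr ?orbT.
  by lia.
have ks : size (tr s) <= nsol by have := emitted_size em; rewrite size_map.
have hV : 8 * (rg s 0 + 4 * n + 3) <= V.
  have : (4 * n + 2) * size (tr s) <= (4 * n + 2) * nsol by rewrite leq_mul2l ks orbT.
  by lia.
have o_in : msem t (ag s (rg s 44)) by case: em => /(_ (ag s (rg s 44))); case: msem => //; lia.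
wstep; apply: (wp_out _ _ V4 HB).
  by move=> x; apply: (msem_some wt o_in); rewrite vT inE.
set o := ag (tick s) _.
wstep; apply: (@wp_pop_emit (logb k) S (map snd (tr s)) (outst (tick s) o)) => //=.
move=> s1 S1 U N' pq1 em1.
have tr1 : tr s1 = rcons (tr s) ((tm s).+2, o) by case: U.
wstep; simpl.
apply: (IH _ S1) => //=; rewrite ?tr1 ?size_rcons ?map_rcons //.
- by have := emitted_size em1; rewrite size_rcons size_map; lia.
- apply: paced_rcons => // _; rewrite size_map /=; lia.
- by rewrite nth_rcons size_map s0.
- rewrite last_rcons; have := upto_tm U; rewrite /= -/k /gapb; lia.
- exact: leq_trans N0 (upto_le U).
- by move: N'; rewrite /= mulnS; lia.
by move=> _; apply: leq_trans hM _; apply: leq_mul.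
Qed.

Definition buffered (s : hst) := [seq ag s (fl s fBUF i) | i <- iota 0 (rg s 61)].

Lemma wp_out_loop s (Q : hst -> Prop) : all (msem t) (buffered s) ->
  tr s = [::] -> rg s 62 = 0 -> 0 < rg s 61 -> rg s 61 < V ->
  (forall s', (forall x, x \notin [:: 62; 63] -> rg s' x = rg s x) -> fl s' = fl s ->
     ag s' = ag s -> map snd (tr s') = buffered s -> paced (map fst (tr s')) ->
     nth 0 (map fst (tr s')) 0 <= tm s + 3 ->
     tm s' <= last 0 (map fst (tr s')) + 3 -> Q s') ->
  WP c_out_loop Q s.
Proof.
move=> ok tr0 E62 b0 bV HQ; set b := rg s 61 in b0 bV.
set A := fun i => ag s (fl s fBUF i).
suff loop k s1 : rg s1 62 + k = b -> (forall x, x \notin [:: 62; 63] -> rg s1 x = rg s x) ->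
    fl s1 = fl s -> ag s1 = ag s -> map snd (tr s1) = [seq A i | i <- iota 0 (rg s1 62)] ->
    paced (map fst (tr s1)) ->
    (if rg s1 62 == 0 then tm s1 = tm s else nth 0 (map fst (tr s1)) 0 <= tm s + 3 /\
       tm s1 <= last 0 (map fst (tr s1)) + 2) -> WP c_out_loop Q s1.
  apply: (loop b) => //; rewrite ?E62 ?tr0 //.
  by move=> k /andP[_].
elim: k s1 => [|k IH] s1 Ek Er Ef Ea Et pc ht; apply: (wp_while V4 HB) => /=;
  rewrite (Er 61) // -/b.
  rewrite addn0 in Ek; rewrite Ek ltnn; rewrite Ek (gtn_eqF b0) in ht; case: ht => f0 ht.
  by apply: HQ => //=; [rewrite Et Ek|lia].
set j := rg s1 62 in Ek Et ht *.
have jb : j < b by lia.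
rewrite jb; wstep; wstep; simpl; wstep; apply: (wp_out _ _ V4 HB) => [x|]; simpl.
  apply: (msem_some wt); last by rewrite vT inE.
  rewrite Ea Ef; move/allP: ok; apply; apply/mapP; exists j => //.
  by rewrite mem_iota.
wstep; simpl; first by lia.
have szt : size (tr s1) = j by rewrite -(size_map snd) Et size_map size_iota.
apply: IH => //=.
- by lia.
- move=> x; rewrite !inE !negb_or => /andP[x1 x2]; rewrite (negbTE x1) (negbTE x2).
  by rewrite Er // !inE negb_or x1.
- by rewrite map_rcons Et iotaD map_cat cats1 /= Ea Ef.
- rewrite map_rcons; apply: paced_rcons => //; rewrite size_map szt => j0 /=.
  by rewrite (gtn_eqF j0) in ht; rewrite /gapb; lia.
rewrite addn1 /= map_rcons last_rcons /=; split; last by lia.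
rewrite nth_rcons size_map szt; case: (posnP j) ht => [-> /= ->|j0 []] //; lia.
Qed.

(** The loop stops early only on an empty queue, so a nonempty one at the end certifies that [z]
    outputs are buffered. *)
Lemma wp_buf_loop K z s S (Q : hst -> Prop) :
  rg s 61 <= z -> rg s 60 = z -> M0 + (4 * n + 2) * z.+1 < 2 ^ K ->
  PQ w s S -> emitted (buffered s) S -> (forall i, i < rg s 61 -> fl s fBUF i < rg s 0) ->
  tr s = [::] -> 0 < rg s 61 -> rg s 44 = fl s fT (rg s 30) -> 0 < rg s 0 ->
  rg s 0 <= M0 + (4 * n + 2) * rg s 61 ->
  (forall s' S', PQ w s' S' -> emitted (buffered s') S' ->
     tr s' = [::] -> 0 < rg s' 61 -> rg s' 44 = fl s' fT (rg s' 30) -> 0 < rg s' 0 ->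
     rg s' 0 <= M0 + (4 * n + 2) * rg s' 61 -> (rg s' 44 != 0 -> z <= rg s' 61) ->
     tm s' <= tm s + (z - rg s 61) * (popcost K + 10) + 5 -> Q s') ->
  WP c_buf_loop Q s.
Proof.
move=> + + hK; move Ek: (z - rg s 61) => k.
elim: k s S Ek => [|k IH] s S Ek jz Ez pq em bb tr0 j0 E44 N0 N1 HQ;
  apply: (wp_while V4 HB) => /=; rewrite Ez.
  rewrite ltnNge (_ : z <= rg s 61) /=; last by lia.
  by apply: (HQ _ S) => //=; lia.
have jz' : rg s 61 < z by lia.
rewrite jz' /=; wstep; rewrite /=; case: eqP => [E0|/eqP r0] /=.
  wstep; apply: (wp_while V4 HB); rewrite /= ltnn.
  apply: (HQ _ S) => //=; last by lia.
  by rewrite E0.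
have jn := emitted_size em; rewrite size_map size_iota in jn.
have [r44 So] : rg s 44 < rg s 0 /\ 0 < S (ag s (rg s 44)).
  by have := PQ_root pq; rewrite -E44 (negbTE r0).
have hj : (4 * n + 2) * rg s 61 <= (4 * n + 2) * nsol by rewrite leq_mul2l jn orbT.
have hz : (4 * n + 2) * (rg s 61).+2 <= (4 * n + 2) * z.+1 by rewrite leq_mul2l ltnS jz' orbT.
do 4 (wstep; simpl); first by lia.
match goal with |- wp _ _ _ _ _ _ _ ?x => set s0 := x end.
have U0 : upto [:: 61] [:: fBUF] 4 s s0 by rewrite /s0; uptac => //; exact: upto_refl.
wstep; apply: (@wp_pop_emit K S (buffered s)) => //; rewrite /s0 /=; try lia.
  exact: PQ_upto U0 _ _ pq.
rewrite -/s0; move=> s1 S1 U N' pq1 em1; wstep; simpl.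
have [u1 u2 u3 [_ u4] u5 u6] := U; have {}u3 : rg s 0 <= rg s1 0 := u3.
have {}u6 : tm s1 <= (tm s).+4 + popcost K := u6.
have E61 : rg s1 61 = (rg s 61).+1 by rewrite u1 //= addn1.
have Eb : fl s1 fBUF = upd (fl s fBUF) (rg s 61) (rg s 44) by rewrite u2.
apply: (IH _ S1) => //=; rewrite ?E61 ?Eb //=.
- by lia.
- by rewrite u1.
- move: em1; congr emitted.
  rewrite /buffered /= E61 -[(rg s 61).+1]addn1 iotaD map_cat cats1 Eb /= eqxx.
  rewrite u4 //; congr rcons; apply/eq_in_map => i; rewrite mem_iota => /= ib.
  by rewrite ltn_eqF // u4 //; apply: bb.
- move=> i; rewrite ltnS leq_eqVlt; case: eqP => /= [_ _|_ /bb]; lia.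
- by rewrite u5.
- by lia.
- by move: N'; rewrite /= mulnS; lia.
move=> s2 S2 h1 h2 h3 h4 h5 h6 h7 h8 h9; apply: (HQ _ S2) => //.
by move: h9; rewrite mulSn /=; lia.
Qed.

Definition bufcost K z := 2 * n * (pushcost K + 24) + z * (popcost K + 10) + 20.

Lemma wp_buffer K z s (Q : hst -> Prop) :
  nrep w (fl s) (ag s) t (rg s 44) -> rg s 44 < rg s 0 -> (forall i, fl s fT i = 0) ->
  tr s = [::] -> 0 < rg s 0 <= M0 -> rg s 60 = z -> 0 < z ->
  M0 + (4 * n + 2) * z.+1 < 2 ^ K ->
  (forall s' S', PQ w s' S' -> emitted (buffered s') S' ->
     tr s' = [::] -> 0 < rg s' 61 -> rg s' 44 = fl s' fT (rg s' 30) -> 0 < rg s' 0 ->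
     rg s' 0 <= M0 + (4 * n + 2) * rg s' 61 -> (rg s' 44 != 0 -> z <= rg s' 61) ->
     tm s' <= tm s + bufcost K z -> Q s') ->
  WP c_buffer Q s.
Proof.
move=> rt tN T0 tr0 /andP[N0 NM] Ez z0 hK HQ; rewrite /c_buffer.
do 12 (wstep; simpl).
match goal with |- wp _ _ _ _ _ _ _ ?x => set s0 := x end.
have U0 : upto [:: 30; 56; 59; 61] [:: fBUF] 6 s s0 by rewrite /s0; uptac => //; exact: upto_refl.
have Eal := nrep_best rt.
have ok : okl w [:: t] (ag s (rg s 44)).
  by rewrite Eal; split=> //; rewrite /pvars big_nil -setI_eq0 setI0.
have pq0 : PQ w s0 (fun=> 0).
  (* The empty queue has height 0 and uses the array [fT] as it was in the initial memory. *)
  exists 0, [::], (fun _ _ => 0); split; last by move=> tau; rewrite big_nil.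
  split=> //=; first by lia.
  by split=> // j q _; rewrite /bestof /s0 /= T0.
have Ect tau : Ec t [::] (ag s (rg s 44)) tau = msem t tau.
  rewrite /Ec /= vT (_ : agree_out _ _ _) ?andbT //; apply/agree_outP => x.
  by rewrite !inE.
wstep.
apply: (@wp_descend _ _ _ _ _ _ _ _ V4 HB (rg s 0 + 4 * n) K _ _ (2 * n) t [::] (fun=> 0)) => //.
all: try by rewrite /s0 /=; lia.
- exact: weight_le ok.
- exact: nrep_upto U0 rt tN.
move=> s1 S1 U N1 pq1 ES1; wstep; wstep.
have [u1 u2 u3 [_ u4] u5 u6] := U; have {}u3 : rg s 0 <= rg s1 0 := u3.
have {}u6 : tm s1 <= (tm s).+4.+2 + (2 * n * (pushcost K + 24) + 2) := u6.
have {}ES1 tau : S1 tau + (tau == ag s (rg s 44)) = msem t tau by rewrite -Ect -[RHS]add0n -ES1.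
have {}N1 : rg s1 0 <= rg s 0 + 2 * (2 * n) := N1.
have E61 : rg s1 61 = 1 by rewrite u1.
have Eb : fl s1 fBUF 0 = rg s 44 by rewrite u2.
(* The first output is the maximum of the whole tree, known without the queue. *)
have em1 : emitted [:: ag s (rg s 44)] S1.
  apply: (@emitted_rcons _ _ _ _ _ [::] (fun tau => msem t tau : nat)) => // tau.
  rewrite lt0b => st; apply: (Ec_opt mono ok); by rewrite Ect st.
apply: (@wp_buf_loop K z _ S1); rewrite /= ?E61 //.
- by rewrite u1.
- by rewrite /buffered /= E61 /= Eb u4.
- by case=> // _; rewrite Eb; lia.
- by rewrite u5.
- by lia.
- by lia.
move=> s2 S2 h1 h2 h3 h4 h5 h6 h7 h8 h9; apply: (HQ _ S2) => //; apply: leq_trans h9 _.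
have : (z - 1) * (popcost K + 10) <= z * (popcost K + 10) by rewrite leq_mul2r leq_subr orbT.
by rewrite /bufcost /=; lia.
Qed.

Lemma wp_enumerate s (Q : hst -> Prop) :
  nrep w (fl s) (ag s) t (rg s 44) -> rg s 44 < rg s 0 -> (forall i, fl s fT i = 0) ->
  tr s = [::] -> rg s 0 = M0 -> 0 < M0 -> M0 * M0 < V ->
  (forall s' z, z.-1 * z.-1 < M0 ->
     final (tm s + 4 * z + bufcost (logb z.+1) z + 10) s' -> Q s') ->
  WP (c_root;; c_buffer;; Const 62 0;; c_out_loop;; Ld 44 fT 30;; c_main_loop) Q s.
Proof.
move=> rt tN T0 tr0 E0 M00 MM HQ; wstep; apply: wp_root; rewrite ?E0 //.
move=> s1 U1 z0 zM Mz zz; set z := rg s1 60 in U1 z0 zM Mz zz.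
have [u1 u2 u3 u4 u5 u6] := U1.
have E01 : rg s1 0 = M0 by rewrite u1.
(* As [M0 <= z * z], the bits allotted to [z + 1] outputs cover all objects of the buffering
   phase. *)
have hK : M0 + (4 * n + 2) * z.+1 < 2 ^ logb z.+1.
  apply: leq_ltn_trans (logb_gt _).
  have h1 : z * z <= z.+1 * z.+1 by rewrite leq_mul.
  have h2 : (4 * n + 2) * z.+1 <= (4 * n + 2) * (z.+1 * z.+1) by rewrite leq_mul2l leq_pmulr ?orbT.
  by lia.
wstep; apply: (@wp_buffer (logb z.+1) z); rewrite ?u2 ?u5 ?E01 //.
- by rewrite u1 //; apply: nrep_upto U1 rt tN.
- by rewrite u1 // -E0.
- by rewrite M00 leqnn.
move=> s2 S2 pq2 em2 tr2 b0 E44 N0 N2 zb ht; do 3 wstep.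
have bs : rg s2 61 <= nsol by have := emitted_size em2; rewrite size_map size_iota.
apply: wp_out_loop => //=; first by apply/allP => tau; apply: emitted_msem em2.
  by lia.
move=> s3 Er Ef Ea Ebuf pc first_ last_; wstep; wstep.
have szt : size (tr s3) = rg s2 61 by rewrite -(size_map snd) Ebuf size_map size_iota.
apply: (@wp_main_loop (tm s + 4 * z + bufcost (logb z.+1) z + 10) _ S2) => //=; rewrite ?szt //.
- by apply: PQ_congr pq2; rewrite //= Er.
- by rewrite Ebuf.
- by rewrite /= in first_; lia.
- by rewrite /gapb; lia.
- by rewrite Er.
- by rewrite Er.
- rewrite Ef Er // -E44 => /zb zb'; apply: leq_trans Mz _; exact: leq_mul.
by move=> s4 fin; apply: HQ fin.
Qed.
End Enumeration.

(** * Bounds *)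

Lemma simt_times n m t T (r a : seq (nat * passign n m)) t' T' : simt t T r a t' T' ->
  map snd r = map snd a /\ forall k, k <= size r ->
    let x := nth 0 (t :: rcons (map fst r) t') in
    let X := nth 0 (T :: rcons (map fst a) T') in
    x k.+1 <= x k + KC n * (X k.+1 - X k).
Proof.
elim: r a t T => [|[t1 o] r IH] [|[T1 o'] a] t T //=.
  by case=> _ h; split=> // k; rewrite leqn0 => /eqP ->.
case=> <- _ h /IH[-> H]; split=> // -[|k] //= kr; exact: H.
Qed.

Section Ranks.
Variables (n m : nat) (C : circuit n m) (rk : nat -> nat).
Local Notation G := (size (gates C)).
(** The rank provided by [wf_circuit] is arbitrary; counting gates of smaller rank normalises it
    below the number of gates, which bounds the stack. *)
Definition level v := #|[set u : 'I_G | rk u < rk v]|.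

Lemma level_lt v u : u < G -> rk u < rk v -> level u < level v.
Proof.
move=> uG uv; apply: proper_card; apply/properP; split.
  by apply/subsetP => x; rewrite !inE => /ltn_trans; apply.
by exists (Ordinal uG); rewrite !inE ?ltnn.
Qed.

Lemma level_le v : v < G -> level v < G.
Proof.
move=> vG; rewrite -[X in _ < X]card_ord -cardsT; apply: proper_card; apply/properP.
by split; [exact: subsetT|exists (Ordinal vG); rewrite !inE ?ltnn].
Qed.
End Ranks.

Section Labels.
Variables (n m : nat) (C : circuit n m).
Hypothesis smo : smooth C.
Local Notation G := (size (gates C)).
Variable rk : nat -> nat.
Hypothesis edges_lt : forall v u, v < G -> u \in edges C v -> u < G.
Hypothesis rk_lt : forall v u, v < G -> u \in edges C v -> rk u < rk v.

(** A value in a solution is the label of some input gate, hence bounded by the input words however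
    large the domain is. *)
Lemma restr_label v (tau : passign n m) x d : v < G -> restr_in_rel C v tau ->
  invar C v x -> tau x = Some d -> exists2 u, u < G & gate_at C u = GInp x d.
Proof.
have [r] := ubnP (rk v); elim: r v => // r IH v rv vG [sigma rs ag] ivx E.
case: rs vG rv ag ivx =>
  [v' y e s' Eg Es|v' us s' Eg _ H|v' us s' Eg _ [u uus [s2 r2 ag2]]] vG rv ag ivx.
- have Ex := (invar_inp x Eg).1 ivx; exists v' => //; rewrite Eg Ex.
  by move: E; rewrite -ag // Es Ex eqxx => -[->].
- have [|u uus ix] := (@invar_edges _ _ C v' x _).1 ivx; first by rewrite Eg.
  have us' : u \in us by move: uus; rewrite /edges Eg.
  have [s2 r2 ag2] := H u us'.
  apply: (IH u) ix E; [|exact: edges_lt uus|].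
    by apply: leq_trans (rk_lt vG uus) _.
  exists s2 => //; apply: agrees_sub ag2 ag => z iz.
  by apply/invar_edges; [rewrite Eg|exists u].
have uE : u \in edges C v' by rewrite /edges Eg.
have [|u' u's ix] := (@invar_edges _ _ C v' x _).1 ivx; first by rewrite Eg.
have {}ix : invar C u x.
  have {}u's : u' \in us by move: u's; rewrite /edges Eg.
  exact: (smo Eg u's uus x).1 ix.
apply: (IH u) ix E; [|exact: edges_lt uE|].
  by apply: leq_trans (rk_lt vG uE) _.
exists s2 => //; apply: agrees_sub ag2 ag => z iz.
by apply/invar_edges; [rewrite Eg|exists u].
Qed.

Definition inlen := size (encode C) + \max_(e <- encode C) e + 2.

Lemma encode_nth i : (nth 0 (encode C) i).+1 < inlen.
Proof.
rewrite /inlen; case: (ltnP i (size (encode C))) => h; last by rewrite nth_default // addn2.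
have := @leq_bigmax_seq _ (encode C) xpredT id _ (mem_nth 0 h) isT => /=; lia.
Qed.

Lemma gate_label u x d : u < G -> gate_at C u = GInp x d -> d.+1 < inlen.
Proof.
move=> uG E; have [|Ed _] := @encode_gate _ _ C u uG 2; first by rewrite E.
move: Ed; rewrite E /= => Ed.
by have := encode_nth (nth 0 (encode C) (u + 2) + 2); rewrite Ed.
Qed.

End Labels.

(** * Linear preprocessing, logarithmic delay and word size *)

Section Bounds.
Variable n : nat.

Definition slope := 124 * (2 * n + 4).

Lemma popcost_le k : popcost n k <= slope * k.+1.
Proof.
rewrite /popcost /pushcost /slope mulnS.
have -> : 2 * n * (93 * k + 100 + 24) = 186 * (n * k) + 248 * n by lia.
have -> : 124 * (2 * n + 4) * k = 248 * (n * k) + 496 * k by lia.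
by lia.
Qed.

Definition offset := slope * (4 * n + 10) + 10.

Lemma gapb_le k : gapb n k <= offset * (trunc_log 2 k.+1).+1.
Proof.
rewrite /gapb /logb /offset; set L := (trunc_log _ _).+1.
have h := popcost_le (4 * n + 3 + 2 * L).
have L0 : 0 < L by []; rewrite mulnDl.
suff : slope * (4 * n + 3 + 2 * L).+1 <= slope * (4 * n + 10) * L by lia.
rewrite -mulnA leq_mul2l; apply/orP; right; rewrite mulnDl.
have : 4 * n <= 4 * n * L by rewrite leq_pmulr.
lia.
Qed.

Definition precost := 700 + 14 * (offset + 2 * slope + 34).

(** [z] is about the square root of [M]. Bounding the logarithm crudely by [z], each buffered output
    costs [O(z)], so the buffer costs [O(z ^ 2)], which is linear in [s]. *)
Lemma precost_le s M T z : z.-1 * z.-1 < M -> M <= 2 * s + 3 -> T <= 400 * s + 300 ->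
  T + 4 * z + bufcost n (logb n z.+1) z + 10 <= precost * s.+1.
Proof.
move=> zM Ms Ts; set K := logb n z.+1.
have hK : K <= 4 * n + 9 + 2 * z.
  rewrite /K /logb; suff : trunc_log 2 z.+2 <= z.+2 by lia.
  apply: leq_trans (ltnW (ltn_expl _ (ltnSn 1))) _; exact: trunc_logP.
have h1 : bufcost n K z <= z.+1 * (popcost n K + 10) + 20.
  by rewrite /bufcost mulSn /popcost; lia.
have h2 : popcost n K + 10 <= offset + 2 * slope * z.
  apply: leq_trans (leq_add (popcost_le K) (leqnn _)) _.
  have : slope * K.+1 <= slope * (4 * n + 10 + 2 * z) by rewrite leq_mul2l; apply/orP; right; lia.
  by rewrite /offset mulnDr -!mulnA (mulnCA 2); lia.
have h3 : offset + 2 * slope * z <= (offset + 2 * slope) * z.+1.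
  by rewrite mulnDl leq_add // ?leq_pmulr // leq_mul2l leqnSn orbT.
have h4 : z.+1 * (popcost n K + 10) <= (offset + 2 * slope) * (z.+1 * z.+1).
  rewrite mulnCA leq_mul2l; apply/orP; right; exact: leq_trans h2 h3.
set q := offset + 2 * slope in h3 h4.
have h5 : z.+1 * z.+1 <= 4 * s + 14.
  (* For [z = y + 1] the two sides differ by [(y - 2) ^ 2]. *)
  have : z.+1 * z.+1 <= 2 * (z.-1 * z.-1) + 8.
    case: (z) => //= y; have [+ _] := nat_AGM2 y 2.
    by rewrite -mulnn; lia.
  lia.
have h6 : q * (z.+1 * z.+1) <= q * (4 * s + 14) by rewrite leq_mul2l h5 orbT.
have h7 : q * (4 * s + 14) <= 14 * q * s.+1 by rewrite (mulnC 14) -mulnA leq_mul2l; lia.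
have h8 : z <= z.+1 * z.+1 by rewrite mulSn; lia.
rewrite /precost -/q; move: h1 h4 h6 h7; set u := popcost _ _; lia.
Qed.
End Bounds.

(** Constants depending on [n] are absorbed by powers of [N] through [n < N ^ n]. *)
Lemma vbound_le n N M Z : 2 <= N -> M <= 2 * N -> Z <= N ^ n ->
  8 * (M + (4 * n + 2) * Z.+1 + 1) <= N ^ (2 * n + 8) /\ M * M < N ^ (2 * n + 8).
Proof.
move=> N2 MN ZN; have Nn : n < N ^ n by rewrite ltn_expl.
split; last first.
  have h4 : M * M <= 4 * (N * N) by have := leq_mul MN MN; lia.
  apply: leq_ltn_trans h4 _.
  have -> : N ^ (2 * n + 8) = N ^ (2 * n + 6) * (N * N) by rewrite mulnn -expnD -addnA.
  rewrite ltn_mul2r muln_gt0; have : 2 * n + 6 < N ^ (2 * n + 6) by rewrite ltn_expl.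
  lia.
have -> : N ^ (2 * n + 8) = N ^ n * N * (N ^ n * N ^ 7).
  by rewrite -expnSr -!expnD; congr (_ ^ _); lia.
have h7 : 64 * n + 64 <= N ^ n * N ^ 7.
  have h2 : 2 ^ 7 <= N ^ 7 by rewrite leq_exp2r.
  by apply: leq_trans (leq_mul Nn h2); rewrite (_ : 2 ^ 7 = 128) //; lia.
apply: (@leq_trans (N ^ n * N * (64 * n + 64))); last by rewrite leq_mul2l h7 orbT.
have a1 : N <= N ^ n * N by rewrite leq_pmull; lia.
have a2 : N ^ n * 2 <= N ^ n * N by rewrite leq_mul2l N2 orbT.
have a3 : (4 * n + 2) * Z.+1 <= (4 * n + 2) * (N ^ n * N).
  by rewrite leq_mul2l; apply/orP; right; lia.
by move: (N ^ n * N) a1 a2 a3 => u; lia.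
Qed.

Lemma word_le n N : 2 <= N ->
  obase n + (N ^ (2 * n + 8)).+1 * width n <= N ^ (5 * n + 16).
Proof.
move=> N2; rewrite /obase /width; set V := N ^ _.
have V0 : 0 < V by rewrite expn_gt0; lia.
have -> : N ^ (5 * n + 16) = V * (N ^ n * N ^ (2 * n + 8)).
  by rewrite /V -!expnD; congr (_ ^ _); lia.
have h : 256 * (n + 1) <= N ^ n * N ^ (2 * n + 8).
  have h1 : n < N ^ n by rewrite ltn_expl.
  have h2 : 2 ^ 8 <= N ^ (2 * n + 8).
    apply: (@leq_trans (N ^ 8)); first by rewrite leq_exp2r.
    by rewrite leq_pexp2l; lia.
  by apply: leq_trans (leq_mul h1 h2); rewrite (_ : 2 ^ 8 = 256) //; lia.
apply: (@leq_trans (V * (256 * (n + 1)))); last by rewrite leq_mul2l h orbT.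
have : n <= V * n by rewrite leq_pmull.
lia.
Qed.

(** Solutions are functions from the variables to the at most [N] values that can occur as
    labels. *)
Lemma nsol_le n m (C : circuit n m) (t : tree n m) :
  (forall tau x d, msem t tau -> tau x = Some d -> d.+1 < inlen C) ->
  (forall tau x, msem t tau -> tau x != None) -> nsol t <= inlen C ^ n.
Proof.
move=> lab full; set N := inlen C in lab *.
pose A := [pred o : option 'I_m | if o is Some d then d < N else false].
have AN : #|A| <= N.
  rewrite -(size_iota 0 N) cardE.
  rewrite -(size_map (fun o : option 'I_m => if o is Some d then val d else 0)).
  apply: uniq_leq_size.
    rewrite map_inj_in_uniq ?enum_uniq // => -[d|] [d'|]; rewrite !mem_enum //= => _ _ E.
    by congr Some; apply: val_inj.
  by move=> x /mapP[[d|]]; rewrite mem_enum // => dN ->; rewrite mem_iota.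
apply: (@leq_trans (#|A| ^ n)); last by case: (n) => // k; rewrite leq_exp2r.
rewrite -[X in _ ^ X]card_ord -card_ffun_on; apply: subset_leq_card.
apply/subsetP => tau st; apply/ffun_onP => x; rewrite inE.
case E: (tau x) => [d|]; first by have := lab _ _ _ st E; apply: ltn_trans.
by have := full _ x st; rewrite E.
Qed.

Definition prog n := compile n 0 c_main ++ [:: IHalt].
(** One number serves as time factor and as exponent of the word bound; being a sum, it dominates
    what each use requires. *)
Definition const n := KC n * (precost n + offset n) + (5 * n + 16).

Theorem theorem4p1 (n : nat) :
  exists (P : seq instr) (c : nat),
    forall (R : realType) (m : nat) (C : circuit n m) (w : passign n m -> R),
      wf_circuit C -> covers_all_vars C -> smooth_dDNNF C -> subset_monotone w ->
      enumerates P c C w.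
Proof.
exists (prog n), (const n) => R m C w [oG we ne [rk0 rk0_lt]] cov [dec smo det] mono.
have edges_lt v u : v < size (gates C) -> u \in edges C v -> u < size (gates C).
  by move=> vG uv; have /andP[/allP h _] := we v vG; apply: h.
have edges_uniq v : v < size (gates C) -> uniq (edges C v).
  by move=> vG; have /andP[] := we v vG.
have rk_lt v u : v < size (gates C) -> u \in edges C v -> level C rk0 u < level C rk0 v.
  by move=> vG uv; apply: level_lt; [exact: edges_lt uv|exact: rk0_lt].
have N2 : 2 <= inlen C by rewrite /inlen leq_addl.
set V := inlen C ^ (2 * n + 8).
have NV : inlen C < V.
  rewrite -[X in X < _]expn1 ltn_exp2l //; lia.
have HB : obase n + V.+1 * width n <= word_bound (const n) (encode C).
  apply: leq_trans (word_le n N2) _; apply: (leq_pexp2l (ltnW N2)).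
  exact: leq_addl.
have V4 : 4 <= V by apply: leq_trans (ltn_expl _ N2); lia.
have HI1 i : (nth 0 (encode C) i).+1 < V by apply: ltn_trans (encode_nth C i) NV.
have HI i : nth 0 (encode C) i < V by apply: ltnW.
have sN : size (encode C) <= inlen C by rewrite /inlen; lia.
have GS := encode_size C.
have HS : size (encode C) < V by apply: leq_ltn_trans NV.
pose Q (s : hst n m) := exists t, [/\ grepr w C (outg C) t, wft w t, vars t = setT
  & final w t (precost n * (circuit_size C).+1) s].
have := @wp_exec n m R (prog n) _ V (encode C) w V4 HB c_main Q (erefl _) wfc_main.
case.
  rewrite /c_main; apply: (wp_seq V4 HB).
  apply: (wp_dfs (erefl _) V4 HB HI HI1 HS dec smo det edges_lt edges_uniq ne
    rk_lt (@level_le _ _ C rk0) (X := inlen C)) => //.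
    exact: leq_trans GS sN.
  move=> s t gt rt tN T0 tr0 tms cnt; have [wt vt st] := gt.
  have vT : vars t = setT by apply/setP => x; rewrite inE; apply/vt/cov.
  have full tau x : msem t tau -> tau x != None.
    by move=> h; apply: (msem_some wt h); rewrite vT inE.
  have lab tau x d : msem t tau -> tau x = Some d -> d.+1 < inlen C.
    move=> /st h E; have [u uG Eu] := restr_label smo edges_lt rk0_lt oG h (cov x) E.
    exact: gate_label uG Eu.
  have N0 : 0 < rg s 0 by apply: leq_ltn_trans tN.
  have MN : rg s 0 <= 2 * inlen C by lia.
  have [b1 b2] := vbound_le N2 MN (nsol_le lab full).
  apply: (@wp_enumerate _ _ _ _ _ _ _ _ V4 HB mono t wt vT _ b1) => //.
  move=> s' z zM fin; exists t; split=> //.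
  case: fin => f1 f2 [f3 f4]; split=> //; split=> //; apply: leq_trans f4 _.
  exact: precost_le zM cnt tms.
move=> s [fuel [real [T [E [t [gt wt vT [em pc [s0 first_]]]] sim]]]].
have [Eo times] := simt_times sim.
exists fuel, real, T; split=> //.
have outs_sem tau : (tau \in map snd real) = msem t tau.
  by have [/(_ tau) + _ _] := em; rewrite Eo addn0 -has_pred1 has_count => ->; case: msem.
have szr : size real = size (tr s) by rewrite -(size_map snd) Eo size_map.
have [[_ _ st] [_ srt _]] := (gt, em).
have full tau x : msem t tau -> tau x != None.
  by move=> h; apply: (msem_some wt h); rewrite vT inE.
split.
- split; first by rewrite Eo; exact: emitted_uniq em.
  by apply/allP => tau; rewrite outs_sem => h; apply/forallP => x; exact: full.
- move=> a; rewrite outs_sem st; split=> [[sigma r ag]|r]; last by exists (Defs.lift a).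
  by have <- : sigma = Defs.lift a by apply/ffunP => x; exact: ag.
- by rewrite Eo.
- have := times 0 (leq0n _); rewrite /= add0n subn0 => h; apply: leq_trans h _.
  rewrite nth_rcons size_map s0.
  apply: (@leq_trans (KC n * (precost n * (circuit_size C).+1))).
    by rewrite leq_mul2l first_ orbT.
  by rewrite mulnA leq_mul2r /const mulnDr; apply/orP; right; lia.
case=> // k; rewrite size_rcons size_map ltnS => /andP[_ ks].
have h := times k.+1 ks.
have := pc k.+1; rewrite size_rcons size_map ltnS -szr ks => /(_ isT) h2.
rewrite leq_subLR; apply: leq_trans h _; rewrite leq_add2l.
apply: (@leq_trans (KC n * (offset n * (trunc_log 2 k.+2).+1))).
  rewrite leq_mul2l; apply/orP; right; apply: leq_trans (gapb_le n k.+1).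
  by rewrite leq_subLR.
by rewrite mulnA leq_mul2r /const; apply/orP; right; rewrite mulnDr; lia.
Qed.
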